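(* Let $\lambda=\pi^2/18$. Then: (i) $\displaystyle\limsup_{p\to 0}\ \sup_{m\ge 1}\ \bigl(-p\log I(m,p)\bigr)\le 2\lambda$, where the supremum is over positive integers $m$; (ii) $\displaystyle\liminf_{B\to\infty}\ \liminf_{p\to 0}\ \bigl(-p\log I(\lfloor B/p\rfloor,p)\bigr)\ge 2\lambda$.
   Context: Here $p\to0$ through $p\in(0,1)$, $B$ is a positive real, and $\lfloor\cdot\rfloor$ denotes the integer part. Bootstrap percolation on $\mathbb{Z}^2$: for a site $x\in\mathbb{Z}^2$ let $N(x)=\{y\in\mathbb{Z}^2:\|x-y\|=1\}$ (Euclidean norm). For $K\subseteq\mathbb{Z}^2$ let $\mathcal{B}(K)=K\cup\{x\in\mathbb{Z}^2:|N(x)\cap K|\ge 2\}$ and $\langle K\rangle=\lim_{t\to\infty}\mathcal{B}^t(K)=\bigcup_{t\ge 0}\mathcal{B}^t(K)$, where $\mathcal{B}^t$ is the $t$-th iterate. For $p\in[0,1]$, let $X\subseteq\mathbb{Z}^2$ be the random set in which each site is included independently with probability $p$, and let $P_p$ denote the corresponding product probability measure. A set $K\subseteq\mathbb{Z}^2$ is internally spanned if $\langle X\cap K\rangle=K$. For a positive integer $L$ let $R(L,L)=\{1,\dots,L\}\times\{1,\dots,L\}$ and $I(L,p)=P_p(R(L,L)\text{ is internally spanned})$. *)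

(* Defs.v *)
From HB Require Import structures.
From mathcomp Require Import all_boot all_order all_algebra.
From mathcomp Require Import all_classical all_reals all_analysis.
From mathcomp Require Import measurable_realfun ring lra.

Set Implicit Arguments.
Unset Strict Implicit.
Unset Printing Implicit Defensive.

Import Order.TTheory GRing.Theory Num.Theory.
Import numFieldNormedType.Exports.

Local Open Scope classical_set_scope.
Local Open Scope ring_scope.

Notation Z2 := (int * int)%type.

(* The Euclidean distance is 1 exactly when its square, an integer, is 1. *)
Definition nbhd (x : Z2) : set Z2 :=
  [set y | (x.1 - y.1) ^+ 2 + (x.2 - y.2) ^+ 2 = 1].

(* [`I_2 #<= A] says that the set A has at least two elements. *)
Definition boot_step (K : set Z2) : set Z2 :=
  K `|` [set x | (`I_2 #<= nbhd x `&` K)%card].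

Definition boot_span (K : set Z2) : set Z2 := \bigcup_t iter t boot_step K.

Definition internally_spanned (X K : set Z2) : Prop :=
  boot_span (X `&` K) = K.

Definition square (L : nat) : set Z2 :=
  [set x | (1 <= x.1 <= L%:Z) /\ (1 <= x.2 <= L%:Z)].

(* Configurations are subsets of Z^2, with the product sigma-algebra, i.e. the
   one generated by the events "x is occupied". *)
Definition site_events : set (set (set Z2)) :=
  range (fun x : Z2 => [set X : set Z2 | X x]).

Definition config := g_sigma_algebraType site_events.

Definition cylinder (occ vac : seq Z2) : set config :=
  [set X | (forall x, x \in occ -> X x) /\ (forall x, x \in vac -> ~ X x)].

Definition is_product_measure (R : realType) (p : R)
    (P : probability config R) : Prop :=
  forall occ vac : seq Z2, uniq (occ ++ vac) ->
    P (cylinder occ vac) = (p ^+ size occ * (1 - p) ^+ size vac)%:E.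

Section Existence.
Variables (R : realType) (p : R).
Hypothesis p01 : 0 <= p <= 1.

(* On [0, 1[ this map preserves Lebesgue measure and is independent of the
   event u < p, so that its iterates encode independent Bernoulli trials. *)
Let shift (u : R) : R := if u < p then u / p else (u - p) / (1 - p).
Let trial (n : nat) (u : R) : bool := iter n shift u < p.

Let wt (b : option bool) : R :=
  if b is Some b then (if b then p else 1 - p) else 1.

(* The first (size c) trials agree with c, where None is unconstrained. *)
Fixpoint trial_pattern (c : seq (option bool)) (u : R) : bool :=
  if c is o :: c' then
    (if o is Some b then (u < p) == b else true) && trial_pattern c' (shift u)
  else true.

Let shift01 u : 0 <= u < 1 -> 0 <= shift u < 1.
Proof.
move=> /andP[u0 u1]; rewrite /shift; case: ltP => up.
  have p0 : 0 < p by exact: le_lt_trans up.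
  by rewrite divr_ge0 ?(ltW p0)//= ltr_pdivrMr // mul1r.
have p1 : 0 < 1 - p by rewrite subr_gt0 (le_lt_trans up).
by rewrite divr_ge0 ?subr_ge0 ?(ltW p1)//= ?ltr_pdivrMr ?mul1r ?ltrD2r// -subr_ge0 ltW.
Qed.

Let wt_ge0 b : 0 <= wt b.
Proof. by case/andP: p01 => ? ?; case: b => [[]|] //=; rewrite subr_ge0. Qed.

Let W (c : seq (option bool)) : R := \prod_(o <- c) wt o.

Let pattern_itv (w : seq bool) : exists a : R, [/\ 0 <= a, a + W (map Some w) <= 1 &
  forall u, 0 <= u < 1 ->
    trial_pattern (map Some w) u = (a <= u < a + W (map Some w))].
Proof.
case/andP: (p01) => p0 p1.
elim: w => [|b w [a [a0 a1 aP]]].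
  by exists 0; rewrite /W big_nil add0r; split=> // u ->.
have W0 : 0 <= W (map Some w) by apply: prodr_ge0 => i _; exact: wt_ge0.
rewrite /W /= big_cons -/(W _) /=; move: (W _) W0 a1 aP => l l0 a1 aP.
case: b => /=.
- exists (p * a); split; [by rewrite mulr_ge0|by nra|] => u u01.
  rewrite eqb_id aP ?shift01// /shift; case: ltP => up /=; last first.
    apply/esym/negbTE; apply/negP => /andP[h1 h2]; nra.
  have pp : 0 < p by lra.
  by rewrite ler_pdivlMr// ltr_pdivrMr// mulrC -mulrDr (mulrC p (_ + _)).
- exists (p + (1 - p) * a); split; [by nra|by nra|] => u u01.
  rewrite eqbF_neg -leNgt aP ?shift01// /shift; case: ltP => up /=.
    apply/esym/negbTE; apply/negP => /andP[h1 h2]; nra.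
  have pp : 0 < 1 - p by lra.
  rewrite ler_pdivlMr// ltr_pdivrMr// lerBrDl ltrBlDl.
  by apply/idP/idP => /andP[h1 h2]; apply/andP; split; nra.
Qed.

Let mshift : measurable_fun setT shift.
Proof.
apply: measurable_fun_ifT; first exact: measurable_fun_ltr.
- exact: measurable_funM.
- by apply: measurable_funM => //; exact: measurable_funB.
Qed.

Let mpattern c : measurable_fun setT (trial_pattern c).
Proof.
elim: c => [|o c IH] /=; first exact: measurable_cst.
apply: measurable_and; last exact: measurableT_comp IH mshift.
case: o => [b|]; last exact: measurable_cst.
have mlt : measurable_fun [set: R] (fun u : R => u < p).
  exact: measurable_fun_ltr.
case: b; first by under eq_fun do rewrite eqb_id.
by under eq_fun do rewrite eqbF_neg; exact: measurable_neg.
Qed.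

Let mtrial n : measurable_fun setT (trial n).
Proof.
rewrite /trial; apply: measurable_fun_ltr => //.
elim: n => [|n IH] /=; first exact: measurable_id.
exact: measurableT_comp mshift IH.
Qed.

Let U : set R := `[0, 1[.
Let mU : measurable U. Proof. exact: measurable_itv. Qed.
Let mu := mrestr (@lebesgue_measure R) mU.

Let mpatternS c : measurable [set u | trial_pattern c u].
Proof. by have := mpattern c measurableT (Y := [set true]) I; rewrite setTI. Qed.

Let mu_pattern c w : mu [set u | trial_pattern (map Some w ++ c) u] = (W (map Some w ++ c))%:E.
Proof.
elim: c w => [|o c IH] w.
  rewrite cats0; have [a [a0 a1 aP]] := pattern_itv w.
  have -> : mu [set u | trial_pattern (map Some w) u]
      = lebesgue_measure (`[a, a + W (map Some w)[ : set R).
    rewrite /mu /mrestr; congr (lebesgue_measure _).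
    apply/seteqP; split=> u /=; rewrite /U /= !in_itv /=.
      by case=> + u01; rewrite aP.
    move=> au; have u01 : 0 <= u < 1 by lra.
    by rewrite aP.
  have W0 : 0 <= W (map Some w) by apply: prodr_ge0 => i _; exact: wt_ge0.
  rewrite lebesgue_measure_itv /= lte_fin ltrDl lt_neqAle W0 andbT.
  case: eqVneq => [<-//|_]; by rewrite -EFinB addrC addKr.
case: o => [b|].
  have -> : [seq Some i | i <- w] ++ Some b :: c
    = [seq Some i | i <- rcons w b] ++ c by rewrite map_rcons cat_rcons.
  exact: IH.
have patternE u : trial_pattern (map Some w ++ None :: c) u =
    trial_pattern (map Some (rcons w true) ++ c) u || trial_pattern (map Some (rcons w false) ++ c) u.
  elim: w u {IH} => [|b w IHw] u /=; first by case: (u < p) => /=; rewrite ?orbF.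
  by rewrite IHw andb_orr.
have patternD u : ~ (trial_pattern (map Some (rcons w true) ++ c) u /\
    trial_pattern (map Some (rcons w false) ++ c) u).
  elim: w u {IH patternE} => [|b w IHw] u /=; first by case: (u < p) => -[].
  by case=> /andP[_ h1] /andP[_ h2]; exact: (IHw (shift u)).
have -> : [set u | trial_pattern (map Some w ++ None :: c) u] =
    [set u | trial_pattern (map Some (rcons w true) ++ c) u] `|`
    [set u | trial_pattern (map Some (rcons w false) ++ c) u].
  by apply/seteqP; split=> u /=; rewrite patternE => /orP.
have muU (A B : set R) : measurable A -> measurable B -> A `&` B = set0 ->
  mu (A `|` B) = (mu A + mu B)%E by move=> *; exact: measureU.
rewrite muU //; last by rewrite -subset0 => u /= /patternD.
rewrite !IH -EFinD; congr EFin.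
rewrite /W !big_cat/= !map_rcons -!cats1 !big_cat /= !big_cons !big_nil /=; ring.
Qed.

Let patternE c u : trial_pattern c u = all (fun i =>
  if nth None c i is Some b then trial i u == b else true) (iota 0 (size c)).
Proof.
elim: c u => [//|o c IH] u /=; rewrite IH; congr (_ && _).
rewrite -[1%N]addn0 iotaDl all_map; apply: eq_all => i /=.
by rewrite /trial -iterSr.
Qed.

Let field (u : R) : config := [set x | trial (pickle x) u].

Let mfield : measurable_fun setT field.
Proof.
apply: (@measurability _ _ _ config setT field site_events) => //.
move=> _ [_ [x _ <-] <-]; rewrite setTI.
by have := mtrial (pickle x) measurableT (Y := [set true]) I; rewrite setTI.
Qed.

Definition trial_law : set config -> \bar R := pushforward mu field.

Let law0 : trial_law set0 = 0%E.
Proof. by rewrite /trial_law /pushforward preimage_set0 [LHS]measure0. Qed.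
Let law_ge0 A : (0 <= trial_law A)%E.
Proof. exact: measure_ge0. Qed.
Let law_sigma : semi_sigma_additive trial_law.
Proof. by apply: measure_semi_sigma_additive; exact: mfield. Qed.
Let lawT : trial_law setT = 1%E.
Proof.
rewrite /trial_law /pushforward preimage_setT /mu /mrestr setTI lebesgue_measure_itv /=.
by rewrite lte_fin ltr01 -EFinB subr0.
Qed.

HB.instance Definition _ := isMeasure.Build _ _ _ trial_law law0 law_ge0 law_sigma.
HB.instance Definition _ := Measure_isProbability.Build _ _ _ trial_law lawT.

Lemma product_measure_exists : exists P : probability config R, is_product_measure p P.
Proof.
exists trial_law => occ vac ov_uniq.
pose so := map pickle occ; pose sv := map pickle vac.
have pickle_inj : injective (@pickle Z2) by exact: (pcan_inj pickleK).
have /[!cat_uniq]/and3P[uo /hasPn ovD uv] : uniq (so ++ sv).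
  by rewrite -map_cat map_inj_uniq.
pose N := (\max_(i <- so ++ sv) i).+1.
have ltN i : i \in so ++ sv -> (i < N)%N.
  by move=> iov; rewrite /N ltnS; exact: (@leq_bigmax_seq _ _ xpredT id).
pose f i := if i \in so then Some true else
            if i \in sv then Some false else None.
have [c cE] : exists c, c = mkseq f N by exists (mkseq f N).
have szc : size c = N by rewrite cE size_mkseq.
have nthc i : (i < N)%N -> nth None c i = f i by move=> ?; rewrite cE nth_mkseq.
transitivity (mu [set u | trial_pattern c u]).
  congr (mu _); apply/seteqP; split=> u /=; rewrite patternE szc.
    move=> [uo1 uv0]; apply/allP => i; rewrite mem_iota add0n => /andP[_ iN].
    rewrite nthc// /f; case: ifPn => [/mapP[x xo ->]|_].
      by rewrite eqb_id; exact: uo1.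
    case: ifPn => [/mapP[x xv ->]|//].
    by rewrite eqbF_neg; apply/negP; exact: uv0.
  move=> /allP H; split=> x xx.
    have xi : pickle x \in so by exact: map_f.
    have xN : (pickle x < N)%N by apply: ltN; rewrite mem_cat xi.
    have := H (pickle x); rewrite mem_iota add0n xN => /(_ isT).
    by rewrite nthc// /f xi eqb_id.
  have xi : pickle x \in sv by exact: map_f.
  have xN : (pickle x < N)%N by apply: ltN; rewrite mem_cat xi orbT.
  have := H (pickle x); rewrite mem_iota add0n xN => /(_ isT).
  by rewrite nthc// /f (negbTE (ovD _ xi)) xi eqbF_neg => /negP.
rewrite (mu_pattern _ [::]) cE; congr EFin.
have prodS (s : seq nat) (x : R) : uniq s -> {in s, forall i, (i < N)%N} ->
    \prod_(i <- iota 0 N | i \in s) x = x ^+ size s.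
  move=> us sN; rewrite -big_filter.
  have -> : size s = size [seq i <- iota 0 N | i \in s]; last first.
    by elim: [seq i <- _ | _] => [|j t IHt]; rewrite ?big_nil// big_cons IHt exprS.
  apply: perm_size; apply: uniq_perm => //.
    by rewrite filter_uniq ?iota_uniq.
  move=> i; rewrite mem_filter mem_iota add0n leq0n andTb.
  by case: (boolP (i \in s)) => //= /sN ->.
rewrite /W /= big_map -[size occ](size_map pickle) -[size vac](size_map pickle).
rewrite -!prodS//; [|by move=> i ii; apply: ltN; rewrite mem_cat ii ?orbT..].
rewrite [X in _ = X * _]big_mkcond [X in _ = _ * X]big_mkcond -big_split /=.
apply: eq_bigr => i _; rewrite /f -/so -/sv.
case: (boolP (i \in so)) => io; case: (boolP (i \in sv)) => iv /=;
  rewrite ?mulr1 ?mul1r//.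
by have := ovD _ iv; rewrite io.
Qed.

End Existence.

Lemma cylinder_measurable (occ vac : seq Z2) : measurable (cylinder occ vac).
Proof.
have mx (x : Z2) : measurable ([set X | X x] : set config).
  by apply: sub_sigma_algebra; exists x.
have -> : cylinder occ vac =
    (\bigcap_(x in [set` occ]) [set X | X x]) `&`
    (\bigcap_(x in [set` vac]) ~` [set X | X x]).
  by apply/seteqP; split.
apply: measurableI; apply: fin_bigcap_measurable => // x _.
exact: measurableC.
Qed.

Lemma product_measure_unique (R : realType) (p : R)
    (P Q : probability config R) :
  is_product_measure p P -> is_product_measure p Q ->
  forall A : set config, measurable A -> P A = Q A.
Proof.
move=> hP hQ; pose G : set (set config) := range (cylinder^~ [::]).
apply: (@measure_unique _ R config G (fun=> setT)).
- apply/seteqP; split; apply: smallest_sub; try exact: smallest_sigma_algebra.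
    move=> _ [x _ <-]; apply: sub_sigma_algebra; exists [:: x] => //.
    apply/seteqP; split=> X /=.
      by case=> h _; apply: h; rewrite mem_head.
    by move=> Xx; split=> // y; rewrite inE => /eqP ->.
  by move=> _ [s _ <-]; exact: cylinder_measurable.
- move=> _ _ [s _ <-] [t _ <-]; exists (s ++ t) => //.
  apply/seteqP; split=> X /=.
    move=> [h _]; split; split=> // x xs; apply: h; rewrite mem_cat xs ?orbT//.
  move=> [[h1 _] [h2 _]]; split=> // x; rewrite mem_cat => /orP[]; auto.
- move=> _; exists [::] => //; apply/seteqP; split=> X //=.
- by apply/seteqP; split=> // X _; exists 0%N.
- move=> _ [s _ <-].
  have -> : cylinder s [::] = cylinder (undup s) [::].
    by apply/seteqP; split=> X /= [h _]; split=> // x xs; apply: h;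
      move: xs; rewrite mem_undup.
  have us : uniq (undup s ++ [::]) by rewrite cats0 undup_uniq.
  exact: etrans (hP _ _ us) (esym (hQ _ _ us)).
- by move=> _; apply: le_lt_trans (probability_le1 P measurableT) (ltry 1).
Qed.

Lemma product_measure_total (R : realType) (p : R) :
  exists P : probability config R, 0 <= p <= 1 -> is_product_measure p P.
Proof.
case: (boolP (0 <= p <= 1)) => [|_].
  by case/product_measure_exists => P hP; exists P.
have [//|P _] := @product_measure_exists R 0 _; first by rewrite lexx ler01.
by exists P.
Qed.

(* For 0 <= p <= 1 this is the product measure, by [site_lawP], and it is the
   only one, by [product_measure_unique]; outside that range it is junk. *)
Definition site_law (R : realType) (p : R) : probability config R :=
  sval (cid (product_measure_total p)).

Lemma site_lawP (R : realType) (p : R) :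
  0 <= p <= 1 -> is_product_measure p (site_law p).
Proof. exact: (svalP (cid (product_measure_total p))). Qed.

(* The event constrains only the sites of the square, hence is measurable. *)
Definition span_prob (R : realType) (L : nat) (p : R) : \bar R :=
  site_law p [set X | internally_spanned X (square L)].

Definition lambda (R : realType) : R := pi ^+ 2 / 18.

(* Main.v *)
(* Write g(z) = - ln (beta (1 - e^{-z})), where beta(u) is the largest root of
   b^2 = u b + u (1 - u): a strip of k sites across and n sites along has no two
   consecutive vacant cross-sections with probability about e^{- n g(q k)}, where
   q = - ln (1 - p).  The integral of g over ]0, +oo[ is pi^2/18.

   For (i), a filled square of side m extends to one of side m + n when the strips to the
   east and to the north of it have no two consecutive vacant columns (rows) and an
   occupied last one.  Growing from a single site by blocks of side about h / p costs in
   total at most (2 lambda + o(1)) / p, whatever the final side is.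

   For (ii), let pot(a, b) be the cheapest cost of growing an a x b rectangle,
   2 sum_{k < m} g(k) + (M - m) g(m) with m and M the minimum and the maximum of a and b;
   by convexity of g it is subadditive under merging of neighbouring rectangles, up to
   O(g(0)).  By induction on the semi-perimeter, a rectangle K is internally spanned with
   probability at most p^{-O(1)} e^{- pot K}: either K is thin (a seed), or descending
   through spanning subrectangles one reaches a rectangle S, slightly smaller than K, that
   is the hull of two much smaller rectangles spanned disjointly.  The BK inequality
   handles these two, and growing from S to K requires the strips around S to have no two
   consecutive vacant columns or rows.  Shifting the argument of g by Z > 0 keeps g(0)
   finite, and a factor 1 - eps absorbs the dependence between columns and rows through
   the corners. *)
Require Import Defs.
From mathcomp Require Import all_boot all_order all_algebra.
From mathcomp Require Import all_classical all_reals all_analysis.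
From mathcomp Require Import zify ring lra.
Import Order.TTheory GRing.Theory Num.Theory.
Import numFieldNormedType.Exports.
Local Open Scope classical_set_scope.
Local Open Scope ring_scope.
Set Implicit Arguments.
Unset Strict Implicit.
Unset Printing Implicit Defensive.

(** * Finite product measures and the van den Berg--Kesten inequality *)

(** The crux of (ii) is the size of the descent step [T], about [tau / p]. Each level of the
    induction squares the polynomial factor in 1/p (two children) and multiplies it by the number of
    triples of rectangles, so the number of levels must stay bounded as p -> 0; hence [T] has order
    1/p. On the other hand, growing by n columns and m rows involves at most n m corner sites, each
    of which is occupied with probability p and spoils the independence of rows and columns. Since n
    m p <= (n + m) T p, this costs a small multiple of n + m as soon as [T * p] is small; so [tau]
    is a small constant, chosen after [eps]. Seeds have a side of at most [eta / p]: there g is so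
    large that crossing the long side alone beats the crude bound (a + b) g(0) on the potential. The
    value of lambda comes from z(t) = ln(1 - t^3) - ln(1 - t^2): integration by parts and the
    symmetry of the curve turn the integral of g into twice that of z(t)/t over ]0, 1[, which is 2
    (1/2 - 1/3) zeta(2). *)

Definition iver (R : realType) (P : Prop) : R := (`[<P>])%:R.
Notation "'1[ P ]" := (iver _ P) (at level 0, P at level 200).

Section Expectation.
Variables (R : realType) (T : eqType) (p : R).
Implicit Types (s : seq T) (F G : set T -> R) (w D : set T).

Lemma iver_ge0 (P : Prop) : 0 <= '1[P] :> R.
Proof. by rewrite /iver; case: asbool. Qed.

Lemma iver_le1 (P : Prop) : '1[P] <= 1 :> R.
Proof. by rewrite /iver; case: asbool; rewrite ?ler01. Qed.

Lemma iverT (P : Prop) : P -> '1[P] = 1 :> R.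
Proof. by move=> h; rewrite /iver asboolT. Qed.

Lemma iverF (P : Prop) : ~ P -> '1[P] = 0 :> R.
Proof. by move=> h; rewrite /iver asboolF. Qed.

Lemma le_iver (P Q : Prop) : (P -> Q) -> '1[P] <= '1[Q] :> R.
Proof.
move=> PQ; case: (pselect P) => h; first by rewrite (iverT h) (iverT (PQ h)).
by rewrite (iverF h) iver_ge0.
Qed.

Lemma eq_iver (P Q : Prop) : (P <-> Q) -> '1[P] = '1[Q] :> R.
Proof. by move=> PQ; congr ((_ : bool)%:R); exact: asbool_equiv_eq. Qed.

Lemma iver_and (P Q : Prop) : '1[P /\ Q] = '1[P] * '1[Q] :> R.
Proof. by rewrite /iver asbool_and -natrM mulnb. Qed.

Lemma iver_not (P : Prop) : '1[~ P] = 1 - '1[P] :> R.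
Proof.
by case: (pselect P) => h; [rewrite (iverT h) iverF ?subrr|rewrite (iverF h) iverT ?subr0].
Qed.

(* Expectation when the sites of [s] are occupied independently with
   probability [p] and all other sites are vacant. *)
Fixpoint Ex s F : R :=
  if s is x :: s' then
    p * Ex s' (fun w => F (x |` w)) + (1 - p) * Ex s' F
  else F set0.

Definition Pr s (Q : set T -> Prop) : R := Ex s (fun w => '1[Q w]).

Lemma eq_Ex s F G : (forall w, w `<=` [set` s] -> F w = G w) -> Ex s F = Ex s G.
Proof.
elim: s F G => [|x s IH] F G FG /=; first exact: FG.
congr (_ * _ + _ * _); apply: IH => w ws; apply: FG => y.
  by case=> [->|/ws] /=; rewrite inE ?eqxx // => ->; rewrite orbT.
by move=> /ws /=; rewrite inE => ->; rewrite orbT.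
Qed.

Lemma Ex_cst s c : Ex s (fun=> c) = c.
Proof. by elim: s => //= x s ->; rewrite -mulrDl addrC subrK mul1r. Qed.

Lemma ExD s F G : Ex s (fun w => F w + G w) = Ex s F + Ex s G.
Proof. by elim: s F G => //= x s IH F G; rewrite !IH; ring. Qed.

Lemma ExZ s c F : Ex s (fun w => c * F w) = c * Ex s F.
Proof. by elim: s F => //= x s IH F; rewrite !IH; ring. Qed.

Lemma Ex_sum s (I : Type) (r : seq I) (F : I -> set T -> R) :
  Ex s (fun w => \sum_(i <- r) F i w) = \sum_(i <- r) Ex s (F i).
Proof.
elim: r => [|i r IH]; first by under eq_Ex do rewrite big_nil; rewrite Ex_cst big_nil.
by rewrite big_cons -IH -ExD; apply: eq_Ex => w _; rewrite big_cons.
Qed.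

(** An arbitrary codomain covers both random variables and events; for events the equality is one of
    propositions, proved by extensionality. *)
Definition depends (A : Type) (D : set T) (F : set T -> A) :=
  forall w, F w = F (w `&` D).

Lemma depends_agree (A : Type) D (F : set T -> A) w w' : depends D F ->
  w `&` D = w' `&` D -> F w = F w'.
Proof. by move=> dF e; rewrite dF e -dF. Qed.

Lemma depends_sub (A : Type) D D' (F : set T -> A) :
  D `<=` D' -> depends D F -> depends D' F.
Proof.
by move=> DD dF w; rewrite dF [RHS]dF -setIA (setIidr DD).
Qed.

Lemma depends_comp (A B : Type) D (F : set T -> A) (h : A -> B) :
  depends D F -> depends D (fun w => h (F w)).
Proof. by move=> dF w; rewrite dF. Qed.

Lemma depends_and D (P Q : set T -> Prop) :
  depends D P -> depends D Q -> depends D (fun w => P w /\ Q w).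
Proof. by move=> dP dQ w; rewrite dP dQ. Qed.

(** Each site lies in [D] or in its complement, so one of the two factors ignores it and comes out
    of the splitting at that site. *)
Lemma Ex_indep s D F G : depends D F -> depends (~` D) G ->
  Ex s (fun w => F w * G w) = Ex s F * Ex s G.
Proof.
elim: s F G => //= x s IH F G dF dG.
have dF' : depends D (fun w => F (x |` w)).
  move=> w; apply: (depends_agree dF); apply/seteqP; split=> y /=; tauto.
have dG' : depends (~` D) (fun w => G (x |` w)).
  move=> w; apply: (depends_agree dG); apply/seteqP; split=> y /=; tauto.
rewrite (IH _ _ dF' dG') (IH _ _ dF dG).
case: (pselect (D x)) => Dx.
  have -> : Ex s (fun w => G (x |` w)) = Ex s G.
    apply: eq_Ex => w _; apply: (depends_agree dG); apply/seteqP.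
    by split=> y /= [h nD]; split=> //; [case: h => [e|//]; case: nD; rewrite e|right].
  ring.
have -> : Ex s (fun w => F (x |` w)) = Ex s F.
  apply: eq_Ex => w _; apply: (depends_agree dF); apply/seteqP.
  by split=> y /= [h nD]; split=> //; [case: h => [e|//]; case: Dx; rewrite -e|right].
ring.
Qed.

Lemma Pr_indep s D (P Q : set T -> Prop) : depends D P -> depends (~` D) Q ->
  Pr s (fun w => P w /\ Q w) = Pr s P * Pr s Q.
Proof.
move=> dP dQ; rewrite /Pr -(@Ex_indep s D).
- by apply: eq_Ex => w _; rewrite iver_and.
- exact: depends_comp dP.
- exact: depends_comp dQ.
Qed.

Lemma Ex_split s (d : pred T) F : Ex s F =
  Ex [seq x <- s | d x] (fun w => Ex [seq x <- s | ~~ d x] (fun w' => F (w `|` w'))).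
Proof.
elim: s F => [|x s IH] F /=; first by rewrite setU0.
rewrite (IH F) (IH (fun w => F (x |` w))); case: (d x) => /=.
  congr (_ * _ + _); apply: eq_Ex => w _; apply: eq_Ex => w' _.
  by rewrite setUA.
rewrite -!ExZ -ExD; apply: eq_Ex => w _; congr (_ * _ + _).
by apply: eq_Ex => w' _; rewrite setUCA.
Qed.

Lemma Ex_filter s (d : pred T) F : depends [set x | d x] F ->
  Ex s F = Ex [seq x <- s | d x] F.
Proof.
move=> dF; rewrite (Ex_split s d); apply: eq_Ex => w _.
rewrite -[RHS](Ex_cst [seq x <- s | ~~ d x]); apply: eq_Ex => w' w's.
apply: (depends_agree dF); apply/seteqP; split=> y /= [].
  case=> [//|/w's /=]; rewrite mem_filter /= => /andP[/negP]; tauto.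
by move=> wy dy; split=> //; left.
Qed.

Lemma Ex_perm s t F : perm_eq s t -> Ex s F = Ex t F.
Proof.
(* Permutations are generated by exchanges of adjacent blocks, and [catE] isolates a block by
   conditioning on the one before it. *)
suff H : forall s1 s2 G, Ex (s1 ++ s2) G = Ex (s2 ++ s1) G.
  have catE r1 r2 G : Ex (r1 ++ r2) G = Ex r1 (fun w => Ex r2 (fun w' => G (w `|` w'))).
    elim: r1 G => [|x r1 IH] G /=.
      by apply: eq_Ex => w _; rewrite set0U.
    by rewrite !IH; congr (_ * _ + _); apply: eq_Ex => w _; apply: eq_Ex => w' _; rewrite setUA.
  move=> st; move: F; pose P r := forall F, Ex s F = Ex r F.
  suff: P t by [].
  apply: (@catCA_perm_ind _ P) st _ => // s1 s2 s3 h F; rewrite h.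
  by rewrite !catA [LHS]catE [RHS]catE H.
move=> s1 s2 G.
elim: s1 G => [|x s1 IH] G; first by rewrite cats0.
rewrite /= !IH; clear; elim: s2 G => //= y s2 IH2 G; rewrite -!IH2.
have e w : x |` (y |` w) = y |` (x |` w) by rewrite setUCA.
under [X in _ = _ * (_ * X + _) + _]eq_Ex do rewrite -e.
ring.
Qed.

Hypothesis p01 : 0 <= p <= 1.

Lemma le_Ex s F G : (forall w, w `<=` [set` s] -> F w <= G w) -> Ex s F <= Ex s G.
Proof.
case/andP: p01 => p0 p1.
elim: s F G => [|x s IH] F G FG /=; first exact: FG.
rewrite lerD // ler_wpM2l ?subr_ge0 //; apply: IH => w ws; apply: FG => y.
  by case=> [->|/ws] /=; rewrite inE ?eqxx // => ->; rewrite orbT.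
by move=> /ws /=; rewrite inE => ->; rewrite orbT.
Qed.

Lemma Ex_ge0 s F : (forall w, 0 <= F w) -> 0 <= Ex s F.
Proof. by move=> F0; rewrite -[leLHS](Ex_cst s); exact: le_Ex. Qed.

Lemma Pr_ge0 s Q : 0 <= Pr s Q.
Proof. by apply: Ex_ge0 => w; exact: iver_ge0. Qed.

Lemma Pr_le1 s Q : Pr s Q <= 1.
Proof. by rewrite -(Ex_cst s 1); apply: le_Ex => w _; exact: iver_le1. Qed.

Lemma le_Pr s (P Q : set T -> Prop) :
  (forall w, w `<=` [set` s] -> P w -> Q w) -> Pr s P <= Pr s Q.
Proof. by move=> PQ; apply: le_Ex => w ws; apply: le_iver; exact: PQ. Qed.

Lemma Pr_union s (I : eqType) (r : seq I) (Q : I -> set T -> Prop) :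
  Pr s (fun w => exists2 i, i \in r & Q i w) <= \sum_(i <- r) Pr s (Q i).
Proof.
rewrite /Pr -Ex_sum; apply: le_Ex => w _.
case: (pselect (exists2 i, i \in r & Q i w)) => h; last first.
  by rewrite iverF // sumr_ge0 // => i _; exact: iver_ge0.
rewrite (iverT h); case: h => i ir Qi.
rewrite (big_rem i ir) /= (iverT Qi) lerDl sumr_ge0 // => j _; exact: iver_ge0.
Qed.

Definition increasing (A : set T -> Prop) :=
  forall w w', w `<=` w' -> A w -> A w'.

Definition disjoint_occ (A B : set T -> Prop) (w : set T) :=
  exists w1 w2, [/\ w1 `<=` w, w2 `<=` w, w1 `&` w2 = set0, A w1 & B w2].

(* The van den Berg--Kesten inequality.  Splitting on one site, inclusion-exclusion gives
   P(A1oB0 u A0oB1) <= P(A1)P(B0) + P(A0)P(B1) - P(A0oB0), and the remaining gap is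
   p^2 (P(A1) - P(A0)) (P(B1) - P(B0)); the case p <= 1/2 avoids a sign problem. *)
Lemma BK s (A B : set T -> Prop) : p <= 1 / 2 -> uniq s ->
  increasing A -> increasing B ->
  Pr s (disjoint_occ A B) <= Pr s A * Pr s B.
Proof.
case/andP: p01 => p0 p1 p2.
elim: s A B => [|x s IH] A B /=.
  move=> _ iA iB; rewrite /Pr /= -iver_and; apply: le_iver => -[w1 [w2 [h1 h2 _ A1 B2]]].
  by split; [apply: iA A1|apply: iB B2].
move=> /andP[xs us] iA iB.
pose A1 w := A (x |` w); pose B1 w := B (x |` w).
have iA1 : increasing A1 by move=> w w' ww; apply: iA; exact: setUS.
have iB1 : increasing B1 by move=> w w' ww; apply: iB; exact: setUS.
have A01 w : A w -> A1 w by apply: iA => y; right.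
have B01 w : B w -> B1 w by apply: iB => y; right.
have step : Pr s (fun w => disjoint_occ A B (x |` w)) <=
    Pr s (disjoint_occ A1 B) + Pr s (disjoint_occ A B1) - Pr s (disjoint_occ A B).
  rewrite lerBrDr /Pr -!ExD; apply: le_Ex => w ws.
  have xw : ~ w x by move=> /ws /=; apply/negP.
  have i1 : disjoint_occ A B w -> disjoint_occ A1 B w.
    by case=> w1 [w2 [? ? ? /A01 ? ?]]; exists w1, w2.
  have i2 : disjoint_occ A B w -> disjoint_occ A B1 w.
    by case=> w1 [w2 [? ? ? ? /B01 ?]]; exists w1, w2.
  case: (pselect (disjoint_occ A B w)) => h0.
    by rewrite (iverT h0) (iverT (i1 h0)) (iverT (i2 h0)) lerD2r iver_le1.
  rewrite (iverF h0) addr0.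
  case: (pselect (disjoint_occ A B (x |` w))) => h; last first.
    by rewrite (iverF h) addr_ge0 // iver_ge0.
  suff [h1|h1] : disjoint_occ A1 B w \/ disjoint_occ A B1 w.
  - by rewrite (iverT h1) ler_wpDr ?iver_ge0 ?iver_le1.
  - by rewrite (iverT h1) ler_wpDl ?iver_ge0 ?iver_le1.
  case: h => w1 [w2 [h1 h2 h12 Aw Bw]].
  (* The site x lies in at most one witness. It is removed from [w1], where [A1] supplies it again,
     or else from [w2], where [B1] does. *)
  have [x1|x1] := pselect (w1 x).
    left; exists (w1 `\ x), w2; split => //.
    - by move=> y [] /h1[e /(_ e)|].
    - move=> y y2; case: (h2 _ y2) => // yx; exfalso.
      have : (w1 `&` w2) x by split => //; rewrite -yx.
      by rewrite h12.
    - by rewrite -subset0 -h12 => y [[]].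
    - by apply: iA Aw => y y1; case: (pselect (y = x)) => [->|]; [left|right].
  right; exists w1, (w2 `\ x); split => //.
  - by move=> y y1; case: (h1 _ y1) => // yx; case: x1; rewrite -yx.
  - by move=> y [] /h2[e /(_ e)|].
  - by rewrite -subset0 -h12 => y [? []].
  - by apply: iB Bw => y y1; case: (pselect (y = x)) => [->|]; [left|right].
have -> : Pr (x :: s) (disjoint_occ A B) =
  p * Pr s (fun w => disjoint_occ A B (x |` w)) + (1 - p) * Pr s (disjoint_occ A B) by [].
have -> : Pr (x :: s) A = p * Pr s A1 + (1 - p) * Pr s A by [].
have -> : Pr (x :: s) B = p * Pr s B1 + (1 - p) * Pr s B by [].
have h10 := IH A1 B us iA1 iB; have h01 := IH A B1 us iA iB1.
have h00 := IH A B us iA iB.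
have a01 : Pr s A <= Pr s A1 by apply: le_Pr => w _; exact: A01.
have b01 : Pr s B <= Pr s B1 by apply: le_Pr => w _; exact: B01.
move: (Pr s _) (Pr s (disjoint_occ A1 B)) (Pr s (disjoint_occ A B1)) (Pr s (disjoint_occ A B)) step h10 h01 h00 => X Y Z W.
move: (Pr s A) (Pr s A1) (Pr s B) (Pr s B1) a01 b01 => a a1 b b1 a01 b01 XYZ hY hZ hW.
have k1 : p * X <= p * (a1 * b + a * b1 - W) by rewrite ler_wpM2l //; lra.
have k2 : (1 - 2 * p) * W <= (1 - 2 * p) * (a * b) by rewrite ler_wpM2l //; lra.
have k3 : 0 <= p ^+ 2 * ((a1 - a) * (b1 - b)).
  by rewrite mulr_ge0 ?sqr_ge0 // mulr_ge0 // subr_ge0.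
lra.
Qed.

End Expectation.

(** * Internally spanned rectangles *)

Lemma nbhdE (x y : Z2) : nbhd x y <->
  (x.1 = y.1 /\ (x.2 = y.2 + 1 \/ x.2 = y.2 - 1)) \/
  (x.2 = y.2 /\ (x.1 = y.1 + 1 \/ x.1 = y.1 - 1)).
Proof.
case: x y => [a b] [c d] /=; rewrite /nbhd /=; split; last first.
  by case=> -[-> [] ->]; ring.
rewrite !expr2 => h.
have : (a - c = 0 /\ (b - d = 1 \/ b - d = -1)) \/ (b - d = 0 /\ (a - c = 1 \/ a - c = -1)).
  move: (a - c) (b - d) h => u v h.
  have hu : -1 <= u <= 1 by nia.
  have hv : -1 <= v <= 1 by nia.
  have : u = -1 \/ u = 0 \/ u = 1 by lia.
  have : v = -1 \/ v = 0 \/ v = 1 by lia.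
  by move=> [e1|[e1|e1]] [e2|[e2|e2]]; subst u v; lia.
lia.
Qed.

Definition bclosed (C : set Z2) :=
  forall x y z, y <> z -> nbhd x y -> nbhd x z -> C y -> C z -> C x.

(** K lies in the bootstrap closure of A, seen as the intersection of all closed sets containing A.
    No time index appears; [internally_spannedE] links this to the iterates. *)
Definition spans (A K : set Z2) := forall C, bclosed C -> A `<=` C -> K `<=` C.

Lemma spansS A A' K K' : A `<=` A' -> K' `<=` K -> spans A K -> spans A' K'.
Proof. by move=> AA KK s C cC sAC z /KK; apply: s => // y /AA /sAC. Qed.

Lemma spans_trans A B K : spans A B -> spans B K -> spans A K.
Proof. by move=> AB BK C cC sAC; apply: BK => //; exact: AB. Qed.

Lemma card_ge2P (B : set Z2) :
  (`I_2 #<= B)%card <-> exists y z, [/\ y <> z, B y & B z].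
Proof.
have img1 (y : Z2) : [set y] = (fun=> y) @` `I_1.
  by apply/seteqP; split=> [z ->|z [n _ <-]] //; exists 0%N.
split=> [h|[y [z [yz By Bz]]]].
  have [y By] : exists y, B y.
    apply: contrapT => nB; have B0 : B = set0 by rewrite -subset0 => y By; apply: nB; exists y.
    by move: h; rewrite B0 => /card_le0P /seteqP[/(_ 0%N isT)].
  apply: contrapT => nh; have By1 : B `<=` [set y].
    by move=> z Bz; apply: contrapT => zy; apply: nh; exists z, y.
  have := card_le_trans h (subset_card_le By1).
  by rewrite img1 => /card_le_trans/(_ (card_image_le _ _)); rewrite card_le_II.
pose f (n : nat) := if n == 0%N then y else z.
have fi : {in `I_2 &, injective f}.
  by move=> [|[|m]] [|[|n]]; rewrite !inE //= /f /= => _ _ e; exfalso; apply: yz.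
have := inj_card_eq fi; rewrite card_eq_le => /andP[_ /card_le_trans]; apply.
by apply: subset_card_le => _ [[|[|n]] //= _ <-].
Qed.

Lemma boot_stepS K : K `<=` boot_step K.
Proof. by move=> z; left. Qed.

Lemma iter_bootS K m n : (m <= n)%N -> iter m boot_step K `<=` iter n boot_step K.
Proof.
move=> /subnK <-; elim: (n - m)%N => // k IH; rewrite addSn.
exact: subset_trans IH (@boot_stepS _).
Qed.

Lemma boot_span_closed K : bclosed (boot_span K).
Proof.
move=> x y z yz xy xz [i _ yi] [j _ zj]; exists (maxn i j).+1 => //.
right; apply/card_ge2P; exists y, z; split => //; split => //.
  exact: iter_bootS (leq_maxl _ _) _ yi.
exact: iter_bootS (leq_maxr _ _) _ zj.
Qed.

Lemma boot_span_min K C : bclosed C -> K `<=` C -> boot_span K `<=` C.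
Proof.
move=> cC KC z [n _]; elim: n z => [|n IH] z /=; first exact: KC.
case=> [/IH //|/card_ge2P[x [y [xy [zx /IH Cx] [zy /IH Cy]]]]].
exact: (cC z x y).
Qed.

Lemma internally_spannedE X K : bclosed K ->
  internally_spanned X K <-> spans (X `&` K) K.
Proof.
move=> cK; split=> [e C cC XC|sK].
  by rewrite -e; exact: boot_span_min.
apply/seteqP; split; first by apply: boot_span_min => // z [].
apply: sK; first exact: boot_span_closed.
by move=> z Kz; exists 0%N.
Qed.

Lemma spans_not_two_columns A K x : spans A K ->
  (forall z, A z -> z.1 <> x /\ z.1 <> x + 1) ->
  forall z, K z -> z.1 <> x /\ z.1 <> x + 1.
Proof.
move=> sK Ax; apply: (sK [set z | z.1 <> x /\ z.1 <> x + 1]) => //.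
move=> [a b] [a1 b1] [a2 b2] ne /nbhdE /= h1 /nbhdE /= h2 h3 h4.
suff : ~ (a1 = a2 /\ b1 = b2) by lia.
by move=> [e1 e2]; apply: ne; rewrite e1 e2.
Qed.

Definition flip (z : Z2) : Z2 := (z.2, z.1).

Lemma flipK : involutive flip. Proof. by case. Qed.

Lemma bclosed_flip C : bclosed C -> bclosed (flip @^-1` C).
Proof.
move=> cC x y z yz xy xz; apply: cC.
- by move=> e; apply: yz; rewrite -[y]flipK e flipK.
- by move: x y xy {yz xz} => [a b] [c d] /nbhdE /= h; apply/nbhdE => /=; lia.
- by move: x z xz {yz xy} => [a b] [c d] /nbhdE /= h; apply/nbhdE => /=; lia.
Qed.

Lemma spans_flip A K : spans A K -> spans (flip @^-1` A) (flip @^-1` K).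
Proof.
move=> s C /bclosed_flip cC sAC z Kz.
have /(_ _ Kz) : K `<=` flip @^-1` C.
  by apply: s => // y Ay; apply: sAC; rewrite /= flipK.
by rewrite /= flipK.
Qed.

(* A rectangle is given by its lower left site (included) and its upper right
   corner (excluded). *)
Definition rect := (Z2 * Z2)%type.

Definition box (r : rect) : set Z2 :=
  [set z | (r.1.1 <= z.1 < r.2.1) /\ (r.1.2 <= z.2 < r.2.2)].

Definition valid (r : rect) := (r.1.1 < r.2.1) && (r.1.2 < r.2.2).

Definition wid (r : rect) : nat := `|r.2.1 - r.1.1|%N.
Definition hei (r : rect) : nat := `|r.2.2 - r.1.2|%N.
Definition semiper (r : rect) : nat := (wid r + hei r)%N.

Definition subrect (r s : rect) :=
  [&& s.1.1 <= r.1.1, r.2.1 <= s.2.1, s.1.2 <= r.1.2 & r.2.2 <= s.2.2].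

Definition hull (r s : rect) : rect :=
  ((Order.min r.1.1 s.1.1, Order.min r.1.2 s.1.2),
   (Order.max r.2.1 s.2.1, Order.max r.2.2 s.2.2)).

(** Sites with a common neighbour are at distance at most 2, so rectangles that are pairwise not
    near have a closed union. *)
Definition near_rect (r s : rect) := exists z z',
  [/\ box r z, box s z' & (`|z.1 - z'.1| + `|z.2 - z'.2| <= 2)%N].

Lemma subrect_box r s : valid r -> box r `<=` box s <-> subrect r s.
Proof.
case: r s => [[a b] [c d]] [[a' b'] [c' d']]; rewrite /valid /subrect /box /=.
move=> v; split=> [h|h [x y] /= hx]; last by lia.
have := h (a, b); have := h (c - 1, d - 1); rewrite /=; lia.
Qed.

Lemma bclosed_box r : bclosed (box r).
Proof.
case: r => [[a b] [c d]] [x x'] [y y'] [z z'] yz /nbhdE /= h1 /nbhdE /= h2.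
rewrite /box /=.
suff : ~ (y = z /\ y' = z') by lia.
by move=> [e1 e2]; apply: yz; rewrite e1 e2.
Qed.

Lemma fill_column C x x' c d y0 : bclosed C -> (x' = x + 1 \/ x' = x - 1) ->
  (forall y, c <= y < d -> C (x, y)) -> c <= y0 < d -> C (x', y0) ->
  forall y, c <= y < d -> C (x', y).
Proof.
move=> cC xx Cx y0cd Cy0.
have up (n : nat) : y0 + n%:Z < d -> C (x', y0 + n%:Z).
  elim: n => [|n IH] h; first by rewrite addr0.
  apply: (cC _ (x', y0 + n%:Z) (x, y0 + n.+1%:Z)).
  - by case; lia.
  - by apply/nbhdE => /=; lia.
  - by apply/nbhdE => /=; lia.
  - by apply: IH; lia.
  - by apply: Cx; lia.
have down (n : nat) : c <= y0 - n%:Z -> C (x', y0 - n%:Z).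
  elim: n => [|n IH] h; first by rewrite subr0.
  apply: (cC _ (x', y0 - n%:Z) (x, y0 - n.+1%:Z)).
  - by case; lia.
  - by apply/nbhdE => /=; lia.
  - by apply/nbhdE => /=; lia.
  - by apply: IH; lia.
  - by apply: Cx; lia.
move=> y hy; case: (leP y0 y) => h.
  by have := up `|y - y0|%N; rewrite (_ : y0 + _ = y); [apply; lia|lia].
by have := down `|y - y0|%N; rewrite (_ : y0 - _ = y); [apply; lia|lia].
Qed.

Lemma extend_x C a b x0 c d : bclosed C -> a <= x0 < b ->
  (forall y, c <= y < d -> C (x0, y)) ->
  (forall x, a <= x < b -> exists2 y, c <= y < d & C (x, y)) ->
  forall x y, a <= x < b -> c <= y < d -> C (x, y).
Proof.
move=> cC x0ab C0 Cx.
have up (n : nat) : x0 + n%:Z < b -> forall y, c <= y < d -> C (x0 + n%:Z, y).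
  elim: n => [|n IH] h; first by rewrite addr0.
  have [|y1 y1cd Cy1] := Cx (x0 + n.+1%:Z); first by lia.
  apply: (fill_column (x := x0 + n%:Z) (y0 := y1) cC) => //; first by left; lia.
  by apply: IH; lia.
have down (n : nat) : a <= x0 - n%:Z -> forall y, c <= y < d -> C (x0 - n%:Z, y).
  elim: n => [|n IH] h; first by rewrite subr0.
  have [|y1 y1cd Cy1] := Cx (x0 - n.+1%:Z); first by lia.
  apply: (fill_column (x := x0 - n%:Z) (y0 := y1) cC) => //; first by right; lia.
  by apply: IH; lia.
move=> x y hx hy; case: (leP x0 x) => h.
  by have := up `|x - x0|%N; rewrite (_ : x0 + _ = x); [apply => //; lia|lia].
by have := down `|x - x0|%N; rewrite (_ : x0 - _ = x); [apply => //; lia|lia].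
Qed.

Lemma extend_y C a b y0 c d : bclosed C -> c <= y0 < d ->
  (forall x, a <= x < b -> C (x, y0)) ->
  (forall y, c <= y < d -> exists2 x, a <= x < b & C (x, y)) ->
  forall x y, a <= x < b -> c <= y < d -> C (x, y).
Proof.
move=> /bclosed_flip cC h1 h2 h3 x y hx hy.
exact: (extend_x (C := flip @^-1` C) (x0 := y0) (a := c) (b := d) (c := a) (d := b) cC).
Qed.

(** The common site is used twice: its row extends [r] to the full width of the hull, then its
    column extends the resulting band to the full height. *)
Lemma hull_meet C r s z : bclosed C -> box r `<=` C -> box s `<=` C ->
  box r z -> box s z -> box (hull r s) `<=` C.
Proof.
case: r s z => [[a b] [c d]] [[a' b'] [c' d']] [x0 y0] cC rC sC /= rz sz.
rewrite /box /= in rz sz.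
have h x y : Order.min a a' <= x < Order.max c c' -> b <= y < d -> C (x, y).
  apply: (extend_x (x0 := x0) cC); first by lia.
    by move=> {}y hy; apply: rC; rewrite /box /=; lia.
  move=> {}x hx; exists y0; first by lia.
  have [h|h] : (a <= x < c) \/ (a' <= x < c') by lia.
    by apply: rC; rewrite /box /=; lia.
  by apply: sC; rewrite /box /=; lia.
move=> [x y]; rewrite /box /= => -[hx hy].
apply: (extend_y (a := Order.min a a') (b := Order.max c c') (y0 := y0)
  (c := Order.min b b') (d := Order.max d d') cC) => //; first by lia.
  by move=> {hx}x hx; apply: h => //; lia.
move=> {hy}y hy; exists x0; first by lia.
have [h'|h'] : (b <= y < d) \/ (b' <= y < d') by lia.
  by apply: rC; rewrite /box /=; lia.
by apply: sC; rewrite /box /=; lia.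
Qed.

Lemma near_spans r s : near_rect r s -> spans (box r `|` box s) (box (hull r s)).
Proof.
move=> [[x y] [[x' y'] [rz sz dz]]] C cC; rewrite subUset => -[rC sC].
(* Two sites at distance at most 2 fill their bounding box [m] at once, every other site of it being
   adjacent to both. As [m] meets [r] and [s], [hull_meet] applies twice. *)
pose m : rect := ((Order.min x x', Order.min y y'), (Order.max x x' + 1, Order.max y y' + 1)).
have mC : box m `<=` C.
  move=> [u v] /=; rewrite /box /= => -[hu hv].
  have [e|n1] := pselect ((u, v) = (x, y)); first by rewrite e; exact: rC.
  have [e|n2] := pselect ((u, v) = (x', y')); first by rewrite e; exact: sC.
  have {}n1 : ~ (u = x /\ v = y) by move=> [e1 e2]; apply: n1; rewrite e1 e2.
  have {}n2 : ~ (u = x' /\ v = y') by move=> [e1 e2]; apply: n2; rewrite e1 e2.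
  rewrite /= in dz.
  apply: (cC _ (x, y) (x', y')).
  - by case; lia.
  - by apply/nbhdE => /=; lia.
  - by apply/nbhdE => /=; lia.
  - exact: rC.
  - exact: sC.
have h1 : box (hull r m) `<=` C.
  by apply: (hull_meet (z := (x, y)) cC) => //; rewrite /box /=; lia.
have h2 : box (hull (hull r m) s) `<=` C.
  apply: (hull_meet (z := (x', y')) cC) => //.
  by move: rz sz; rewrite /hull /box /=; lia.
apply: subset_trans h2 => -[u v] [/andP[k1 k2] /andP[k3 k4]].
have lemin (i j k : int) : Order.min (Order.min i k) j <= Order.min i j by lia.
have lemax (i j k : int) : Order.max i j <= Order.max (Order.max i k) j by lia.
by split; apply/andP; split; [exact: le_trans (lemin _ _ _) k1|exact: lt_le_trans (lemax _ _ _)|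
  exact: le_trans (lemin _ _ _) k3|exact: lt_le_trans (lemax _ _ _)].
Qed.

Lemma subrect_side r s z : valid r -> box r z -> subrect r s ->
  r <> s -> exists z1 z2, [/\ box r z1, box s z2, ~ box r z2 & nbhd z1 z2].
Proof.
case: r s z => [[a b] [c d]] [[a' b'] [c' d']] [x y].
rewrite /valid /box /subrect /= => v hz hs ne.
have : (a' < a) \/ (c < c') \/ (b' < b) \/ (d < d').
  apply: contrapT => h; apply: ne.
  by have [-> -> -> ->] : [/\ a = a', b = b', c = c' & d = d'] by split; lia.
case=> [h|[h|[h|h]]].
- exists (a, b), (a - 1, b); split => /=; try lia; by apply/nbhdE => /=; lia.
- exists (c - 1, b), (c, b); split => /=; try lia; by apply/nbhdE => /=; lia.
- exists (a, b), (a, b - 1); split => /=; try lia; by apply/nbhdE => /=; lia.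
- exists (a, d - 1), (a, d); split => /=; try lia; by apply/nbhdE => /=; lia.
Qed.

Lemma nbhd_near z z' : nbhd z z' -> (`|z.1 - z'.1| + `|z.2 - z'.2| <= 2)%N.
Proof. by move=> /nbhdE; lia. Qed.

Lemma nbhd_near2 x z z' : nbhd x z -> nbhd x z' ->
  (`|z.1 - z'.1| + `|z.2 - z'.2| <= 2)%N.
Proof. by move=> /nbhdE h /nbhdE h'; lia. Qed.

Lemma valid_hull r s : valid r -> valid (hull r s).
Proof. by rewrite /valid /hull /=; lia. Qed.

(* [I] is a finite set of labels, the sites of [A] labelled [i]
   lie in and span the rectangle [rr i]. *)
Definition process (A : set Z2) (K : rect) (I : seq Z2) (f : Z2 -> Z2)
    (rr : Z2 -> rect) :=
  [/\ uniq I, (forall z, A z -> f z \in I) &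
   forall i, i \in I -> [/\ valid (rr i), rr i <> K,
     A `&` (f @^-1` [set i]) `<=` box (rr i) &
     spans (A `&` (f @^-1` [set i])) (box (rr i))]].

Lemma process_near A K I f rr : valid K -> A `<=` box K ->
  spans A (box K) -> process A K I f rr ->
  exists i j, [/\ i \in I, j \in I, i <> j & near_rect (rr i) (rr j)].
Proof.
move=> vK AK sA [uI fI rI]; apply: contrapT => hn.
have {}hn i j : i \in I -> j \in I -> near_rect (rr i) (rr j) -> i = j.
  by move=> iI jI nij; apply: contrapT => ij; apply: hn; exists i, j.
pose U : set Z2 := [set z | exists2 i, i \in I & box (rr i) z].
have cU : bclosed U.
  move=> x y z yz xy xz [i iI iy] [j jI jz].
  have e : i = j.
    by apply: hn => //; exists y, z; split => //; exact: nbhd_near2 xy xz.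
  by exists i => //; apply: (bclosed_box yz xy xz) => //; rewrite e.
have AU : A `<=` U.
  by move=> z Az; exists (f z); [exact: fI|have [_ _ + _] := rI _ (fI _ Az); apply].
have KU := sA _ cU AU.
have [|i iI _] := KU K.1.
  by move: vK; rewrite /valid /box /=; lia.
have [vi niK hi si] := rI i iI.
have rK : subrect (rr i) K.
  apply/subrect_box => //; apply: subset_trans (si (box K) (@bclosed_box K) _) _ => //.
  by apply: subset_trans AK => z [].
have [|z1 [z2 [h1 h2 h3 h4]]] := subrect_side (z := (rr i).1) vi _ rK niK.
  by move: vi; rewrite /valid /box /=; lia.
have [j jI jz2] := KU _ h2.
have e : i = j by apply: hn => //; exists z1, z2; split => //; exact: nbhd_near.
by apply: h3; rewrite e.
Qed.

Lemma spanning_children A K : valid K -> (1 < semiper K - 1)%N ->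
  finite_set A -> A `<=` box K -> spans A (box K) ->
  exists r s X Y,
    [/\ [/\ valid r, valid s, r <> K & s <> K], near_rect r s, hull r s = K,
      [/\ X `<=` A, Y `<=` A & X `&` Y = set0] &
      [/\ X `<=` box r, Y `<=` box s, spans X (box r) & spans Y (box s)]].
Proof.
move=> vK K2 fA AK sA.
suff H : forall n I f rr, size I = n -> process A K I f rr ->
  exists r s X Y,
    [/\ [/\ valid r, valid s, r <> K & s <> K], near_rect r s, hull r s = K,
      [/\ X `<=` A, Y `<=` A & X `&` Y = set0] &
      [/\ X `<=` box r, Y `<=` box s, spans X (box r) & spans Y (box s)]].
  have /finite_seqP[I eI] := fA.
  apply: (H (size (undup I)) (undup I) (fun z => z) (fun z => (z, (z.1 + 1, z.2 + 1)))) => //.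
  split; first exact: undup_uniq.
    by move=> z; rewrite mem_undup eI.
  move=> i; rewrite mem_undup => iI; split.
  - by rewrite /valid /=; lia.
  - move=> e; move: K2; rewrite -e /semiper /wid /hei /=; lia.
  - by move=> z [_ /= ->]; rewrite /box /= !ltzD1 !lexx.
  - move=> C cC sAC z zi; apply: sAC; rewrite eI.
    suff -> : z = i by split.
    by move: z i zi {iI} => [x y] [x' y']; rewrite /box /= => h; congr pair; lia.
elim => [|n IH] I f rr sI pI.
  have [i [j [+ _ _ _]]] := process_near vK AK sA pI.
  by rewrite (size0nil sI).
have [i [j [iI jI ij nij]]] := process_near vK AK sA pI.
have [uI fI rI] := pI.
have [vi iK iA si] := rI i iI; have [vj jK jA sj] := rI j jI.
have [hK|hK] := pselect (hull (rr i) (rr j) = K).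
  exists (rr i), (rr j), (A `&` (f @^-1` [set i])), (A `&` (f @^-1` [set j])).
  split => //; split => //; try by move=> z [].
  by rewrite -subset0 => z [[_ /= e1] [_ /= e2]]; apply: ij; rewrite -e1 -e2.
pose f' z := if f z == j then i else f z.
pose rr' k := if k == i then hull (rr i) (rr j) else rr k.
apply: (IH (rem j I) f' rr'); first by rewrite size_rem // sI.
split; first exact: rem_uniq.
  move=> z Az; rewrite mem_rem_uniq // inE /f'.
  case: (eqVneq (f z) j) => [_|->]; last by rewrite fI.
  by rewrite iI andbT; apply/eqP.
move=> k; rewrite mem_rem_uniq // inE => /andP[kj kI].
have [vk kK kA sk] := rI k kI.
rewrite /rr'; case: eqVneq => [ki|ki].
  have e : A `&` f' @^-1` [set k] = (A `&` f @^-1` [set i]) `|` (A `&` f @^-1` [set j]).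
    rewrite ki; apply/seteqP; split=> z /=; rewrite /f'.
      by case=> Az; case: eqVneq => [e _|_ e]; [right|left].
    case=> -[Az e]; split => //; first by rewrite e; case: eqVneq.
    by rewrite e eqxx.
  split => //; first exact: valid_hull.
  - rewrite e => z [/iA|/jA]; move: vi vj; rewrite /valid /box /hull /=; lia.
  - rewrite e; apply: spans_trans (near_spans nij) => C cC; rewrite !subUset => -[h1 h2].
    by split; [exact: si|exact: sj].
have e : A `&` f' @^-1` [set k] = A `&` f @^-1` [set k].
  apply/seteqP; split=> z /=; rewrite /f' => -[Az].
    by case: eqVneq => // _ e; move: ki; rewrite e eqxx.
  by move=> e; split => //; case: eqVneq => // e'; move: kj; rewrite -e' e eqxx.
by rewrite e; split.
Qed.

(** The + 1 is the gap of one column or row that may separate near rectangles. *)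
Lemma hull_dims r s : valid r -> valid s -> near_rect r s ->
  [/\ (maxn (wid r) (wid s) <= wid (hull r s))%N,
      (maxn (hei r) (hei s) <= hei (hull r s))%N,
      (wid (hull r s) <= wid r + wid s + 1)%N &
      (hei (hull r s) <= hei r + hei s + 1)%N].
Proof.
case: r s => [[a b] [c d]] [[a' b'] [c' d']] vr vs [[x y] [[x' y'] [h1 h2 h3]]].
move: vr vs h1 h2 h3; rewrite /valid /box /wid /hei /hull /=.
move=> /andP[v1 v2] /andP[v3 v4] [/andP[k1 k2] /andP[k3 k4]] [/andP[l1 l2] /andP[l3 l4]] h.
by split; lia.
Qed.

Lemma subrect_refl r : subrect r r.
Proof. by rewrite /subrect !lexx. Qed.

Lemma subrect_trans r s t : subrect r s -> subrect s t -> subrect r t.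
Proof. rewrite /subrect; lia. Qed.

Lemma subrect_hulll r s : subrect r (hull r s).
Proof. rewrite /subrect /hull /=; lia. Qed.

Lemma subrect_hullr r s : subrect s (hull r s).
Proof. rewrite /subrect /hull /=; lia. Qed.

Lemma subrect_semiper r s : valid r -> subrect r s -> r <> s ->
  (semiper r < semiper s)%N.
Proof.
case: r s => [[a b] [c d]] [[a' b'] [c' d']]; rewrite /valid /subrect /semiper /wid /hei /=.
move=> v h ne.
suff : ~ [/\ a = a', b = b', c = c' & d = d'].
  move=> h'; have {}h' : ~ (a = a' /\ b = b' /\ c = c' /\ d = d').
    by case=> ? [? [? ?]]; apply: h'; split.
  lia.
by case=> e1 e2 e3 e4; apply: ne; rewrite e1 e2 e3 e4.
Qed.

Definition span_ev (r : rect) (w : set Z2) := spans (w `&` box r) (box r).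

Lemma span_ev_increasing r : increasing (span_ev r).
Proof. by move=> w w' ww; apply: spansS => //; exact: setSI. Qed.

Lemma span_ev_depends r : depends (box r) (span_ev r).
Proof. by move=> w; rewrite /span_ev -setIA setIid. Qed.

Lemma span_ev_children A K : valid K -> (2 < semiper K)%N -> finite_set A ->
  span_ev K A -> exists r s,
    [/\ [/\ valid r, valid s, subrect r K & subrect s K],
        (semiper r < semiper K)%N /\ (semiper s < semiper K)%N,
        near_rect r s, hull r s = K &
        disjoint_occ (span_ev r) (span_ev s) (A `&` box K)].
Proof.
move=> vK K2 fA sA.
have K2' : (1 < semiper K - 1)%N by lia.
have [r [s [X [Y [[vr vs rK sK] n h [XA YA XY] [Xr Ys sX sY]]]]]] :=
  spanning_children vK K2' (finite_setIl _ fA) (@subIsetr _ A (box K)) sA.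
have rsub : subrect r K by rewrite -h subrect_hulll.
have ssub : subrect s K by rewrite -h subrect_hullr.
exists r, s; split => //.
  by split; exact: subrect_semiper.
by exists X, Y; split => //; rewrite /span_ev setIidl.
Qed.

Lemma disjoint_occ_sub (T : eqType) (P Q : set T -> Prop) w w' :
  w `<=` w' -> disjoint_occ P Q w -> disjoint_occ P Q w'.
Proof.
by move=> ww [x [y [xw yw xy Px Qy]]]; exists x, y; split => //;
  exact: subset_trans ww.
Qed.

Lemma disjoint_occ_l (T : eqType) (P Q : set T -> Prop) w : increasing P ->
  disjoint_occ P Q w -> P w.
Proof. by move=> iP [x [y [xw yw xy Px Qy]]]; exact: iP Px. Qed.

Lemma disjoint_occ_r (T : eqType) (P Q : set T -> Prop) w : increasing Q ->
  disjoint_occ P Q w -> Q w.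
Proof. by move=> iQ [x [y [xw yw xy Px Qy]]]; exact: iQ Qy. Qed.

(* Going down from [K] along the larger child, stop at the first rectangle both
   of whose children have semi-perimeter smaller than that of [K] by at least [T]. *)
Lemma spanning_descent A K T : valid K -> (0 < T)%N -> (T + 2 < semiper K)%N ->
  finite_set A -> span_ev K A ->
  exists s r1 r2, [/\ [/\ valid s, valid r1, valid r2 & subrect s K],
     (semiper K < semiper s + T)%N,
     (semiper r1 + T <= semiper K)%N /\ (semiper r2 + T <= semiper K)%N,
     near_rect r1 r2 /\ hull r1 r2 = s &
     disjoint_occ (span_ev r1) (span_ev r2) (A `&` box s)].
Proof.
move=> vK T0 TK fA sK.
(* Induction on the current rectangle [s] with K fixed. The invariant [semiper K < semiper s + T]
   passes to any child that is too large for the descent to stop. *)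
have [n] := ubnP (semiper K).
have : (semiper K < semiper K + T)%N by lia.
move: (subrect_refl K) (vK) sK; move: {1 3 4 6 7}K => s.
elim: n s => // n IH s ssK vs ss sT sn.
have s2 : (2 < semiper s)%N by lia.
have [r1 [r2 [[v1 v2 k1 k2] [l1 l2] nr hr dr]]] := span_ev_children vs s2 fA ss.
have d1 : disjoint_occ (span_ev r1) (span_ev r2) A.
  by apply: disjoint_occ_sub dr => z [].
have e1 : span_ev r1 A by apply: disjoint_occ_l d1; exact: span_ev_increasing.
have e2 : span_ev r2 A by apply: disjoint_occ_r d1; exact: span_ev_increasing.
have i1 := subrect_trans k1 ssK; have i2 := subrect_trans k2 ssK.
case: (ltnP (semiper K) (semiper r1 + T)) => c1; first by apply: (IH r1) => //; lia.
case: (ltnP (semiper K) (semiper r2 + T)) => c2; first by apply: (IH r2) => //; lia.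
by exists s, r1, r2; split.
Qed.

(** * Strips without two consecutive vacant columns *)

Section Strips.
Variables (R : realType) (T : eqType) (p : R).
Hypothesis p01 : 0 <= p <= 1.
Implicit Types (s : seq T) (w : set T).

Definition vacant (d : pred T) w := forall x, d x -> ~ w x.

Lemma vacant_depends (d : pred T) : depends [set x | d x] (vacant d).
Proof.
move=> w; apply/propext; split=> h x dx; first by case=> wx _; exact: h wx.
by move=> wx; apply: (h x dx); split.
Qed.

Lemma Pr_vacant s (d : pred T) : Pr p s (vacant d) = (1 - p) ^+ count d s.
Proof.
elim: s => [|x s IH].
  by rewrite /Pr /= iverT // => x _ [].
rewrite /Pr /= -/(Pr p s (vacant d)) IH; case: (boolP (d x)) => dx.
  rewrite (_ : Ex p s _ = 0) ?mulr0 ?add0r ?exprS // -[RHS](Ex_cst p s).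
  by apply: eq_Ex => w _; apply: iverF => /(_ x dx); apply; left.
rewrite add0n (_ : Ex p s _ = (1 - p) ^+ count d s); first by ring.
rewrite -IH; apply: eq_Ex => w _; apply: eq_iver; split=> h y dy.
  by move=> wy; apply: (h y dy); right.
by case=> [e|]; [move: dx; rewrite -e dy|exact: h].
Qed.

Lemma Pr_not s (Q : set T -> Prop) : Pr p s (fun w => ~ Q w) = 1 - Pr p s Q.
Proof.
rewrite -[X in _ = X - _](Ex_cst p s) -mulN1r -ExZ -ExD.
by apply: eq_Ex => w _; rewrite iver_not mulN1r.
Qed.

Lemma Pr_or s (P Q : set T -> Prop) :
  Pr p s (fun w => P w \/ Q w) <= Pr p s P + Pr p s Q.
Proof.
rewrite -ExD; apply: le_Ex => // w _.
have [h|h] := pselect (P w).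
  by rewrite (iverT _ h) ler_wpDr ?iver_ge0 ?iver_le1.
rewrite (iverF _ h) add0r; apply: le_iver; tauto.
Qed.

Lemma Pr_or_disjoint s (P Q : set T -> Prop) : (forall w, P w -> ~ Q w) ->
  Pr p s (fun w => P w \/ Q w) = Pr p s P + Pr p s Q.
Proof.
move=> PQ; rewrite -ExD; apply: eq_Ex => w _.
have [h|h] := pselect (P w).
  by rewrite (iverT _ h) (iverF _ (PQ _ h)) addr0 iverT //; left.
rewrite (iverF _ h) add0r; apply: eq_iver; tauto.
Qed.

Variables (col : nat -> pred T) (s : seq T) (u b : R) (N : nat).
Hypothesis disj_col : forall i j x, col i x -> col j x -> i = j.
Hypothesis Pr_col : forall j, (j < N)%N -> Pr p s (vacant (col j)) = 1 - u.
Hypothesis u0 : 0 < u.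
Hypothesis ub : u <= b.
Hypothesis b1 : b <= 1.
Hypothesis bE : b ^+ 2 = u * b + u * (1 - u).

Definition cols n : set T := [set x | exists2 j, (j < n)%N & col j x].

Let col_sub j n : (j < n)%N -> [set x | col j x] `<=` cols n.
Proof. by move=> jn x /= cx; exists j. Qed.

Let U_sub m n : (m <= n)%N -> cols m `<=` cols n.
Proof. by move=> mn x [j jm cx]; exists j => //; exact: leq_trans mn. Qed.

Let U_disj n : cols n `<=` ~` [set x | col n x].
Proof. by move=> x [j jn cx] /= cn; move: jn; rewrite (disj_col cx cn) ltnn. Qed.

(* [o j] means that column j is known to be occupied. *)
Definition no_gap (o : nat -> bool) n w := forall j, (j.+1 < n)%N ->
  ~~ o j -> ~~ o j.+1 -> vacant (col j) w -> ~ vacant (col j.+1) w.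

Lemma no_gap_depends o n : depends (cols n) (no_gap o n).
Proof.
have dv j : (j < n)%N -> depends (cols n) (vacant (col j)).
  by move=> jn; apply: depends_sub (@vacant_depends (col j)); exact: col_sub.
move=> w; apply/propext; split=> h j jn o1 o2.
  by rewrite -!(dv _ _ w) //; [exact: h|exact: ltnW].
by rewrite (dv j (ltnW jn)) (dv _ jn); exact: h.
Qed.

(** The last column is occupied, or it is vacant and the one before is occupied or declared. By
    [bE], b^n solves the resulting two-step recursion; a declared column is simply dropped, at the
    price of a factor u <= b. The factor b in front settles n = 1. *)
Lemma no_gap_le (o : nat -> bool) n : (n <= N)%N ->
  b * u ^+ (\sum_(j < n) o j)%N * Pr p s (no_gap o n) <= b ^+ n.
Proof.
have u1 : u <= 1 by exact: le_trans ub b1.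
have b0 : 0 < b by exact: lt_le_trans ub.
elim/ltn_ind: n => -[|[|n]] IH nN.
- rewrite big_ord0 !expr0 mulr1; apply: le_trans (_ : b * 1 <= _).
    by rewrite ler_wpM2l ?(ltW b0) // Pr_le1.
  by rewrite mulr1.
- rewrite expr1 -mulrA -[leRHS]mulr1 ler_wpM2l ?(ltW b0) //.
  by rewrite -[leRHS]mulr1 ler_pM ?exprn_ge0 ?(ltW u0) ?Pr_ge0 ?exprn_ile1 ?Pr_le1 // ltW.
have IH1 := IH n.+1 (leqnn _) (ltnW nN).
have IH0 := IH n (leqnSn _) (ltnW (ltnW nN)).
rewrite big_ord_recr /=.
case: (boolP (o n.+1)) => on1 /=.
  rewrite addn1 exprS (exprS b n.+1).
  have le1 : Pr p s (no_gap o n.+2) <= Pr p s (no_gap o n.+1).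
    by apply: le_Pr => // w _ h j jn; apply: h; exact: leq_trans jn _.
  apply: le_trans (_ : u * (b * u ^+ (\sum_(i < n.+1) o i)%N * Pr p s (no_gap o n.+1)) <= _).
    rewrite mulrCA -!mulrA ler_wpM2l ?(ltW u0) // !mulrA ler_wpM2l // mulr_ge0 ?exprn_ge0 //; exact: ltW.
  by apply: ler_pM => //; rewrite ?(ltW u0) // !mulr_ge0 ?exprn_ge0 ?Pr_ge0 // ltW.
rewrite addn0.
have nonvac_dep j : depends [set x | col j x] (fun w => ~ vacant (col j) w).
  exact: depends_comp (@vacant_depends (col j)).
have Pnv j : (j < N)%N -> Pr p s (fun w => ~ vacant (col j) w) = u.
  by move=> jN; rewrite Pr_not Pr_col //; ring.
(* [v] is the probability that column n is occupied or declared. When it is declared, [v = 1], but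
   the left-hand side then has one more factor u, so that [kE] covers both cases. *)
pose v := if o n then 1 else u.
have h : Pr p s (no_gap o n.+2) <= u * Pr p s (no_gap o n.+1) + (1 - u) * (v * Pr p s (no_gap o n)).
  pose A1 w := ~ vacant (col n.+1) w /\ no_gap o n.+1 w.
  pose A2 w := vacant (col n.+1) w /\ ((o n \/ ~ vacant (col n) w) /\ no_gap o n w).
  have e1 : Pr p s A1 = u * Pr p s (no_gap o n.+1).
    rewrite /A1 (@Pr_indep _ _ p s [set x | col n.+1 x]) ?Pnv //.
    by apply: depends_sub (@no_gap_depends o n.+1); exact: U_disj.
  have e2 : Pr p s A2 = (1 - u) * (v * Pr p s (no_gap o n)).
    rewrite /A2 (@Pr_indep _ _ p s [set x | col n.+1 x]) ?Pr_col //; first last.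
    - apply: (depends_sub (@U_disj n.+1)); apply: depends_and.
        apply: (depends_sub (@col_sub n n.+1 (leqnn _))).
        by move=> w /=; rewrite -(vacant_depends (col n) w).
      by apply: (depends_sub (@U_sub n n.+1 (leqnSn _))); exact: no_gap_depends.
    - exact: vacant_depends.
    rewrite (@Pr_indep _ _ p s [set x | col n x]); first last.
    - by apply: (depends_sub (@U_disj n)); exact: no_gap_depends.
    - by move=> w /=; rewrite -(vacant_depends (col n) w).
    congr (_ * (_ * _)); rewrite /v; case: (o n).
      by rewrite -[RHS](Ex_cst p s); apply: eq_Ex => w _; rewrite iverT //; left.
    rewrite -(Pnv n); last exact: ltnW.
    by apply: eq_Ex => w _; apply: eq_iver; split=> [[//|//]|]; right.
  rewrite -e1 -e2; apply: le_trans (Pr_or _ _ _).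
  apply: le_Pr => // w _ ng; have [va|nva] := pselect (vacant (col n.+1) w); last first.
    left; split => // j jn; apply: ng; exact: ltnW.
  right; split => //; split; last first.
    by move=> j jn; apply: ng; apply: leq_trans jn _; rewrite ltnW.
  case: (boolP (o n)) => on; [by left|right => vn].
  exact: (ng n (leqnn _) on on1 vn va).
set k := (\sum_(i < n.+1) o i)%N in IH1 *.
have kE : u ^+ k * v = u ^+ (\sum_(i < n) o i)%N * u.
  rewrite /k big_ord_recr /= /v; case: (o n) => /=; last by rewrite addn0.
  by rewrite addn1 exprS mulr1 mulrC.
have c0 : 0 <= b * u ^+ k by rewrite mulr_ge0 ?exprn_ge0 // ltW.
apply: le_trans (ler_wpM2l c0 h) _.
rewrite !exprS; have bbE := bE; rewrite expr2 in bbE.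
have -> : b * (b * b ^+ n) = u * (b * b ^+ n) + (1 - u) * (u * b ^+ n).
  by rewrite mulrA bbE; ring.
rewrite mulrDr; apply: lerD.
  by rewrite mulrCA ler_wpM2l ?(ltW u0) // -exprS.
rewrite mulrCA ler_wpM2l ?subr_ge0 // !mulrA -(mulrA b) kE.
have -> : b * (u ^+ (\sum_(i < n) o i)%N * u) * Pr p s (no_gap o n) =
  u * (b * u ^+ (\sum_(i < n) o i)%N * Pr p s (no_gap o n)) by ring.
by rewrite ler_wpM2l // ltW.
Qed.

(** The condition on the last column lets a filled region cross the strip to its very end; it also
    makes the two cases of the recursion below disjoint. *)
Definition traversable n w := no_gap xpred0 n w /\
  (forall j, j.+1 = n -> ~ vacant (col j) w).

Lemma traversable_depends n : depends (cols n) (traversable n).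
Proof.
apply: depends_and; first exact: no_gap_depends.
move=> w; apply/propext.
have dv j : j.+1 = n -> depends (cols n) (vacant (col j)).
  by move=> jn; apply: depends_sub (@vacant_depends (col j)); apply: col_sub; rewrite -jn.
by split=> h j jn; [rewrite -(dv j)|rewrite (dv j)] => //; exact: h.
Qed.

(** The recursion of [no_gap_le] from below: the last column is occupied, and the one before is
    either occupied too or vacant after a shorter traversable strip. The constant u / b is what n =
    0 (where u <= b) and n = 1 allow. *)
Lemma traversable_ge n : (n <= N)%N -> u * b ^+ n <= b * Pr p s (traversable n).
Proof.
have u1 : u <= 1 by exact: le_trans ub b1.
have b0 : 0 < b by exact: lt_le_trans ub.
have Pnv j : (j < N)%N -> Pr p s (fun w => ~ vacant (col j) w) = u.
  by move=> jN; rewrite Pr_not Pr_col //; ring.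
have nonvac_dep j : depends [set x | col j x] (fun w => ~ vacant (col j) w).
  exact: depends_comp (@vacant_depends (col j)).
elim/ltn_ind: n => -[|[|n]] IH nN.
- rewrite (_ : Pr _ _ _ = 1) ?mulr1 // -[RHS](Ex_cst p s).
  by apply: eq_Ex => w _; rewrite iverT.
- rewrite expr1 mulrC ler_wpM2l ?(ltW b0) // -(Pnv 0%N) //.
  by apply: le_Pr => // w _ h; split => // j [->].
have IH1 := IH n.+1 (leqnn _) (ltnW nN).
have IH0 := IH n (leqnSn _) (ltnW (ltnW nN)).
have h : u * Pr p s (traversable n.+1) + u * ((1 - u) * Pr p s (traversable n))
    <= Pr p s (traversable n.+2).
  pose A1 w := ~ vacant (col n.+1) w /\ traversable n.+1 w.
  pose A2 w := ~ vacant (col n.+1) w /\ (vacant (col n) w /\ traversable n w).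
  have e1 : Pr p s A1 = u * Pr p s (traversable n.+1).
    rewrite /A1 (@Pr_indep _ _ p s [set x | col n.+1 x]) ?Pnv //.
    by apply: depends_sub (@traversable_depends n.+1); exact: U_disj.
  have e2 : Pr p s A2 = u * ((1 - u) * Pr p s (traversable n)).
    rewrite /A2 (@Pr_indep _ _ p s [set x | col n.+1 x]) ?Pnv //; last first.
      apply: (depends_sub (@U_disj n.+1)); apply: depends_and.
        by apply: (depends_sub (@col_sub n n.+1 (leqnn _))); exact: vacant_depends.
      by apply: (depends_sub (@U_sub n n.+1 (leqnSn _))); exact: traversable_depends.
    rewrite (@Pr_indep _ _ p s [set x | col n x]) ?Pr_col //; first exact: ltnW.
      exact: vacant_depends.
    by apply: (depends_sub (@U_disj n)); exact: traversable_depends.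
  rewrite -e1 -e2 -Pr_or_disjoint; last first.
    by move=> w [_ [_ h]] [_ [va _]]; exact: (h n).
  apply: le_Pr => // w _ [[nv [ng l]]|[nv [va [ng l]]]]; split; try by move=> j [->].
    move=> j; rewrite ltnS leq_eqVlt => /predU1P[[->] //|jn]; exact: ng.
  move=> j; rewrite ltnS leq_eqVlt => /predU1P[[->] //|].
  rewrite ltnS leq_eqVlt => /predU1P[e|jn]; last exact: ng.
  by move=> _ _ vj; case: (l j e).
apply: le_trans (_ : b * (u * Pr p s (traversable n.+1) + u * ((1 - u) * Pr p s (traversable n))) <= _); last first.
  by rewrite ler_wpM2l // ltW.
rewrite !exprS; have bbE := bE; rewrite expr2 in bbE.
have -> : u * (b * (b * b ^+ n)) = u * (u * b ^+ n.+1) + (u * (1 - u)) * (u * b ^+ n).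
  by rewrite (mulrA b b) bbE exprS; ring.
rewrite [leRHS]mulrDr; apply: lerD.
  by rewrite [leRHS]mulrCA ler_wpM2l // ltW.
have -> : b * (u * ((1 - u) * Pr p s (traversable n))) =
  (u * (1 - u)) * (b * Pr p s (traversable n)) by ring.
by rewrite ler_wpM2l // mulr_ge0 ?subr_ge0 // ltW.
Qed.

End Strips.

(** * Holroyd's integral *)

Section Calculus.
Variable R : realType.
Implicit Types (f df : R -> R) (a b s t u x y z : R).

Lemma is_derive_lnf f x d : is_derive x 1 f d -> 0 < f x ->
  is_derive x 1 (fun t => ln (f t)) (d / f x).
Proof.
move=> h h0; have := @is_derive1_comp _ (@ln R) f x _ _ (is_derive1_ln h0) h.
by rewrite mulrC.
Qed.

Lemma MVT_le f df a b : a < b ->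
  (forall x, a <= x <= b -> is_derive x 1 f (df x)) ->
  exists2 c, a < c < b & f b - f a = df c * (b - a).
Proof.
move=> ab h.
have [|x|c] := @MVT R f df a b ab; last by rewrite in_itv /= => ? ?; exists c.
- by move=> x; rewrite in_itv /= => /andP[ax xb]; apply: h; rewrite !ltW.
- apply: derivable_within_continuous => t; rewrite in_itv /= => tab.
  by have [hd _] := h t tab.
Qed.

Lemma nondecr_of_derive f df a b : a <= b ->
  (forall x, a <= x <= b -> is_derive x 1 f (df x)) ->
  (forall x, a < x < b -> 0 <= df x) -> f a <= f b.
Proof.
rewrite le_eqVlt => /predU1P[-> //|ab] h h0.
have [c cab e] := MVT_le ab h.
by rewrite -subr_ge0 e mulr_ge0 ?h0 // subr_ge0 ltW.
Qed.

Lemma incr_of_derive f df a b : a < b ->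
  (forall x, a <= x <= b -> is_derive x 1 f (df x)) ->
  (forall x, a < x < b -> 0 < df x) -> f a < f b.
Proof.
move=> ab h h0.
have [c cab e] := MVT_le ab h.
by rewrite -subr_gt0 e mulr_gt0 ?h0 // subr_gt0.
Qed.

(* The curve e^{-2z}(1 - e^{-z}) = e^{-2g}(1 - e^{-g}) is parametrized by the ratio
   t = e^{z-g}, via e^{-z} = (1+t)/(1+t+t^2) and e^{-g} = t(1+t)/(1+t+t^2). *)
Definition zt t : R := ln (1 + t + t ^+ 2) - ln (1 + t).
Definition gt t : R := zt t - ln t.
Definition dzt t : R := (2 * t + t ^+ 2) / ((1 + t + t ^+ 2) * (1 + t)).
(** This is dg/dz along the curve, the quotient of the two derivatives (see [dgtE]); its
    monotonicity in t is the convexity of g as a function of z. *)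
Definition slope t : R := - ((1 + 2 * t) / (t ^+ 2 * (2 + t))).

Lemma poly2_gt0 t : 0 <= t -> 0 < 1 + t + t ^+ 2.
Proof. by move=> t0; nra. Qed.

Lemma is_derive_zt t : 0 <= t -> is_derive t 1 zt (dzt t).
Proof.
move=> t0; have p0 := poly2_gt0 t0.
have d1 : is_derive t 1 (fun t : R => 1 + t + t ^+ 2) (1 + 2 * t).
  apply: is_derive_eq; rewrite /GRing.scale /=; ring.
have d2 : is_derive t 1 (fun t : R => 1 + t) 1.
  apply: is_derive_eq; ring.
have t1 : 0 < 1 + t by lra.
apply: (is_derive_eq (is_deriveB (is_derive_lnf d1 p0) (is_derive_lnf d2 t1))).
rewrite /dzt; field.
by rewrite !gt_eqF.
Qed.

Lemma is_derive_gt t : 0 < t -> is_derive t 1 gt (dzt t - t^-1).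
Proof.
move=> t0.
exact: is_deriveB (is_derive_zt (ltW t0)) (is_derive1_ln t0).
Qed.

Lemma dzt_gt0 t : 0 < t -> 0 < dzt t.
Proof.
move=> t0; have := poly2_gt0 (ltW t0) => p0.
by rewrite /dzt divr_gt0 //; [nra|rewrite mulr_gt0 //; lra].
Qed.

Lemma dgtE t : 0 < t -> dzt t - t^-1 = slope t * dzt t.
Proof.
move=> t0; have p0 := poly2_gt0 (ltW t0); rewrite /slope /dzt; field.
by rewrite !gt_eqF //; lra.
Qed.

Lemma slope_lt0 t : 0 < t -> slope t < 0.
Proof. by move=> t0; rewrite /slope oppr_lt0 divr_gt0 //; nra. Qed.

Lemma slope_nondecr s t : 0 < s -> s <= t -> slope s <= slope t.
Proof.
move=> s0 st; have t0 : 0 < t by lra.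
rewrite /slope lerN2 ler_pdivrMr; last by rewrite mulr_gt0 ?exprn_gt0 //; lra.
rewrite mulrAC ler_pdivlMr; last by rewrite mulr_gt0 ?exprn_gt0 //; lra.
rewrite -subr_ge0.
have -> : (1 + 2 * s) * (t ^+ 2 * (2 + t)) - (1 + 2 * t) * (s ^+ 2 * (2 + s)) =
  (t - s) * (t ^+ 2 + t * s + s ^+ 2 + 2 * (t + s) + 2 * (s * t) * (t + s) + 4 * (s * t)).
  by ring.
rewrite mulr_ge0 ?subr_ge0 //.
have st0 : 0 < s * t by rewrite mulr_gt0.
have := mulr_gt0 st0 (addr_gt0 t0 s0); nra.
Qed.

Lemma zt_lt s t : 0 <= s -> s < t -> zt s < zt t.
Proof.
move=> s0 st; apply: (incr_of_derive (df := dzt)) => //.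
  by move=> x /andP[sx _]; apply: is_derive_zt; lra.
by move=> x /andP[sx _]; apply: dzt_gt0; lra.
Qed.

Lemma zt_le s t : 0 <= s -> s <= t -> zt s <= zt t.
Proof. by move=> s0; rewrite le_eqVlt => /predU1P[->|/(zt_lt s0)/ltW]. Qed.

Lemma zt0 : zt 0 = 0.
Proof. by rewrite /zt expr0n /= !addr0 subrr. Qed.

Lemma zt_gt0 t : 0 < t -> 0 < zt t.
Proof. by move=> t0; rewrite -zt0 zt_lt. Qed.

Lemma zt_ge0 t : 0 <= t -> 0 <= zt t.
Proof. by move=> t0; rewrite -zt0 zt_le. Qed.

Lemma gt_le s t : 0 < s -> s <= t -> gt t <= gt s.
Proof.
move=> s0 st; rewrite -lerN2.
apply: (nondecr_of_derive (f := fun t => - gt t) (df := fun t => - (dzt t - t^-1))) => //.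
  by move=> x /andP[sx _]; apply: is_deriveN; apply: is_derive_gt; lra.
move=> x /andP[sx _]; have x0 : 0 < x by lra.
by rewrite dgtE // -mulNr ltW // mulr_gt0 ?oppr_gt0 ?slope_lt0 ?dzt_gt0.
Qed.

(** The substitution t -> 1/t exchanges the coordinates z and g, which is the symmetry of the curve
    about the diagonal. *)
Lemma gt_inv t : 0 < t -> zt t^-1 = gt t.
Proof.
move=> t0; have p0 := poly2_gt0 (ltW t0); have t1 : 0 < 1 + t by lra.
have tn : t != 0 by rewrite gt_eqF.
rewrite /gt /zt.
have -> : 1 + t^-1 + t^-1 ^+ 2 = (1 + t + t ^+ 2) / t / t by field.
have -> : 1 + t^-1 = (1 + t) / t by field.
rewrite !ln_div ?posrE ?divr_gt0 //; lra.
Qed.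

Lemma gt_gt0 t : 0 < t -> 0 < gt t.
Proof. by move=> t0; rewrite -gt_inv // zt_gt0 // invr_gt0. Qed.

(** The derivative of [gt u - slope s * zt u] is [(slope u - slope s) * dzt u], which changes sign
    at s, so the minimum is there. *)
Lemma gt_tangent s t : 0 < s -> 0 < t -> gt s + slope s * (zt t - zt s) <= gt t.
Proof.
move=> s0 t0; rewrite -lerBrDl.
pose f u := gt u - slope s * zt u.
have df (u : R) : 0 < u -> is_derive u 1 f ((slope u - slope s) * dzt u).
  move=> u0; apply: (is_derive_eq (is_deriveB (is_derive_gt u0)
    (is_deriveZ (slope s) (is_derive_zt (ltW u0))))).
  by rewrite /GRing.scale /= dgtE // mulrBl.
suff : f s <= f t by rewrite /f; lra.
case: (leP s t) => st.
  apply: (nondecr_of_derive (df := fun u => (slope u - slope s) * dzt u)) => // u /andP[h1 h2].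
    by apply: df; lra.
  rewrite mulr_ge0 // ?subr_ge0 ?slope_nondecr //; first lra.
  by rewrite ltW // dzt_gt0; lra.
rewrite -lerN2.
apply: (nondecr_of_derive (f := fun u => - f u) (df := fun u => - ((slope u - slope s) * dzt u))) => [|u /andP[h1 h2]|u /andP[h1 h2]].
- lra.
- by apply: is_deriveN; apply: df; lra.
rewrite -mulNr mulr_ge0 // ?oppr_ge0 ?subr_le0 ?slope_nondecr //; try lra.
by rewrite ltW // dzt_gt0; lra.
Qed.

Lemma zt_leX t : 0 <= t -> zt t <= t ^+ 2.
Proof.
move=> t0; rewrite /zt -ln_div ?posrE ?poly2_gt0 //; last lra.
have -> : (1 + t + t ^+ 2) / (1 + t) = 1 + t ^+ 2 / (1 + t).
  by field; rewrite gt_eqF //; lra.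
have h : 0 <= t ^+ 2 / (1 + t) by rewrite divr_ge0 ?sqr_ge0 //; lra.
apply: le_trans (le_ln1Dx _) _; first by lra.
by rewrite ler_pdivrMr; [nra|lra].
Qed.

End Calculus.

(** * The sum of the inverse squares *)

Section Basel.
Variable R : realType.
Implicit Types (x t : R).

Lemma sin_le x : 0 <= x -> sin x <= x.
Proof.
move=> x0; rewrite -subr_ge0.
have -> : 0 = 0 - sin 0 :> R by rewrite sin0 subr0.
apply: (nondecr_of_derive (f := fun y : R => y - sin y) (df := fun y => 1 - cos y)) => // y _.
Qed.

Lemma sin_ge x : 0 <= x <= pi -> x * cos x <= sin x.
Proof.
move=> /andP[x0 xpi]; rewrite -subr_ge0.
have -> : 0 = sin 0 - 0 * cos 0 :> R by rewrite sin0 mul0r subr0.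
apply: (nondecr_of_derive (f := fun y : R => sin y - y * cos y) (df := fun y => y * sin y)) => //.
  move=> y _; apply: is_derive_eq; rewrite /GRing.scale /=; ring.
by move=> y /andP[y0 yx]; rewrite mulr_ge0 ?sin_ge0_pi //; lra.
Qed.

(** From x cos x <= sin x <= x, squared and inverted; the constant 1 comes from cos^2 = 1 -
    sin^2. *)
Lemma inv_sin2_bounds x : 0 < x < pi / 2 ->
  (x ^+ 2)^-1 <= (sin x ^+ 2)^-1 <= (x ^+ 2)^-1 + 1.
Proof.
move=> /andP[x0 xpi]; have pi0 := @pi_gt0 R.
have s0 : 0 < sin x by apply: sin_gt0_pihalf; rewrite x0 xpi.
have s1 := sin_le (ltW x0).
have s2 : x * cos x <= sin x by apply: sin_ge; lra.
have c0 : 0 <= cos x by apply: cos_ge0_pihalf; lra.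
have e := cos2Dsin2 x.
apply/andP; split.
  by rewrite lef_pV2 ?posrE ?exprn_gt0 // lerXn2r ?nnegrE //; lra.
have x20 : 0 < x ^+ 2 by rewrite exprn_gt0.
have -> : (x ^+ 2)^-1 + 1 = ((x ^+ 2) / (1 + x ^+ 2))^-1.
  by field; rewrite !gt_eqF //; lra.
rewrite lef_pV2 ?posrE ?exprn_gt0 ?divr_gt0 //; last lra.
rewrite ler_pdivrMr; last lra.
have : (x * cos x) ^+ 2 <= sin x ^+ 2 by rewrite lerXn2r ?nnegrE // ?mulr_ge0 //; lra.
rewrite exprMn -(subrK (sin x ^+ 2) (cos x ^+ 2)) in e *; nra.
Qed.

Definition odd_angle (n k : nat) : R := (2 * k%:R + 1) * pi / 2 ^+ n.+2.

Lemma inv_sin2_double x : sin x != 0 -> cos x != 0 ->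
  (sin x ^+ 2)^-1 + (cos x ^+ 2)^-1 = 4 * (sin (x *+ 2) ^+ 2)^-1.
Proof.
move=> s c; have e := cos2Dsin2 x.
have -> : sin (x *+ 2) = 2 * (cos x * sin x) by rewrite sin_mulr2n -mulr_natl.
have -> : (sin x ^+ 2)^-1 + (cos x ^+ 2)^-1 =
  (cos x ^+ 2 + sin x ^+ 2) / (cos x ^+ 2 * sin x ^+ 2) by field; rewrite s c.
by rewrite e; field; rewrite s c.
Qed.

Lemma odd_angle_lt n k : (k < 2 ^ n)%N -> 0 < odd_angle n k < pi / 2.
Proof.
move=> kn; have pi0 := @pi_gt0 R; have p0 : (0 : R) < 2 ^+ n.+2 by rewrite exprn_gt0.
have k0 : 0 <= k%:R :> R by [].
rewrite /odd_angle; apply/andP; split.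
  by rewrite divr_gt0 // mulr_gt0 //; lra.
rewrite ltr_pdivrMr //.
have -> : pi / 2 * 2 ^+ n.+2 = (2 * 2 ^+ n) * pi :> R by rewrite !exprS; field.
rewrite ltr_pM2r //.
have : (k.+1%:R <= (2 ^ n)%:R :> R) by rewrite ler_nat.
rewrite natrX -natr1; lra.
Qed.

(* Doubling the angle turns each term of index [n] into a quarter of two terms of index
   [n.+1], the second angle being complementary. *)
Lemma sum_inv_sin2 n :
  \sum_(k < 2 ^ n) (sin (odd_angle n k) ^+ 2)^-1 = 2 * 4 ^+ n :> R.
Proof.
have pi0 := @pi_gt0 R.
elim: n => [|n IH].
  rewrite expn0 big_ord_recl big_ord0 addr0 expr0 mulr1 /odd_angle /=.
  have -> : (2 * 0%:R + 1) * pi / 2 ^+ 2 = pi / 4 :> R by field.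
  have sc : cos (pi / 4) = sin (pi / 4) :> R.
    by rewrite -cosBpihalf -cosN; congr cos; field.
  have := cos2Dsin2 (pi / 4 : R); rewrite sc => e.
  have -> : sin (pi / 4) ^+ 2 = 2^-1 :> R by lra.
  by rewrite invrK.
have e2 : (2 ^ n.+1 = 2 ^ n + 2 ^ n)%N by rewrite expnS mul2n addnn.
rewrite [in LHS]e2 big_split_ord /= [X in _ + X](reindex_inj rev_ord_inj) /= -big_split /=.
rewrite exprS mulrCA -IH mulr_sumr; apply: eq_bigr => k _.
set x := odd_angle n.+1 k.
have ltk : (k < 2 ^ n.+1)%N by rewrite e2; apply: leq_trans (ltn_ord k) (leq_addr _ _).
have /andP[x0 xpi] := odd_angle_lt ltk; rewrite -/x in x0 xpi.
have -> : odd_angle n.+1 (2 ^ n + (2 ^ n - k.+1)) = pi / 2 - x.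
  rewrite /x /odd_angle addnBA ?ltn_ord // -e2 natrB; last by rewrite e2 (leq_trans (ltn_ord k)) ?leq_addr.
  rewrite natrX -natr1 !exprS; field.
  by rewrite expf_neq0.
have -> : sin (pi / 2 - x) = cos x by rewrite -cosBpihalf -cosN; congr cos; field.
have -> : odd_angle n k = x *+ 2.
  rewrite -mulr_natl /x /odd_angle !exprS; field; by rewrite expf_neq0.
apply: inv_sin2_double; rewrite gt_eqF //.
  by apply: sin_gt0_pihalf; rewrite x0.
by apply: cos_gt0_pihalf; lra.
Qed.

Definition odd_sum (N : nat) : R := \sum_(k < N) ((2 * k%:R + 1) ^+ 2)^-1.

(** Sum [inv_sin2_bounds] over the 2^n angles: the exact value 2 * 4^n lies between a multiple of
    the odd sum and that multiple plus 2^n. *)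
Lemma odd_sum_bounds n :
  pi ^+ 2 / 8 - pi ^+ 2 / 16 / 2 ^+ n <= odd_sum (2 ^ n) <= pi ^+ 2 / 8.
Proof.
have pi0 := @pi_gt0 R; have p2 : 0 < pi ^+ 2 :> R by rewrite exprn_gt0.
have q0 : (0 : R) < 4 ^+ n by rewrite exprn_gt0.
have e k : (odd_angle n k ^+ 2)^-1 = 16 * 4 ^+ n / pi ^+ 2 * ((2 * k%:R + 1) ^+ 2)^-1.
  rewrite /odd_angle; have -> : 4 ^+ n = (2 ^+ n) ^+ 2 :> R.
    by rewrite -exprM mulnC exprM -(natrX _ 2 2).
  have k0 : 0 <= k%:R :> R by [].
  have k1 : 2 * k%:R + 1 != 0 :> R by rewrite gt_eqF //; lra.
  have p1 : pi != 0 :> R by rewrite gt_eqF.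
  rewrite !exprS; move: (pi : R) p1 => P p1; field.
  by rewrite k1 p1 expf_neq0.
have lo : \sum_(k < 2 ^ n) (odd_angle n k ^+ 2)^-1 <= 2 * 4 ^+ n.
  rewrite -sum_inv_sin2; apply: ler_sum => k _.
  by have /andP[] := inv_sin2_bounds (odd_angle_lt (ltn_ord k)).
have hi : 2 * 4 ^+ n <= \sum_(k < 2 ^ n) (odd_angle n k ^+ 2)^-1 + 2 ^+ n.
  rewrite -sum_inv_sin2.
  have -> : 2 ^+ n = \sum_(k < 2 ^ n) 1 :> R.
    by rewrite sumr_const card_ord natrX.
  rewrite -big_split; apply: ler_sum => k _.
  by have /andP[] := inv_sin2_bounds (odd_angle_lt (ltn_ord k)).
have eS : \sum_(k < 2 ^ n) (odd_angle n k ^+ 2)^-1 = 16 * 4 ^+ n / pi ^+ 2 * odd_sum (2 ^ n).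
  by rewrite /odd_sum mulr_sumr; apply: eq_bigr => k _.
rewrite {}eS in lo hi.
have k0 : 0 < 16 * 4 ^+ n / pi ^+ 2 :> R by rewrite divr_gt0 // mulr_gt0.
have p4 : 4 ^+ n = 2 ^+ n * 2 ^+ n :> R by rewrite -exprMn -natrM.
have h0 : (0 : R) < 2 ^+ n by rewrite exprn_gt0.
apply/andP; split; rewrite -(ler_pM2l k0); last first.
  have -> : 16 * 4 ^+ n / pi ^+ 2 * (pi ^+ 2 / 8) = 2 * 4 ^+ n :> R; last by [].
  by move: (pi ^+ 2 : R) p2 => P P0; field; rewrite gt_eqF.
have -> : 16 * 4 ^+ n / pi ^+ 2 * (pi ^+ 2 / 8 - pi ^+ 2 / 16 / 2 ^+ n) = 2 * 4 ^+ n - 2 ^+ n :> R.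
  by rewrite p4; move: (pi ^+ 2 : R) p2 => P P0; field; rewrite !gt_eqF.
by rewrite lerBlDr.
Qed.

Definition zeta2_sum (N : nat) : R := \sum_(k < N) (k.+1%:R ^+ 2)^-1.

(** The even indices reproduce a quarter of the shorter sum, so the limit is 4/3 of that of the odd
    sum. *)
Lemma zeta2_sumD N : zeta2_sum (N + N) = odd_sum N + zeta2_sum N / 4.
Proof.
elim: N => [|N IH]; first by rewrite /zeta2_sum /odd_sum !big_ord0 mul0r addr0.
rewrite addSn addnS /zeta2_sum !big_ord_recr /= -!/(zeta2_sum _) IH.
rewrite /odd_sum big_ord_recr /= -/(odd_sum _).
rewrite -!natr1 natrD; have : 0 <= N%:R :> R by [].
move: (N%:R) => x x0; field; apply/andP; split; rewrite gt_eqF //; lra.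
Qed.

Lemma zeta2_sum_le m n : (m <= n)%N -> zeta2_sum m <= zeta2_sum n.
Proof.
move=> /subnK <-; elim: (n - m)%N => // k IH.
rewrite addSn /zeta2_sum big_ord_recr /= (le_trans IH) // lerDl invr_ge0.
exact: sqr_ge0.
Qed.

Lemma odd_sum_le m n : (m <= n)%N -> odd_sum m <= odd_sum n.
Proof.
move=> /subnK <-; elim: (n - m)%N => // k IH.
rewrite addSn /odd_sum big_ord_recr /= (le_trans IH) // lerDl invr_ge0.
exact: sqr_ge0.
Qed.

Lemma zeta2_sum_ub N : zeta2_sum N <= pi ^+ 2 / 6.
Proof.
have h1 := zeta2_sum_le (leq_addr N N); rewrite zeta2_sumD in h1.
have h2 := odd_sum_le (ltnW (ltn_expl N (isT : (1 < 2)%N))).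
have /andP[_ h3] := odd_sum_bounds N; lra.
Qed.

Lemma zeta2_sum_lb n : pi ^+ 2 / 6 - pi ^+ 2 / 4 / 2 ^+ n <= zeta2_sum (2 ^ n).
Proof.
elim: n => [|n IH].
  rewrite expn0 /zeta2_sum big_ord_recl big_ord0 addr0 expr0 divr1 expr1n invr1.
  have := sqr_ge0 (pi : R); lra.
rewrite expnS mul2n -addnn zeta2_sumD.
have /andP[h _] := odd_sum_bounds n.
have p0 : (0 : R) < 2 ^+ n by rewrite exprn_gt0.
(* The error constant 1/4 is the solution c of c / 2 = 1 / 16 + c / 4. *)
have -> : pi ^+ 2 / 4 / 2 ^+ n.+1 = pi ^+ 2 / 16 / 2 ^+ n + pi ^+ 2 / 4 / 2 ^+ n / 4 :> R.
  by rewrite (exprS _ n); move: (pi ^+ 2 : R) => P; field; rewrite gt_eqF.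
lra.
Qed.

Lemma zeta2_cvg : zeta2_sum N @[N --> \oo] --> (pi ^+ 2 / 6 : R).
Proof.
have nd : nondecreasing_seq zeta2_sum by move=> m n; exact: zeta2_sum_le.
have cv : cvgn zeta2_sum.
  apply: nondecreasing_is_cvgn => //; exists (pi ^+ 2 / 6) => _ [N _ <-].
  exact: zeta2_sum_ub.
suff -> : pi ^+ 2 / 6 = limn zeta2_sum by [].
apply/eqP; rewrite eq_le; apply/andP; split; last first.
  by apply: limr_le => //; near=> N; exact: zeta2_sum_ub.
apply/ler_addgt0Pr => e e0.
pose C : R := pi ^+ 2 / 4.
pose n := (Num.truncn (C / e)).+1.
have hn : C / e < 2 ^+ n.
  apply: lt_le_trans (truncnS_gt _) _.
  by rewrite -natrX ler_nat ltnW // ltn_expl.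
have h := le_trans (zeta2_sum_lb n) (nondecreasing_cvgn_le nd cv (2 ^ n)).
have p0 : (0 : R) < 2 ^+ n by rewrite exprn_gt0.
rewrite ltr_pdivrMr // in hn.
have : C / 2 ^+ n <= e by rewrite ler_pdivrMr // mulrC ltW.
rewrite -/C in h; lra.
Unshelve. all: by end_near.
Qed.

End Basel.

(** * The series of z(t) and of the integral of z(t)/t *)

Section Dilogarithm.
Variable R : realType.
Implicit Types (x y t : R).

Lemma is_derive_monomial (c : R) n t :
  is_derive t 1 (fun u : R => c * u ^+ n.+1) (c * n.+1%:R * t ^+ n).
Proof.
have h : is_derive t 1 (fun u : R => u ^+ n.+1) (n.+1%:R * t ^+ n).
  have := @is_deriveX R R id n.+1 t 1 1 (is_derive_id t 1).
  by rewrite fctE /= /GRing.scale /= mulr1.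
by apply: (is_derive_eq (is_deriveZ c h)); rewrite /GRing.scale /= mulrA.
Qed.

(* Since 1 + t + t^2 = (1 - t^3) / (1 - t), z(t) = sum_n a_n t^n / n with a_n of period 6,
   namely 0, 2, -3, 2, 0, -1; the series are grouped by periods. *)
Definition dblk m t : R :=
  2 / (6 * m + 2)%:R ^+ 2 * t ^+ (6 * m).+2 - 3 / (6 * m + 3)%:R ^+ 2 * t ^+ (6 * m).+3
  + 2 / (6 * m + 4)%:R ^+ 2 * t ^+ (6 * m).+4 - 1 / (6 * m + 6)%:R ^+ 2 * t ^+ (6 * m + 5).+1.
Definition pblk m t : R :=
  2 / (6 * m + 2)%:R * t ^+ (6 * m).+2 - 3 / (6 * m + 3)%:R * t ^+ (6 * m).+3
  + 2 / (6 * m + 4)%:R * t ^+ (6 * m).+4 - 1 / (6 * m + 6)%:R * t ^+ (6 * m + 5).+1.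
Definition qblk m t : R := t ^+ (6 * m) * (2 * t - 3 * t ^+ 2 + 2 * t ^+ 3 - t ^+ 5).

Definition dsum M t : R := \sum_(m < M) dblk m t.
Definition psum M t : R := \sum_(m < M) pblk m t.

Let natne (n k : nat) : (0 < k)%N -> (n + k)%:R != 0 :> R.
Proof. by move=> k0; rewrite pnatr_eq0 -lt0n addn_gt0 k0 orbT. Qed.

Lemma is_derive_pblk m t : is_derive t 1 (pblk m) (qblk m t).
Proof.
apply: (is_derive_eq (is_deriveB (is_deriveD (is_deriveB (is_derive_monomial _ _ _)
  (is_derive_monomial _ _ _)) (is_derive_monomial _ _ _)) (is_derive_monomial _ _ _))).
rewrite /qblk; move: (6 * m)%N => n.
have h k : (0 < k)%N -> (n + k)%:R != 0 :> R by exact: natne.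
rewrite -[n.+4]addn4 -[n.+3]addn3 -[n.+2]addn2 -[n.+1]addn1 -[(n + 5).+1]addn1 -addnA.
rewrite !divfK ?h // !exprD expr1.
by move: (t ^+ n) => u; ring.
Qed.

(* At 0 the derivative is 0, which is also the value of _ / 0. *)
Lemma is_derive_dblk m t : is_derive t 1 (dblk m) (pblk m t / t).
Proof.
apply: (is_derive_eq (is_deriveB (is_deriveD (is_deriveB (is_derive_monomial _ _ _)
  (is_derive_monomial _ _ _)) (is_derive_monomial _ _ _)) (is_derive_monomial _ _ _))).
have [->|t0] := eqVneq t 0.
  by rewrite invr0 mulr0 (_ : 6 * m + 5 = (6 * m).+4.+1)%N ?addnS ?addn0 // !expr0n /= !mulr0 !subr0 addr0.
rewrite /pblk; move: (6 * m)%N => n.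
have h k : (0 < k)%N -> (n + k)%:R != 0 :> R by exact: natne.
rewrite -[n.+4]addn4 -[n.+3]addn3 -[n.+2]addn2 -[n.+1]addn1 -[(n + 5).+1]addn1 -addnA.
have := h 2%N isT; have := h 3%N isT; have := h 4%N isT; have := h (5 + 1)%N isT.
rewrite !exprD expr1; move: (t ^+ n) ((n + 2)%:R) ((n + 3)%:R) ((n + 4)%:R) ((n + (5 + 1))%:R).
move=> u a b c d h1 h2 h3 h4; field.
by rewrite h1 h2 h3 h4 t0.
Qed.

Lemma is_derive_psum M t : is_derive t 1 (psum M) (\sum_(m < M) qblk m t).
Proof.
elim: M => [|M IH].
  rewrite big_ord0; have -> : psum 0 = cst 0 by apply/funext => u; rewrite /psum big_ord0.
  exact: is_derive_cst.
rewrite big_ord_recr /=.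
have -> : psum M.+1 = psum M \+ pblk M by apply/funext => u; rewrite /psum big_ord_recr.
exact: is_deriveD IH (is_derive_pblk _ _).
Qed.

Lemma is_derive_dsum M t : is_derive t 1 (dsum M) (psum M t / t).
Proof.
elim: M => [|M IH].
  rewrite /psum big_ord0 mul0r; have -> : dsum 0 = cst 0 by apply/funext => u; rewrite /dsum big_ord0.
  exact: is_derive_cst.
rewrite /psum big_ord_recr /= mulrDl.
have -> : dsum M.+1 = dsum M \+ dblk M by apply/funext => u; rewrite /dsum big_ord_recr.
exact: is_deriveD IH (is_derive_dblk _ _).
Qed.

(** A geometric sum: the first block is [dzt t * (1 - t ^+ 6)], and each further block carries one
    more factor t^6. *)
Lemma dzt_sum M t : 0 <= t -> dzt t - \sum_(m < M) qblk m t = dzt t * t ^+ (6 * M).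
Proof.
move=> t0; elim: M => [|M IH]; first by rewrite big_ord0 muln0 expr0 subr0 mulr1.
rewrite big_ord_recr /= opprD addrA IH mulnS addnC exprD /qblk /dzt.
have p0 := poly2_gt0 t0.
move: (t ^+ (6 * M)) => u; field.
by rewrite !gt_eqF //; lra.
Qed.

(** By [dzt_sum] the difference has derivative between 0 and 2 t^(6M), since dz/dt <= 2 on [0, 1].
    The bound is linear in t because it gets divided by t later. *)
Lemma psum_bounds M t : 0 <= t <= 1 -> 0 <= zt t - psum M t <= 2 / (6 * M).+1%:R * t.
Proof.
move=> /andP[t0 t1].
have psum0 : psum M 0 = 0.
  rewrite /psum big1 // => m _; rewrite /pblk !expr0n /=; ring.
have df x : 0 <= x -> is_derive x 1 (fun x => zt x - psum M x) (dzt x * x ^+ (6 * M)).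
  move=> x0; rewrite -dzt_sum //.
  exact: is_deriveB (is_derive_zt x0) (is_derive_psum _ _).
have dz0 x : 0 <= x -> 0 <= dzt x.
  move=> x0; have := poly2_gt0 x0 => p0; rewrite /dzt divr_ge0 //.
    by rewrite addr_ge0 ?mulr_ge0 ?exprn_ge0.
  by rewrite mulr_ge0 //; lra.
apply/andP; split.
  have -> : 0 = zt 0 - psum M 0 by rewrite zt0 psum0 subrr.
  apply: (nondecr_of_derive (f := fun x => zt x - psum M x) (df := fun x => dzt x * x ^+ (6 * M))) => //.
    by move=> x /andP[x0 _]; exact: df.
  by move=> x /andP[x0 _]; rewrite mulr_ge0 ?exprn_ge0 ?dz0 //; lra.
apply: (@le_trans _ _ (2 / (6 * M).+1%:R * t ^+ (6 * M).+1)); last first.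
  rewrite ler_wpM2l ?divr_ge0 // exprS ler_piMr // exprn_ile1 //.
rewrite -subr_ge0.
have -> : 0 = 2 / (6 * M).+1%:R * 0 ^+ (6 * M).+1 - (zt 0 - psum M 0).
  by rewrite zt0 psum0 expr0n /=; ring.
apply: (nondecr_of_derive (f := fun x => 2 / (6 * M).+1%:R * x ^+ (6 * M).+1 - (zt x - psum M x))
  (df := fun x => 2 * x ^+ (6 * M) - dzt x * x ^+ (6 * M))) => //.
  move=> x /andP[x0 _]; apply: is_deriveB (df x x0).
  by apply: (is_derive_eq (is_derive_monomial _ _ _)); rewrite divfK // pnatr_eq0.
move=> x /andP[x0 x1]; rewrite -mulrBl mulr_ge0 ?exprn_ge0 ?(ltW x0) // subr_ge0.
have p0 := poly2_gt0 (ltW x0).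
rewrite /dzt ler_pdivrMr; last by rewrite mulr_gt0 //; lra.
by have := exprn_gt0 3 x0; nra.
Qed.

Lemma dsum0 M : dsum M 0 = 0.
Proof. by rewrite /dsum big1 // => m _; rewrite /dblk !expr0n /=; ring. Qed.

Lemma zt_le_id t : 0 <= t <= 1 -> zt t <= t.
Proof.
move=> /andP[t0 t1]; apply: le_trans (zt_leX t0) _.
by rewrite expr2 ler_piMl.
Qed.


End Dilogarithm.

Section DilogLimit.
Variable R : realType.
Implicit Types (x y t : R).

(** Over a whole period the derivative factors as t^(6m) t (2 + t) (1 - t) (1 - t + t^2), so the
    grouped terms are nonnegative on [0, 1]; the partial sums then increase with M and converge up
    to t = 1. *)
Lemma pblk_ge0 m t : 0 <= t <= 1 -> 0 <= pblk m t.
Proof.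
move=> /andP[t0 t1].
have <- : pblk m (0 : R) = 0 by rewrite /pblk !expr0n /=; ring.
apply: (nondecr_of_derive (f := @pblk R m) (df := qblk m) t0) => [x _|x /andP[x0 x1]].
  exact: is_derive_pblk.
rewrite mulr_ge0 ?exprn_ge0 ?(ltW x0) //.
have -> : 2 * x - 3 * x ^+ 2 + 2 * x ^+ 3 - x ^+ 5 =
  x * (2 + x) * (1 - x) * (1 - x + x ^+ 2) by ring.
by rewrite !mulr_ge0 //; [lra|lra|lra|nra].
Qed.

Lemma dblk_ge0 m t : 0 <= t <= 1 -> 0 <= dblk m t.
Proof.
move=> /andP[t0 t1].
have <- : dblk m (0 : R) = 0 by rewrite /dblk !expr0n /=; ring.
apply: (nondecr_of_derive (f := @dblk R m) (df := fun x => pblk m x / x) t0) => [x _|x /andP[x0 x1]].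
  exact: is_derive_dblk.
by rewrite divr_ge0 ?pblk_ge0 ?(ltW x0) //=; lra.
Qed.

Lemma dsum_nondecr t : 0 <= t <= 1 -> nondecreasing_seq (fun M => dsum M t).
Proof.
move=> t01; apply/nondecreasing_seqP => n.
by rewrite /dsum big_ord_recr /= lerDl dblk_ge0.
Qed.

Lemma dsum_le M t : 0 <= t <= 1 -> dsum M t <= t.
Proof.
move=> /andP[t0 t1]; rewrite -subr_ge0.
have -> : 0 = 0 - dsum M (0 : R) by rewrite dsum0 subr0.
apply: (nondecr_of_derive (f := fun x => x - dsum M x) (df := fun x => 1 - psum M x / x)) => //.
  by move=> x _; apply: is_deriveB (is_derive_dsum M x).
move=> x /andP[x0 x1]; have x01 : 0 <= x <= 1 by lra.
have /andP[h _] := psum_bounds M x01.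
rewrite subr_ge0 ler_pdivrMr // mul1r; have := zt_le_id x01; lra.
Qed.

Lemma dsum_ge0 M t : 0 <= t <= 1 -> 0 <= dsum M t.
Proof. by move=> t01; apply: sumr_ge0 => m _; exact: dblk_ge0. Qed.

(** On [0, 1] this is Li_2(t^2) / 2 - Li_2(t^3) / 3, the integral of z(s)/s over [0, t]. *)
Definition dilog t : R := limn (fun M => dsum M t).

Lemma dsum_cvg t : 0 <= t <= 1 -> dsum M t @[M --> \oo] --> dilog t.
Proof.
move=> t01; apply: nondecreasing_is_cvgn; first exact: dsum_nondecr.
by exists t => _ [M _ <-]; exact: dsum_le.
Qed.

Lemma dilog_bounds t : 0 <= t <= 1 -> 0 <= dilog t <= t.
Proof.
move=> t01; apply/andP; split.
  by apply: limr_ge; [exact: dsum_cvg t01|near=> M; exact: dsum_ge0].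
by apply: limr_le; [exact: dsum_cvg t01|near=> M; exact: dsum_le].
Unshelve. all: by end_near.
Qed.

(** The coefficients are 2 on even indices and -3 on multiples of 3, adding up to -1 on multiples of
    6. *)
Lemma dsum1 M : dsum M (1 : R) = zeta2_sum R (3 * M) / 2 - zeta2_sum R (2 * M) / 3.
Proof.
elim: M => [|M IH]; first by rewrite !muln0 /dsum /zeta2_sum !big_ord0; ring.
rewrite /dsum big_ord_recr /= -/(dsum M 1) IH !mulnS /dblk !expr1n !mulr1.
rewrite (_ : 3 + 3 * M = (3 * M).+3)%N // (_ : 2 + 2 * M = (2 * M).+2)%N //.
rewrite /zeta2_sum !big_ord_recr /= -!/(zeta2_sum _ _).
rewrite -[(3 * M).+3]addn3 -[(3 * M).+2]addn2 -[(3 * M).+1]addn1.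
rewrite -[(2 * M).+2]addn2 -[(2 * M).+1]addn1 !(natrD _ (_ * _)%N) !natrM.
have : 0 <= M%:R :> R by [].
move: (zeta2_sum R (3 * M)) (zeta2_sum R (2 * M)) (M%:R : R) => a b x x0; field.
by do ?[apply/andP; split]; rewrite gt_eqF //; lra.
Qed.

Lemma dilog1 : dilog (1 : R) = pi ^+ 2 / 36.
Proof.
rewrite /dilog; apply/cvg_lim => //.
have c k : (0 < k)%N -> zeta2_sum R (k * M) @[M --> \oo] --> (pi ^+ 2 / 6 : R).
  move=> k0; apply: cvg_comp (@zeta2_cvg R); apply/cvgnyPge => A.
  by near=> M; rewrite (leq_trans _ (leq_pmull _ k0)) //; near: M; exact: nbhs_infty_ge.
rewrite (_ : (fun M => dsum M 1) = fun M : nat => zeta2_sum R (3 * M) * 2^-1 - zeta2_sum R (2 * M) * 3^-1); last first.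
  by apply/funext => M; rewrite dsum1.
have -> : pi ^+ 2 / 36 = pi ^+ 2 / 6 * 2^-1 - pi ^+ 2 / 6 * 3^-1 :> R.
  by move: (pi ^+ 2 : R) => P; lra.
by apply: cvgB; apply: cvgMr_tmp; exact: c.
Unshelve. all: by end_near.
Qed.

(** A primitive of g dz: since g = z - ln t, integrating ln t dz by parts leaves z(t)/t dt, whose
    primitive is [dilog]. *)
Definition prim t : R := zt t ^+ 2 / 2 - zt t * ln t + dilog t.

Let primM M t : R := zt t ^+ 2 / 2 - zt t * ln t + dsum M t.

Let is_derive_primM M t : 0 < t ->
  is_derive t 1 (primM M) (gt t * dzt t - (zt t - psum M t) / t).
Proof.
move=> t0; have dz := is_derive_zt (ltW t0).
apply: (is_derive_eq (is_deriveD (is_deriveB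
   (is_deriveM (is_deriveX 2 dz) (is_derive_cst (2^-1 : R) t 1))
   (is_deriveM dz (is_derive1_ln t0))) (is_derive_dsum M t))).
rewrite /GRing.scale /= /gt; field; by rewrite gt_eqF.
Qed.

(** The limit [dilog] is not differentiated. The derivative of [primM M] is g dz/dt minus an error
    between 0 and 2 / (6M + 1), so the bounds hold for [primM M] up to a vanishing correction and
    pass to the limit. *)
Lemma prim_bounds x y : 0 < x -> x <= y -> y <= 1 ->
  (zt y - zt x) * gt y <= prim y - prim x <= (zt y - zt x) * gt x.
Proof.
move=> x0 xy y1; have x01 : 0 <= x <= 1 by lra.
have y01 : 0 <= y <= 1 by lra.
have cprim t : 0 <= t <= 1 -> primM M t @[M --> \oo] --> prim t.
  by move=> t01; apply: cvgD; [exact: cvg_cst|exact: dsum_cvg].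
have cB : primM M y - primM M x @[M --> \oo] --> prim y - prim x.
  by apply: cvgB; exact: cprim.
apply/andP; split.
  have lo M : (zt y - zt x) * gt y <= primM M y - primM M x + M.+1%:R^-1 * (2 * (y - x)).
    pose c : R := 2 / (6 * M).+1%:R.
    have c0 : c <= M.+1%:R^-1 * 2.
      by rewrite /c mulrC ler_wpM2r // lef_pV2 ?posrE // ler_nat ltnS leq_pmull.
    suff h : primM M x - gt y * zt x + c * x <= primM M y - gt y * zt y + c * y.
      have : c * (y - x) <= M.+1%:R^-1 * 2 * (y - x) by rewrite ler_wpM2r //; lra.
      move: (M.+1%:R^-1) (primM M x) (primM M y) (zt x) (zt y) (gt y) c h {c0} => m a b zx zy g c h hc.
      nra.
    pose f u := primM M u - gt y * zt u + c * u.
    pose df u := gt u * dzt u - (zt u - psum M u) / u - gt y * dzt u + c.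
    rewrite -[leLHS]/(f x) -[leRHS]/(f y).
    apply: (nondecr_of_derive (df := df) xy).
      move=> u /andP[xu uy]; have u0 : 0 < u by lra.
      apply: (is_derive_eq (is_deriveD (is_deriveB (is_derive_primM M u0)
        (is_deriveZ (gt y) (is_derive_zt (ltW u0)))) (is_deriveZ c (is_derive_id u 1)))).
      by rewrite /GRing.scale /= mulr1.
    move=> u /andP[xu uy]; have u0 : 0 < u by lra.
    rewrite /df => {f df}; have u01 : 0 <= u <= 1 by lra.
    have /andP[_ h1] := psum_bounds M u01.
    rewrite -ler_pdivrMr // -/c in h1.
    have : gt y * dzt u <= gt u * dzt u.
      by rewrite ler_wpM2r ?(ltW (dzt_gt0 u0)) // gt_le //; lra.
    by lra.
  rewrite -[leRHS]addr0 -(mul0r (2 * (y - x))).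
  apply: (cvgr_to_ge (F := \oo) (f := fun M => primM M y - primM M x + M.+1%:R^-1 * (2 * (y - x)))).
    by apply: cvgD => //; apply: cvgMr_tmp; exact: cvg_harmonic.
  by near=> M; exact: lo.
apply: (cvgr_to_le (F := \oo) (f := fun M => primM M y - primM M x)) => //; near=> M.
pose f u := gt x * zt u - primM M u.
pose df u := gt x * dzt u - (gt u * dzt u - (zt u - psum M u) / u).
suff : f x <= f y by rewrite /f; lra.
apply: (nondecr_of_derive (df := df) xy) => [u /andP[xu uy]|].
  have u0 : 0 < u by lra.
  exact: (is_deriveB (is_deriveZ (gt x) (is_derive_zt (ltW u0))) (is_derive_primM M u0)).
rewrite /df => {f df}.
move=> u /andP[xu uy]; have u0 : 0 < u by lra.
have u01 : 0 <= u <= 1 by lra.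
have /andP[h _] := psum_bounds M u01.
have h2 : 0 <= (zt u - psum M u) / u by rewrite divr_ge0 // ltW.
have : gt u * dzt u <= gt x * dzt u.
  by rewrite ler_wpM2r ?(ltW (dzt_gt0 u0)) // gt_le //; lra.
lra.
Unshelve. all: by end_near.
Qed.

End DilogLimit.

(** * The function g of z and its integral *)

Section GrowthCost.
Variable R : realType.
Implicit Types (x y z t s : R).

Lemma zt1_gt1 : zt 1 = gt 1 :> R.
Proof. by rewrite -gt_inv // invr1. Qed.

(* The region under the curve is symmetric about the diagonal, which it crosses at t = 1;
   integrating by parts turns the part t > 1 into the part t < 1. *)
Definition area t : R :=
  if t <= 1 then prim t else 2 * prim 1 - zt 1 ^+ 2 + zt t * gt t - prim t^-1.

Lemma areaE t : 1 <= t -> area t = 2 * prim 1 - zt 1 ^+ 2 + zt t * gt t - prim t^-1.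
Proof.
move=> t1; rewrite /area; case: (leP t 1) => // h1.
have -> : t = 1 by apply/eqP; rewrite eq_le h1 t1.
rewrite invr1 -zt1_gt1; ring.
Qed.

(** For parameters above 1 these are the bounds of [prim_bounds] at the inverse parameters, [gt_inv]
    exchanging z and g; an interval across 1 is cut there. *)
Lemma area_bounds x y : 0 < x -> x <= y ->
  (zt y - zt x) * gt y <= area y - area x <= (zt y - zt x) * gt x.
Proof.
have low u v : 0 < u -> u <= v -> v <= 1 ->
    (zt v - zt u) * gt v <= area v - area u <= (zt v - zt u) * gt u.
  move=> u0 uv v1; rewrite /area v1 (le_trans uv v1); exact: prim_bounds.
have high u v : 1 <= u -> u <= v ->
    (zt v - zt u) * gt v <= area v - area u <= (zt v - zt u) * gt u.
  move=> u1 uv; have v1 := le_trans u1 uv.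
  have u0 : 0 < u by lra.
  have v0 : 0 < v by lra.
  rewrite !areaE //.
  have h1 : v^-1 <= u^-1 by rewrite lef_pV2 ?posrE.
  have h2 : u^-1 <= 1 by rewrite invf_le1.
  have v0' : 0 < v^-1 by rewrite invr_gt0.
  have := prim_bounds v0' h1 h2.
  rewrite !gt_inv // -(gt_inv v0') -(gt_inv (_ : 0 < u^-1)) ?invr_gt0 // !invrK.
  lra.
move=> x0 xy; case: (leP y 1) => y1; first exact: low.
case: (leP 1 x) => x1; first by apply: high.
have /andP[l1 l2] := low x 1 x0 (ltW x1) (lexx _).
have /andP[h1 h2] := high 1 y (lexx _) (ltW y1).
have g1 := gt_le x0 (ltW x1); have g2 := gt_le ltr01 (ltW y1).
have z1 := zt_le (ltW x0) (ltW x1); have z2 := zt_le ler01 (ltW y1).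
apply/andP; split; nra.
Qed.

(** The value arises from 2 prim(1) - z(1)^2 = 2 dilog(1) = pi^2 / 18; the two other terms vanish as
    t grows. *)
Lemma area_ge_dilog t : 1 <= t -> area t = pi ^+ 2 / 18 + gt t ^+ 2 / 2 - dilog t^-1.
Proof.
move=> t1; rewrite areaE // {2}/prim gt_inv //; last lra.
rewrite lnV ?posrE; last lra.
have -> : 2 * prim 1 - zt 1 ^+ 2 = pi ^+ 2 / 18 :> R.
  rewrite /prim ln1 dilog1; move: (pi ^+ 2 : R) (zt 1 : R) => P z; lra.
rewrite /gt; move: (pi ^+ 2 : R) => P; lra.
Qed.

Lemma gt_le_inv t : 1 <= t -> gt t <= t^-1.
Proof.
move=> t1; rewrite -gt_inv; last lra.
by apply: zt_le_id; rewrite invr_ge0 invf_le1 ?t1 ?andbT; lra.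
Qed.

Lemma area_nondecr s t : 0 < s -> s <= t -> area s <= area t.
Proof.
move=> s0 st; have /andP[h _] := area_bounds s0 st.
have t0 : 0 < t by lra.
have : 0 <= (zt t - zt s) * gt t.
  by rewrite mulr_ge0 ?(ltW (gt_gt0 t0)) // subr_ge0 zt_le // ltW.
lra.
Qed.

Lemma area_ge0 t : 0 < t -> 0 <= area t.
Proof.
move=> t0; suff h s : 0 < s -> s <= 1 -> 0 <= area s.
  case: (leP t 1) => t1; first exact: h.
  by apply: le_trans (h 1 _ _) (area_nondecr _ (ltW t1)).
move=> s0 s1; rewrite /area s1 /prim.
have /andP[d _] : 0 <= dilog s <= s by apply: dilog_bounds; rewrite ltW.
rewrite addr_ge0 // addr_ge0 ?divr_ge0 ?sqr_ge0 // -mulrN mulr_ge0 ?oppr_ge0 ?ln_le0 //.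
by rewrite zt_ge0 // ltW.
Qed.

Lemma area_le t : 0 < t -> area t <= pi ^+ 2 / 18.
Proof.
move=> t0; apply/ler_addgt0Pr => e e0.
pose s : R := Num.max t (Num.max 1 e^-1).
have s1 : 1 <= s by rewrite /s !le_max lexx orbT.
have s0 : 0 < s by lra.
have ts : t <= s by rewrite /s le_max lexx.
have se : e^-1 <= s by rewrite /s !le_max lexx !orbT.
apply: le_trans (area_nondecr t0 ts) _; rewrite area_ge_dilog //.
have /andP[d _] : 0 <= dilog s^-1 <= s^-1.
  by apply: dilog_bounds; rewrite invr_ge0 ltW //= invf_le1.
have g0 := gt_gt0 s0; have g1 := gt_le_inv s1.
have v1 : s^-1 <= 1 by rewrite invf_le1.
have v2 : s^-1 <= e by rewrite -[e]invrK lef_pV2 ?posrE ?invr_gt0.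
have : gt s ^+ 2 / 2 <= e by nra.
lra.
Qed.

Lemma area_large t : 1 <= t -> pi ^+ 2 / 18 - t^-1 <= area t.
Proof.
move=> t1; rewrite area_ge_dilog //.
have /andP[_ d] : 0 <= dilog t^-1 <= t^-1.
  by apply: dilog_bounds; rewrite invr_ge0 invf_le1 ?t1 ?andbT; lra.
have := sqr_ge0 (gt t); lra.
Qed.

Lemma area_small t : 0 < t -> t <= 1 -> area t <= 3 * t.
Proof.
move=> t0 t1; rewrite /area t1 /prim.
have /andP[_ d] : 0 <= dilog t <= t by apply: dilog_bounds; rewrite ltW.
have z2 := zt_leX (ltW t0); have z0 := zt_ge0 (ltW t0).
have l1 : - ln t <= t^-1.
  rewrite -lnV ?posrE //; apply: ltW; apply: ln_sublinear; by rewrite invr_gt0.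
have : zt t * - ln t <= t.
  apply: le_trans (_ : t ^+ 2 * t^-1 <= _); last by rewrite expr2 mulfK // gt_eqF.
  by apply: ler_pM => //; rewrite oppr_ge0 ln_le0.
have : zt t ^+ 2 / 2 <= t.
  have : zt t <= t by apply: zt_le_id; rewrite ltW.
  nra.
rewrite mulrN; lra.
Qed.

(** The inverse of [zt]: e^z = (1 + t + t^2) / (1 + t) means t^2 = v (1 + t) with v = e^z - 1, and
    this is the positive root. *)
Definition tz z : R := let v := expR z - 1 in (v + Num.sqrt (v ^+ 2 + 4 * v)) / 2.

Lemma tzP z : 0 < z -> 0 < tz z /\ tz z ^+ 2 = (expR z - 1) * (1 + tz z).
Proof.
move=> z0; rewrite /tz /=; have : 1 < expR z by rewrite expR_gt1.
rewrite -subr_gt0; move: (expR z - 1) => v v0.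
have D0 : 0 <= v ^+ 2 + 4 * v by nra.
have s0 := sqrtr_ge0 (v ^+ 2 + 4 * v).
split; first lra.
have := sqr_sqrtr D0; move: (Num.sqrt _) s0 => s s0 e.
lra.
Qed.

Lemma tz_gt0 z : 0 < z -> 0 < tz z.
Proof. by move=> /tzP[]. Qed.

Lemma tzK z : 0 < z -> zt (tz z) = z.
Proof.
move=> z0; have [t0 e] := tzP z0; rewrite /zt.
have -> : 1 + tz z + tz z ^+ 2 = expR z * (1 + tz z) by rewrite e; ring.
by rewrite lnM ?posrE ?expR_gt0 ?expRK //; lra.
Qed.

Lemma tz_le x y : 0 < x -> x <= y -> tz x <= tz y.
Proof.
move=> x0 xy; have y0 : 0 < y by lra.
rewrite leNgt; apply/negP => /(zt_lt (ltW (tz_gt0 y0))).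
by rewrite !tzK // ltNge xy.
Qed.

Lemma ztK t : 0 < t -> tz (zt t) = t.
Proof.
move=> t0; have z0 := zt_gt0 t0.
apply/eqP; rewrite eq_le !leNgt; apply/andP; split; apply/negP => h.
  by have := zt_lt (ltW t0) h; rewrite tzK // ltxx.
by have := zt_lt (ltW (tz_gt0 z0)) h; rewrite tzK // ltxx.
Qed.

(* The function g of Holroyd: g z = - ln (beta (1 - e^{-z})). *)
Definition gz z : R := gt (tz z).

(** This stands for the integral of g over ]0, z]; it is handled through the comparison [Gz_bounds]
    with rectangles and its behaviour near 0 and infinity. *)
Definition Gz z : R := area (tz z).

Lemma gz_gt0 z : 0 < z -> 0 < gz z.
Proof. by move=> z0; apply: gt_gt0; exact: tz_gt0. Qed.

Lemma gz_le x y : 0 < x -> x <= y -> gz y <= gz x.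
Proof. by move=> x0 xy; apply: gt_le; [exact: tz_gt0|exact: tz_le]. Qed.

Lemma gz_tangent x y : 0 < x -> 0 < y ->
  gz x + slope (tz x) * (y - x) <= gz y.
Proof.
move=> x0 y0; have := gt_tangent (tz_gt0 x0) (tz_gt0 y0).
by rewrite !tzK.
Qed.

Lemma expR_gt t : 0 < t -> expR (- gt t) = t * (1 + t) / (1 + t + t ^+ 2).
Proof.
move=> t0; have p0 := poly2_gt0 (ltW t0); have t1 : 0 < 1 + t by lra.
have -> : - gt t = ln (t * (1 + t) / (1 + t + t ^+ 2)).
  by rewrite ln_div ?lnM ?posrE ?mulr_gt0 // /gt /zt; ring.
by rewrite lnK // posrE divr_gt0 // mulr_gt0.
Qed.

(** In the parameter t, u = t^2 / (1 + t + t^2) and b = t (1 + t) / (1 + t + t^2), for which the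
    quadratic equation is an identity. *)
Lemma gz_beta z : 0 < z ->
  let u := 1 - expR (- z) in let b := expR (- gz z) in
  [/\ b ^+ 2 = u * b + u * (1 - u), 0 < u, u <= b & b <= 1].
Proof.
move=> z0 /=; have [t0] := tzP z0; rewrite (expRN z).
have e0 := expR_gt0 z.
have b1 : expR (- gz z) <= 1 by rewrite expR_le1 oppr_le0 ltW // gz_gt0.
have p0 := poly2_gt0 (ltW t0).
have t1 : 0 < 1 + tz z by lra.
have bE : expR (- gz z) = tz z * (1 + tz z) / (1 + tz z + tz z ^+ 2).
  exact: expR_gt.
rewrite bE in b1 *.
move: (tz z) t0 t1 p0 b1 {bE} => t t0 t1 p0 b1 e.
have eE : expR z = (1 + t + t ^+ 2) / (1 + t).
  have -> : 1 + t + t ^+ 2 = expR z * (1 + t) by rewrite e; ring.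
  by rewrite mulfK // gt_eqF.
have uE : 1 - (expR z)^-1 = t ^+ 2 / (1 + t + t ^+ 2).
  by rewrite eE; field; rewrite !gt_eqF.
rewrite uE; split => //.
- by field; rewrite gt_eqF.
- by rewrite divr_gt0 // exprn_gt0.
- by rewrite ler_pM2r ?invr_gt0 //; nra.
Qed.

Lemma gz_large (K : R) : exists2 e : R, 0 < e & forall z, 0 < z -> z <= e -> K <= gz z.
Proof.
(* At t = e^{-K}, g = z - ln t = z + K >= K. *)
exists (zt (expR (- K))) => [|z z0 ze]; first by rewrite zt_gt0 // expR_gt0.
apply: le_trans (gz_le z0 ze); rewrite /gz ztK ?expR_gt0 // /gt expRK opprK.
by rewrite lerDr zt_ge0 // expR_ge0.
Qed.

Lemma Gz_bounds x y : 0 < x -> x <= y ->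
  (y - x) * gz y <= Gz y - Gz x <= (y - x) * gz x.
Proof.
move=> x0 xy; have y0 : 0 < y by lra.
have := area_bounds (tz_gt0 x0) (tz_le x0 xy).
by rewrite !tzK.
Qed.

Lemma Gz_ge0 z : 0 < z -> 0 <= Gz z.
Proof. by move=> z0; apply: area_ge0; exact: tz_gt0. Qed.

Lemma Gz_le z : 0 < z -> Gz z <= lambda R.
Proof. by move=> z0; apply: area_le; exact: tz_gt0. Qed.

Lemma Gz_nondecr x y : 0 < x -> x <= y -> Gz x <= Gz y.
Proof. by move=> x0 xy; apply: area_nondecr; [exact: tz_gt0|exact: tz_le]. Qed.

Lemma Gz_small (e : R) : 0 < e ->
  exists2 d : R, 0 < d & forall z, 0 < z -> z <= d -> Gz z <= e.
Proof.
move=> e0; pose t : R := Num.min 1 (e / 3).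
have t0 : 0 < t by rewrite /t lt_min ltr01 divr_gt0.
have t1 : t <= 1 by rewrite /t ge_min lexx.
have te : t <= e / 3 by rewrite /t ge_min lexx orbT.
exists (zt t); first exact: zt_gt0.
move=> z z0 zt'; apply: le_trans (Gz_nondecr z0 zt') _.
rewrite /Gz ztK //; have := area_small t0 t1; lra.
Qed.

Lemma Gz_large (e : R) : 0 < e ->
  exists2 d : R, 0 < d & forall z, d <= z -> lambda R - e <= Gz z.
Proof.
move=> e0; pose t : R := Num.max 1 e^-1.
have t1 : 1 <= t by rewrite /t le_max lexx.
have t0 : 0 < t by lra.
have te : e^-1 <= t by rewrite /t le_max lexx orbT.
exists (zt t); first exact: zt_gt0.
move=> z zz; apply: le_trans (Gz_nondecr (zt_gt0 t0) zz).
rewrite /Gz ztK //; have := area_large t1.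
have : t^-1 <= e by rewrite -[e]invrK lef_pV2 ?posrE ?invr_gt0.
rewrite /lambda; move: (pi ^+ 2 : R) => P; lra.
Qed.

End GrowthCost.

#[global] Opaque gz Gz.

Lemma sum_gz_le (R : realType) (h : R) N : 0 < h -> \sum_(i < N) h * gz (h * i.+1%:R) <= lambda R.
Proof.
move=> h0; case: N => [|N].
  by rewrite big_ord0 /lambda divr_ge0 // sqr_ge0.
apply: le_trans (Gz_le (_ : 0 < h * N.+1%:R)); last by rewrite mulr_gt0.
elim: N => [|N IH].
  rewrite big_ord_recl big_ord0 addr0 mulr1.
  apply/ler_addgt0Pr => e e0.
  (* [Gz_bounds] needs a positive left end: the first cell ]0, h] is cut down to [x, h], which loses
     x g(h) <= e. *)
  pose x : R := Num.min h (e / gz h).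
  have g0 := gz_gt0 h0.
  have x0 : 0 < x by rewrite /x lt_min h0 divr_gt0.
  have xh : x <= h by rewrite /x ge_min lexx.
  have xe : x * gz h <= e by rewrite -ler_pdivlMr // /x ge_min lexx orbT.
  have /andP[+ _] := Gz_bounds x0 xh; have := Gz_ge0 x0; move: xe.
  move: (gz h) (Gz h) (Gz x) => a b c; clear; lra.
rewrite big_ord_recr /=.
have k0 : 0 < h * N.+1%:R by rewrite mulr_gt0.
have k1 : h * N.+1%:R <= h * N.+2%:R by rewrite ler_pM2l // ler_nat.
have /andP[b _] := Gz_bounds k0 k1.
have e : h * N.+2%:R - h * N.+1%:R = h by rewrite -mulrBr -natrB // subSnn mulr1.
move: b IH; rewrite e; move: (gz _) (Gz _) (Gz _) (\sum_(i < _) _) => a1 a2 a3 S; clear; lra.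
Qed.

(** * Growth of a rectangle *)

Definition irange (a : int) (n : nat) : seq int := [seq a + i%:Z | i <- iota 0 n].

Lemma mem_irange a n z : (z \in irange a n) = (a <= z < a + n%:Z).
Proof.
apply/mapP/idP => [[i + ->]|h]; first by rewrite mem_iota; lia.
by exists `|z - a|%N; [rewrite mem_iota|]; lia.
Qed.

Lemma irange_uniq a n : uniq (irange a n).
Proof. by rewrite map_inj_uniq ?iota_uniq // => i j; lia. Qed.

Lemma size_irange a n : size (irange a n) = n.
Proof. by rewrite size_map size_iota. Qed.

Definition rsites (r : rect) : seq Z2 :=
  [seq (x, y) | x <- irange r.1.1 (wid r), y <- irange r.1.2 (hei r)].

Lemma mem_rsites r z : valid r -> z \in rsites r <-> box r z.
Proof.
case: r z => [[a b] [c d]] [x y]; rewrite /valid /box /rsites /wid /hei /= => v.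
split.
  move=> /allpairsP[[x' y'] /= []]; rewrite !mem_irange => h1 h2 [-> ->]; lia.
move=> [h1 h2]; apply/allpairsP; exists (x, y); split => //=; rewrite mem_irange; lia.
Qed.

Lemma rsites_uniq r : uniq (rsites r).
Proof. by apply: allpairs_uniq; rewrite ?irange_uniq // => -[x y] [x' y']. Qed.

Lemma size_rsites r : size (rsites r) = (wid r * hei r)%N.
Proof. by rewrite size_allpairs !size_irange. Qed.

Lemma count_eq_size (T : eqType) (d : pred T) (s l : seq T) : uniq s -> uniq l ->
  (forall z, z \in l <-> d z /\ z \in s) -> count d s = size l.
Proof.
move=> us ul h; rewrite -size_filter; apply/perm_size/uniq_perm => //.
  exact: filter_uniq.
by move=> z; rewrite mem_filter; apply/andP/idP => /h.
Qed.

Definition grow_ev (S K : rect) (w : set Z2) :=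
  spans (box S `|` (w `&` (box K `\` box S))) (box K).

Lemma grow_ev_depends S K : depends (box K `\` box S) (grow_ev S K).
Proof. by move=> w; rewrite /grow_ev -setIA setIid. Qed.

Lemma span_ev_grow S K w : span_ev K w -> grow_ev S K w.
Proof.
apply: spansS => // z [wz Kz]; have [Sz|nSz] := pselect (box S z); [by left|].
by right.
Qed.

Definition corner (S K : rect) (z : Z2) : bool :=
  [&& K.1.1 <= z.1 < K.2.1, K.1.2 <= z.2 < K.2.2,
      ~~ (S.1.1 <= z.1 < S.2.1) & ~~ (S.1.2 <= z.2 < S.2.2)].

(* The columns of [K] outside [S], first those on the left, then those on the right. *)
Definition xcol (S K : rect) (j : nat) : int :=
  if (j < `|S.1.1 - K.1.1|)%N then K.1.1 + j%:Z
  else S.2.1 + (j - `|S.1.1 - K.1.1|)%N%:Z.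

(** Only the part beside [S] is kept: without the corner sites, columns and rows involve disjoint
    sets of sites. *)
Definition colp (S K : rect) (j : nat) : pred Z2 :=
  fun z => (z.1 == xcol S K j) && (S.1.2 <= z.2 < S.2.2).

(* Column [j] is declared occupied if it has an occupied corner site; so is the last
   column on the left, which removes the constraint between both sides of [S]. *)
Definition occ_col (S K : rect) (w : set Z2) (j : nat) : bool :=
  (j.+1 == `|S.1.1 - K.1.1|%N) ||
  `[< exists2 y, corner S K (xcol S K j, y) & w (xcol S K j, y) >].

(** Two adjacent undeclared columns have no occupied corner site; if their side parts are vacant
    too, they are empty and [spans_not_two_columns] forbids filling them. *)
Lemma grow_no_gap S K (w w' : set Z2) : valid S -> valid K -> subrect S K ->
  (forall z, w z -> corner S K z) -> (forall z, w' z -> ~~ corner S K z) ->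
  grow_ev S K (w `|` w') -> no_gap (colp S K) (occ_col S K w) (wid K - wid S) w'.
Proof.
case: S K => [[a b] [c d]] [[A B] [C D]]; rewrite /valid /subrect /= => vS vK sub.
move=> wc w'c gr j; rewrite /wid /= => jn.
rewrite /occ_col => /norP[j1 /negP o1] /norP[j2 /negP o2] v1 v2; rewrite /= in j1 j2.
(* By [j1], column j is not the last one on the left, so [xcol] does not jump over [S] here. *)
have ex : xcol ((a, b), (c, d)) ((A, B), (C, D)) j.+1 = xcol ((a, b), (c, d)) ((A, B), (C, D)) j + 1.
  by rewrite /xcol /=; do 2 case: ifP; lia.
have xK : A <= xcol ((a, b), (c, d)) ((A, B), (C, D)) j < C.
  by rewrite /xcol /=; case: ifP; lia.
have xS : ~~ (a <= xcol ((a, b), (c, d)) ((A, B), (C, D)) j < c).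
  by rewrite /xcol /=; case: ifP; lia.
have xS1 : ~~ (a <= xcol ((a, b), (c, d)) ((A, B), (C, D)) j + 1 < c).
  by rewrite -ex /xcol /=; case: ifP; lia.
rewrite ex in o2; rewrite /vacant /colp /= ex in v1 v2.
move: (xcol _ _ _) xK xS xS1 o1 o2 v1 v2 {ex j1 j2 jn} => x xK xS xS1 o1 o2 v1 v2.
have key y x' : (x' = x \/ x' = x + 1) -> ~ ((w `|` w') `&` (box ((A, B), (C, D)) `\` box ((a, b), (c, d)))) (x', y).
  move=> hx [ww [[/= h1 h2] nS]].
  have cy : corner ((a, b), (c, d)) ((A, B), (C, D)) (x', y) -> w (x', y) -> False.
    move=> h3 h4; case: hx => e; rewrite e in h3 h4; [apply: o1|apply: o2]; apply/asboolP; exact: (ex_intro2 _ _ y h3 h4).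
  case: (boolP (b <= y < d)) => hy; last first.
    have h3 : corner ((a, b), (c, d)) ((A, B), (C, D)) (x', y) by rewrite /corner /=; lia.
    by case: ww => [|/w'c/negP //]; exact: cy.
  case: ww => [h3|h3]; first by have := wc _ h3; rewrite /corner /=; lia.
  by case: hx => e; rewrite e in h3; [apply: (v1 (x, y))|apply: (v2 (x + 1, y))] => //=; rewrite eqxx.
have := spans_not_two_columns gr (x := x); move=> /(_ _ (x, B)) [].
- move=> [x' y] [[/= h1 h2]|h]; first lia.
  by split=> e; apply: (key y x') => //; [left|right].
- by rewrite /box /=; lia.
- by [].
Qed.

(** An occupied corner site lies in one column only; the + 1 is for the last column on the left. *)
Lemma sum_occ_col S K (w : set Z2) (l : seq Z2) n : valid S -> valid K -> subrect S K ->
  uniq l -> (forall z, z \in l <-> corner S K z) -> (n <= wid K - wid S)%N ->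
  (\sum_(j < n) occ_col S K w j <= count (fun z => `[< w z >]) l + 1)%N.
Proof.
move=> vS vK sub ul lc nn.
apply: leq_trans (_ : (\sum_(j < n) ((j.+1 == `|S.1.1 - K.1.1|%N) +
   \sum_(z <- l) ((z.1 == xcol S K j) && `[< w z >])) <= _)%N).
  apply: leq_sum => j _; rewrite /occ_col; case: (_ == _) => //=.
  case: asboolP => // -[y cy wy] /=; rewrite add0n.
  have yl : (xcol S K j, y) \in l by apply/lc.
  by rewrite (big_rem _ yl) /= eqxx asboolT.
rewrite big_split /= addnC; apply: leq_add.
  rewrite exchange_big /= -sum1_count [leqRHS]big_mkcond /=; apply: leq_sum => z _.
  case: asboolP => _; last by rewrite big1 // => j _; rewrite andbF.
  rewrite (eq_bigr (fun j : 'I_n => (z.1 == xcol S K j) : nat)) => [|j _]; last by rewrite andbT.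
  have [[j0 e0]|h] := pselect (exists j : 'I_n, z.1 == xcol S K j); last first.
    by rewrite big1 // => j _; case: eqP => // e; case: h; exists j; apply/eqP.
  rewrite (bigD1 j0) //= e0 big1 // => j jj; case: eqP => // e.
  case/eqP: jj; apply: val_inj => /=.
  move: e0 e nn (ltn_ord j) (ltn_ord j0) => /eqP -> {lc}.
  move: vS vK sub; rewrite /valid /subrect /xcol /wid.
  move: (val j) (val j0) => i i0 /= vS vK sub.
  by do 2 case: ifP; lia.
have [[j0 e0]|h] := pselect (exists j : 'I_n, j.+1 == `|S.1.1 - K.1.1|%N); last first.
  by rewrite big1 // => j _; case: eqP => // e; case: h; exists j; apply/eqP.
rewrite (bigD1 j0) //= e0 big1 // => j jj; case: eqP => // e.
case/eqP: jj; apply: val_inj => /=; move: e0 e; lia.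
Qed.

Definition flipr (r : rect) : rect := (flip r.1, flip r.2).

Lemma box_flip r : box (flipr r) = flip @^-1` box r.
Proof. by apply/seteqP; split=> -[x y] [h1 h2]; split. Qed.

Lemma grow_ev_flip S K w : grow_ev S K w -> grow_ev (flipr S) (flipr K) (flip @^-1` w).
Proof. by rewrite /grow_ev !box_flip => /spans_flip. Qed.

Lemma corner_flip S K z : corner (flipr S) (flipr K) z = corner S K (flip z).
Proof. by rewrite /corner /=; lia. Qed.

Lemma corner_box S K z : corner S K z -> box K z.
Proof. by move=> /and4P[h1 h2 _ _]; split. Qed.

Lemma valid_flip r : valid (flipr r) = valid r.
Proof. by rewrite /valid andbC. Qed.

Lemma subrect_flip r t : subrect (flipr r) (flipr t) = subrect r t.
Proof. by rewrite /subrect /=; lia. Qed.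

Lemma count_colp S K (s : seq Z2) j : valid S -> valid K -> subrect S K ->
  uniq s -> box K `<=` [set` s] -> (j < wid K - wid S)%N ->
  count (colp S K j) [seq z <- s | ~~ corner S K z] = hei S.
Proof.
move=> vS vK sub us Ks jn.
pose l := [seq (xcol S K j, y) | y <- irange S.1.2 (hei S)].
have -> : hei S = size l by rewrite size_map size_irange.
have ul : uniq l by rewrite map_inj_uniq ?irange_uniq // => y y' [].
have mem_side y : (y \in irange S.1.2 (hei S)) = (S.1.2 <= y < S.2.2).
  by rewrite mem_irange; move: vS; clear; rewrite /valid /hei; lia.
have inK y : S.1.2 <= y < S.2.2 -> box K (xcol S K j, y).
  move: jn vS vK sub; clear; case: S K => [[a b] [c d]] [[A B] [C D]].
  rewrite /box /xcol /valid /subrect /wid /=; case: ifP; lia.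
apply: count_eq_size => //; first exact: filter_uniq.
move=> [x y]; rewrite mem_filter; split.
  move=> /mapP[y' + [-> ->]]; rewrite mem_side => hy.
  split; first by rewrite /colp /= eqxx.
  have -> /= : ~~ corner S K (xcol S K j, y') by rewrite /corner /= hy !andbF.
  exact/Ks/inK.
move=> [/andP[/eqP /= -> hy] _]; apply/mapP; exists y => //.
by rewrite mem_side.
Qed.

Lemma size_corner S K (s : seq Z2) : valid S -> valid K -> subrect S K -> uniq s ->
  (size [seq z <- s | corner S K z] <= (wid K - wid S) * (hei K - hei S))%N.
Proof.
move=> vS vK sub us.
rewrite -(size_iota 0 (wid K - wid S)) -(size_iota 0 (hei K - hei S)).
rewrite -(size_allpairs (fun i j => (xcol S K i, xcol (flipr S) (flipr K) j))).
apply: uniq_leq_size; first exact: filter_uniq.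
move=> [x y]; rewrite mem_filter => /andP[+ _].
have xc (T L : rect) z : T.1.1 < T.2.1 -> L.1.1 <= T.1.1 -> T.2.1 <= L.2.1 ->
    L.1.1 <= z < L.2.1 -> ~~ (T.1.1 <= z < T.2.1) ->
    exists2 i, i \in iota 0 (wid L - wid T) & z = xcol T L i.
  case: T L => [[a b] [c d]] [[A B] [C D]] /= h1 h2 h3 h4 h5.
  exists (if z < a then `|z - A|%N else (`|z - c| + `|a - A|)%N).
    by rewrite mem_iota /wid /=; case: ifP; lia.
  by rewrite /xcol /=; case: ifP; case: ifP; lia.
move: vS vK sub; rewrite /valid /subrect /corner => /andP[v1 v2] /andP[v3 v4].
move=> /and4P[s1 s2 s3 s4] /and4P[/= k1 k2 k3 k4].
have [i hi ei] := xc S K x v1 s1 s2 k1 k3.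
have [j hj ej] := xc (flipr S) (flipr K) y v2 s3 s4 k2 k4.
by apply/allpairsP; exists (i, j); split => //=; rewrite -ei -ej.
Qed.

Section GrowBound.
Variables (R : realType) (p : R).
Hypothesis p01 : 0 <= p <= 1.
Variables (S K : rect) (s : seq Z2) (u1 b1 u2 b2 : R).
Hypotheses (vS : valid S) (vK : valid K) (sub : subrect S K).
Hypotheses (us : uniq s) (Ks : box K `<=` [set` s]).
Hypotheses (u1_gt0 : 0 < u1) (ub1 : u1 <= b1) (b1_le1 : b1 <= 1).
Hypothesis b1E : b1 ^+ 2 = u1 * b1 + u1 * (1 - u1).
Hypothesis u1E : 1 - u1 = (1 - p) ^+ hei S.
Hypotheses (u2_gt0 : 0 < u2) (ub2 : u2 <= b2) (b2_le1 : b2 <= 1).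
Hypothesis b2E : b2 ^+ 2 = u2 * b2 + u2 * (1 - u2).
Hypothesis u2E : 1 - u2 = (1 - p) ^+ wid S.

Let cs := [seq z <- s | corner S K z].
Let rs := [seq z <- s | ~~ corner S K z].
Let n := (wid K - wid S)%N.
Let m := (hei K - hei S)%N.

Let Ex_weight (l : seq Z2) (a : R) : uniq l -> Ex p l (fun w => a ^+ count (fun z => `[< w z >]) l) =
  (1 - p + p * a) ^+ size l.
Proof.
elim: l => [|x l IH] //= /andP[xl ul].
rewrite exprS -{}IH //; set E := (X in _ = _ * X).
rewrite (_ : Ex p l _ = a * E); last first.
  rewrite -ExZ; apply: eq_Ex => w wl; have hx : (x |` w) x by left.
  rewrite (asboolT hx).
  have -> : count (fun z => `[< (x |` w) z >]) l = count (fun z => `[< w z >]) l.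
    apply: eq_in_count => z zl; apply: asbool_equiv_eq; split; last by right.
    by case=> // e; move: xl; rewrite -e zl.
  by rewrite add1n exprS.
rewrite (_ : Ex p l _ = E); first by ring.
apply: eq_Ex => w wl; rewrite asboolF ?add0n // => /wl /=; exact/negP.
Qed.

Let xcol_inj T L i j : valid T -> subrect T L -> xcol T L i = xcol T L j -> i = j.
Proof.
clear; case: T L => [[a b] [c d]] [[A B] [C D]].
by rewrite /xcol /valid /subrect /=; case: ifP; case: ifP; lia.
Qed.

(** Given the corner configuration with k occupied sites, columns and rows are independent, and
    [no_gap_le] applies to each with at most k + 1 declared ones. The average of (u1 u2)^(-k) over
    the corner sites is a binomial generating function, computed in [Ex_weight]; the factors u1 and
    u2 on the left pay for the + 1. *)
Lemma Pr_grow_le : (b1 * u1) * (b2 * u2) * Pr p s (grow_ev S K) <=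
  b1 ^+ n * b2 ^+ m * (1 - p + p / (u1 * u2)) ^+ (n * m).
Proof.
case/andP: (p01) => p0 p1.
have uu : 0 < u1 * u2 by rewrite mulr_gt0.
have b1_gt0 : 0 < b1 by exact: lt_le_trans ub1.
have b2_gt0 : 0 < b2 by exact: lt_le_trans ub2.
have ucs : uniq cs by exact: filter_uniq.
have csP z : z \in cs <-> corner S K z.
  rewrite mem_filter; split => [/andP[]//|h]; rewrite h; apply: Ks.
  exact: corner_box h.
pose f1 wc w' := no_gap (colp S K) (occ_col S K wc) n w'.
pose rowp j : pred Z2 := fun z => colp (flipr S) (flipr K) j (flip z).
pose f2 wc w' := no_gap rowp (occ_col (flipr S) (flipr K) (flip @^-1` wc)) m w'.
have key wc : wc `<=` [set` cs] ->
  (b1 * u1) * (b2 * u2) * Ex p rs (fun w' => '1[grow_ev S K (wc `|` w')]) <=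
  b1 ^+ n * b2 ^+ m * (u1 * u2)^-1 ^+ count (fun z => `[< wc z >]) cs.
  move=> wcs; set k := count _ cs.
  have le1 : Ex p rs (fun w' => '1[grow_ev S K (wc `|` w')]) <=
      Pr p rs (fun w' => f1 wc w' /\ f2 wc w').
    apply: le_Ex => // w' w'r; apply: le_iver => gr.
    have h1 z : wc z -> corner S K z by move=> /wcs /csP.
    have h2 z : w' z -> ~~ corner S K z by move=> /w'r /=; rewrite mem_filter => /andP[].
    split; first exact: grow_no_gap.
    move=> j jm o1 o2 v1 v2.
    have := @grow_no_gap (flipr S) (flipr K) (flip @^-1` wc) (flip @^-1` w') _ _ _ _ _ (grow_ev_flip gr).
    move=> h; apply: (h _ _ _ _ _ j jm o1 o2) => {h} //.
    - by rewrite valid_flip.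
    - by rewrite valid_flip.
    - by rewrite subrect_flip.
    - by move=> z /h1; rewrite corner_flip.
    - by move=> z /h2; rewrite corner_flip.
    - by move=> z cz wz; apply: (v1 (flip z)) => //; rewrite /rowp flipK.
    - by move=> z cz wz; apply: (v2 (flip z)) => //; rewrite /rowp flipK.
  pose side : set Z2 := [set z | S.1.2 <= z.2 < S.2.2].
  have indep : Pr p rs (fun w' => f1 wc w' /\ f2 wc w') = Pr p rs (f1 wc) * Pr p rs (f2 wc).
    apply: (@Pr_indep _ _ p rs side).
      apply: (depends_sub _ (@no_gap_depends _ _ _ _)) => -[x y].
      by rewrite /cols /= => -[j _ /andP[]].
    apply: (depends_sub _ (@no_gap_depends _ _ _ _)) => -[x y].
    rewrite /cols /= => -[j jm /andP[/eqP /= e _]].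
    rewrite /side /= e; apply/negP.
    move: jm vS vK sub; rewrite /m; clear; case: S K => [[a b] [c d]] [[A B] [C D]].
    by rewrite /xcol /valid /subrect /hei /=; case: ifP; lia.
  have P1 : b1 * u1 ^+ (k + 1) * Pr p rs (f1 wc) <= b1 ^+ n.
    have Pcol j : (j < n)%N -> Pr p rs (vacant (colp S K j)) = 1 - u1.
      by move=> jn; rewrite Pr_vacant // count_colp // u1E.
    have dcol i j z : colp S K i z -> colp S K j z -> i = j.
      by move=> /andP[/eqP e _] /andP[/eqP e' _]; apply: (xcol_inj vS sub); rewrite -e.
    apply: le_trans (no_gap_le p01 dcol Pcol u1_gt0 ub1 b1_le1 b1E (occ_col S K wc) (leqnn n)).
    rewrite ler_wpM2r ?Pr_ge0 // ler_wpM2l ?(ltW b1_gt0) //.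
    rewrite ler_wiXn2l ?(ltW u1_gt0) ?(le_trans ub1) //.
    exact: sum_occ_col.
  have P2 : b2 * u2 ^+ (k + 1) * Pr p rs (f2 wc) <= b2 ^+ m.
    have vSf : valid (flipr S) by rewrite valid_flip.
    have vKf : valid (flipr K) by rewrite valid_flip.
    have subf : subrect (flipr S) (flipr K) by rewrite subrect_flip.
    have flip_inj : injective flip := inv_inj flipK.
    have Pcol j : (j < m)%N -> Pr p rs (vacant (rowp j)) = 1 - u2.
      move=> jm; rewrite Pr_vacant // u2E.
      have -> : count (rowp j) rs = count (colp (flipr S) (flipr K) j)
          [seq z <- map flip s | ~~ corner (flipr S) (flipr K) z].
        rewrite filter_map count_map /rs; congr (count _ _); apply: eq_filter => z.
        by rewrite /= corner_flip flipK.
      rewrite count_colp ?map_inj_uniq // => z; rewrite box_flip => /Ks zs.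
      by apply/mapP; exists (flip z); rewrite ?flipK.
    have dcol i j z : rowp i z -> rowp j z -> i = j.
      by move=> /andP[/eqP e _] /andP[/eqP e' _]; apply: (xcol_inj vSf subf); rewrite -e.
    apply: le_trans (no_gap_le p01 dcol Pcol u2_gt0 ub2 b2_le1 b2E
       (occ_col (flipr S) (flipr K) (flip @^-1` wc)) (leqnn m)).
    rewrite ler_wpM2r ?Pr_ge0 // ler_wpM2l ?(ltW b2_gt0) //.
    rewrite ler_wiXn2l ?(ltW u2_gt0) ?(le_trans ub2) //.
    have -> : k = count (fun z => `[< (flip @^-1` wc) z >]) (map flip cs).
      rewrite count_map; apply: eq_count => z /=.
      by congr asbool; rewrite /preimage /= flipK.
    apply: sum_occ_col => //; first by rewrite map_inj_uniq.
    move=> z; rewrite corner_flip; split => [/mapP[z' /csP h ->]|/csP h].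
      by rewrite flipK.
    by apply/mapP; exists (flip z); rewrite ?flipK.
  rewrite indep in le1.
  rewrite exprVn ler_pdivlMr ?exprn_gt0 //.
  apply: le_trans (_ : (b1 * u1) * (b2 * u2) * (Pr p rs (f1 wc) * Pr p rs (f2 wc)) * (u1 * u2) ^+ k <= _).
    apply: ler_wpM2r; first by rewrite exprn_ge0 // ltW.
    by apply: ler_wpM2l => //; rewrite !mulr_ge0 // ltW.
  have -> : (b1 * u1) * (b2 * u2) * (Pr p rs (f1 wc) * Pr p rs (f2 wc)) * (u1 * u2) ^+ k =
    (b1 * u1 ^+ (k + 1) * Pr p rs (f1 wc)) * (b2 * u2 ^+ (k + 1) * Pr p rs (f2 wc)).
    rewrite exprMn addn1 !exprS; move: (Pr p rs (f1 wc)) (Pr p rs (f2 wc)) (u1 ^+ k) (u2 ^+ k) => x y z t; ring.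
  by apply: ler_pM => //; rewrite !mulr_ge0 ?exprn_ge0 ?Pr_ge0 // ltW.
rewrite /Pr (Ex_split p s (corner S K)) -/cs -/rs -ExZ.
have c0 : 1 <= 1 - p + p / (u1 * u2).
  have : 1 <= (u1 * u2)^-1.
    rewrite invf_ge1 // mulr_ile1 ?(ltW u1_gt0) ?(ltW u2_gt0) //.
      exact: le_trans ub1 _.
    exact: le_trans ub2 _.
  rewrite -subr_ge0 => h; have := mulr_ge0 p0 h; rewrite mulrBr mulr1; lra.
have bb : 0 <= b1 ^+ n * b2 ^+ m by rewrite mulr_ge0 ?exprn_ge0 // ltW.
apply: le_trans (_ : b1 ^+ n * b2 ^+ m * (1 - p + p / (u1 * u2)) ^+ size cs <= _).
  by rewrite -Ex_weight // -ExZ; apply: le_Ex => // wc wcs; exact: key.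
by rewrite ler_wpM2l // ler_weXn2l // size_corner.
Qed.
End GrowBound.

(** * The growth potential and its subadditivity *)

Section Potential.
Variables (R : realType) (g : nat -> R).
Hypothesis g_ge0 : forall k, 0 <= g k.
Hypothesis g_decr : forall k, g k.+1 <= g k.
Hypothesis g_convex : forall k, g k.+1 - g k <= g k.+2 - g k.+1.

(* The cheapest way to grow an a x b rectangle from a point: along the diagonal first,
   then straight, each new column of height k (or row of width k) costing g k. *)
Definition pot (a b : nat) : R :=
  2 * (\sum_(k < minn a b) g k.+1) + (maxn a b - minn a b)%:R * g (minn a b).

Lemma potC a b : pot a b = pot b a.
Proof. by rewrite /pot minnC maxnC. Qed.

Lemma pot_le a b : (a <= b)%N ->
  pot a b = 2 * (\sum_(k < a) g k.+1) + (b - a)%:R * g a.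
Proof. by move=> ab; rewrite /pot (minn_idPl ab) (maxn_idPr ab). Qed.

Lemma pot_ge a b : (b <= a)%N ->
  pot a b = 2 * (\sum_(k < b) g k.+1) + (a - b)%:R * g b.
Proof. by move=> ab; rewrite potC pot_le. Qed.

Lemma g_le i j : (i <= j)%N -> g j <= g i.
Proof.
by move=> /subnK <-; elim: (j - i)%N => // n IH; rewrite addSn (le_trans (g_decr _)).
Qed.

Lemma g_slope i j : (i <= j)%N -> g i.+1 - g i <= g j.+1 - g j.
Proof.
by move=> /subnK <-; elim: (j - i)%N => // n IH; rewrite addSn (le_trans IH).
Qed.

Lemma g_tangent a n : g a + n%:R * (g a.+1 - g a) <= g (a + n).
Proof.
elim: n => [|n IH]; first by rewrite mul0r addr0 addn0.
rewrite addnS -natr1 mulrDl mul1r.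
have := g_slope (leq_addr n a); lra.
Qed.

Lemma pot_step a b : pot a.+1 b <= pot a b + g b.
Proof.
have [ab|ba] := ltnP a b; last first.
  rewrite !pot_ge //; last exact: leqW.
  have -> : (a.+1 - b)%:R = (a - b)%:R + 1 :> R by rewrite subSn // natr1.
  lra.
rewrite pot_le // pot_le ?(ltnW ab) // big_ord_recr /= subnS.
have [n ->] : exists n, b = (a + n.+1)%N by exists (b - a.+1)%N; lia.
have -> : (a + n.+1 - a)%:R = n%:R + 1 :> R by rewrite addKn natr1.
have -> : (a + n.+1 - a).-1 = n by rewrite addKn.
(* Lengthening the shorter side adds 2 g(a+1) + n g(a+1) - (n+1) g(a). The tangent of g at a, read
   at b = a + n + 1, bounds this by g(b) with g(a) - g(a+1) >= 0 to spare. *)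
have h := g_tangent a n.+1; rewrite -natr1 in h.
have n0 : 0 <= n%:R :> R by [].
have := g_decr a; move: (g a) (g a.+1) (n%:R : R) n0 h (\sum_(i < a) _) => x y z z0 h S; nra.
Qed.

Lemma pot_growx a b n : pot (a + n) b <= pot a b + n%:R * g b.
Proof.
elim: n => [|n IH]; first by rewrite addn0 mul0r addr0.
rewrite addnS -natr1 mulrDl mul1r; have := pot_step (a + n) b; lra.
Qed.

Lemma pot_grow a b a' b' : (a <= a')%N -> (b <= b')%N ->
  pot a' b' <= pot a b + (a' - a)%:R * g b + (b' - b)%:R * g a.
Proof.
move=> /subnKC ea /subnKC eb; rewrite -[in leLHS]ea -[in leLHS]eb.
have h1 : pot (a + (a' - a)) (b + (b' - b)) <=
    pot (a + (a' - a)) b + (b' - b)%:R * g (a + (a' - a)).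
  by rewrite potC [X in _ <= X + _]potC; exact: pot_growx.
have h2 := pot_growx a b (a' - a).
have h3 : (b' - b)%:R * g (a + (a' - a)) <= (b' - b)%:R * g a.
  by rewrite ler_wpM2l // g_le // leq_addr.
lra.
Qed.

(** Starting from a1 x b1, take a2 diagonal steps, each adding at most one column and one row. At
    step k both sides are at least k + 1, because a1 and b1 are positive, so the step costs at most
    2 g(k+1), as in [pot a2 b2]. The remaining rows number at most b2 - a2, at cost at most g(a2)
    each. *)
Let pot_sub_aux a b a1 b1 a2 b2 : (a2 <= b2)%N -> (0 < a1)%N -> (0 < b1)%N ->
  (maxn a1 a2 <= a <= a1 + a2)%N -> (maxn b1 b2 <= b <= b1 + b2)%N ->
  pot a b <= pot a1 b1 + pot a2 b2.
Proof.
move=> ab2 a10 b10 ha hb.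
have diag k : (k <= a2)%N -> pot (minn (a1 + k) a) (minn (b1 + k) b) <=
    pot a1 b1 + 2 * \sum_(i < k) g i.+1.
  elim: k => [|k IH] ka.
    rewrite big_ord0 mulr0 addr0 !addn0.
    have -> : minn a1 a = a1 by lia.
    by have -> : minn b1 b = b1 by lia.
  have le1 : (minn (a1 + k) a <= minn (a1 + k.+1) a)%N by lia.
  have le2 : (minn (b1 + k) b <= minn (b1 + k.+1) b)%N by lia.
  apply: le_trans (pot_grow le1 le2) _.
  have IH' := IH (ltnW ka); rewrite big_ord_recr /= mulrDr.
  have gA : g (minn (a1 + k) a) <= g k.+1 by apply: g_le; lia.
  have gB : g (minn (b1 + k) b) <= g k.+1 by apply: g_le; lia.
  have step (x : nat) (y : R) : (x <= 1)%N -> 0 <= y -> y <= g k.+1 -> x%:R * y <= g k.+1.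
    by case: x => [|[|x]] // _ y0 yg; rewrite ?mul0r ?mul1r.
  have hx : (minn (a1 + k.+1) a - minn (a1 + k) a <= 1)%N by lia.
  have hy : (minn (b1 + k.+1) b - minn (b1 + k) b <= 1)%N by lia.
  have := step _ _ hx (g_ge0 _) gB; have := step _ _ hy (g_ge0 _) gA; lra.
have h := diag a2 (leqnn _).
have ea : minn (a1 + a2) a = a by lia.
rewrite ea in h.
have le2 : (minn (b1 + a2) b <= b)%N by lia.
apply: le_trans (pot_grow (leqnn a) le2) _.
rewrite subnn mul0r addr0 (pot_le ab2).
have : (b - minn (b1 + a2) b)%:R * g a <= (b2 - a2)%:R * g a2.
  by apply: ler_pM => //; [rewrite ler_nat; lia|apply: g_le; lia].
lra.
Qed.

Lemma pot_sub a b a1 b1 a2 b2 : (0 < a1)%N -> (0 < b1)%N ->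
  (maxn a1 a2 <= a <= a1 + a2)%N -> (maxn b1 b2 <= b <= b1 + b2)%N ->
  pot a b <= pot a1 b1 + pot a2 b2.
Proof.
move=> a10 b10 ha hb; case: (leqP a2 b2) => ab2; first exact: pot_sub_aux.
by rewrite potC (potC a1) (potC a2); apply: pot_sub_aux => //; exact: ltnW.
Qed.

(** The gap between near rectangles adds at most one column and one row to the case of [pot_sub],
    each costing at most g(0). *)
Lemma pot_merge a b a1 b1 a2 b2 : (0 < a1)%N -> (0 < b1)%N ->
  (maxn a1 a2 <= a <= a1 + a2 + 1)%N -> (maxn b1 b2 <= b <= b1 + b2 + 1)%N ->
  pot a b <= pot a1 b1 + pot a2 b2 + 2 * g 0%N.
Proof.
move=> a10 b10 ha hb.
have le1 : (minn a (a1 + a2) <= a)%N by lia.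
have le2 : (minn b (b1 + b2) <= b)%N by lia.
apply: le_trans (pot_grow le1 le2) _.
have : pot (minn a (a1 + a2)) (minn b (b1 + b2)) <= pot a1 b1 + pot a2 b2.
  by apply: pot_sub => //; lia.
have step (x k : nat) : (x <= 1)%N -> x%:R * g k <= g 0%N.
  by case: x => [|[|x]] // _; rewrite ?mul0r ?mul1r // g_le.
have h1 : (a - minn a (a1 + a2) <= 1)%N by lia.
have h2 : (b - minn b (b1 + b2) <= 1)%N by lia.
have := step _ (minn b (b1 + b2)) h1; have := step _ (minn a (a1 + a2)) h2; lra.
Qed.

Lemma pot_ub a b : pot a b <= (a + b)%:R * g 0%N.
Proof.
rewrite /pot.
have h1 : \sum_(k < minn a b) g k.+1 <= (minn a b)%:R * g 0%N.
  rewrite mulr_natl -[X in _ *+ X]card_ord -sumr_const; apply: ler_sum => k _; exact: g_le.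
have h2 : (maxn a b - minn a b)%:R * g (minn a b) <= (maxn a b - minn a b)%:R * g 0%N.
  by rewrite ler_wpM2l // g_le.
have -> : (a + b)%:R = 2 * (minn a b)%:R + (maxn a b - minn a b)%:R :> R.
  by rewrite -natrM -natrD; congr (_%:R); lia.
rewrite mulrDl; lra.
Qed.

Lemma pot_square L : pot L L = 2 * \sum_(k < L) g k.+1.
Proof. by rewrite pot_le // subnn mul0r addr0. Qed.

End Potential.

(** * Upper bound on the spanning probability *)

Definition subrects (Q : rect) : seq rect :=
  let pts := rsites (Q.1, (Q.2.1 + 1, Q.2.2 + 1)) in [seq (x, y) | x <- pts, y <- pts].

Lemma mem_subrects Q r : valid Q -> valid r -> subrect r Q -> r \in subrects Q.
Proof.
case: Q r => [[A B] [C D]] [[a b] [c d]]; rewrite /valid /subrect /= => vQ vr sub.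
have vQ' : valid ((A, B), (C + 1, D + 1)) by rewrite /valid /=; lia.
apply/allpairsP; exists ((a, b), (c, d)); split => //=; apply/mem_rsites => //;
  by rewrite /box /=; lia.
Qed.

Lemma size_subrects Q : valid Q ->
  size (subrects Q) = ((wid Q + 1) * (hei Q + 1) * ((wid Q + 1) * (hei Q + 1)))%N.
Proof.
case: Q => [[A B] [C D]]; rewrite /valid /= => v.
rewrite /subrects size_allpairs size_rsites /=.
have -> : wid ((A, B), (C + 1, D + 1)) = (wid ((A, B), (C, D)) + 1)%N by rewrite /wid /=; lia.
by have -> : hei ((A, B), (C + 1, D + 1)) = (hei ((A, B), (C, D)) + 1)%N by rewrite /hei /=; lia.
Qed.

Lemma wid_gt0 r : valid r -> (0 < wid r)%N.
Proof. by rewrite /valid /wid; lia. Qed.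

Lemma hei_gt0 r : valid r -> (0 < hei r)%N.
Proof. by rewrite /valid /hei; lia. Qed.

Lemma subrect_wid r t : valid r -> subrect r t -> (wid r <= wid t)%N.
Proof. by rewrite /valid /subrect /wid; lia. Qed.

Lemma subrect_hei r t : valid r -> subrect r t -> (hei r <= hei t)%N.
Proof. by rewrite /valid /subrect /hei; lia. Qed.

Section SpanBound.
Variables (R : realType) (p : R) (Q : rect) (g : nat -> R) (T : nat) (seed : pred rect).
Hypothesis p_gt0 : 0 < p.
Hypothesis p_le : p <= 1 / 2.
Hypothesis vQ : valid Q.
Hypothesis g_ge0 : forall k, 0 <= g k.
Hypothesis g_decr : forall k, g k.+1 <= g k.
Hypothesis g_convex : forall k, g k.+1 - g k <= g k.+2 - g k.+1.
Hypothesis T_gt0 : (0 < T)%N.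
Let s := rsites Q.
Let X := p^-1.
Hypothesis size_Q : (size (subrects Q))%:R <= X ^+ 8.
Hypothesis g0_le : expR (2 * g 0%N) <= X.
Hypothesis seed_large : forall K, valid K -> ~~ seed K -> (T + 2 < semiper K)%N.
Hypothesis seed_le : forall K, valid K -> subrect K Q -> seed K ->
  Pr p s (span_ev K) <= X ^+ 2 * expR (- pot g (wid K) (hei K)).
Hypothesis grow_le : forall S K, valid S -> valid K -> subrect S K -> subrect K Q ->
  ~~ seed K -> (semiper K < semiper S + T)%N ->
  Pr p s (grow_ev S K) <= X ^+ 4 * expR (- ((wid K - wid S)%:R * g (hei S) +
                                           (hei K - hei S)%:R * g (wid S))).

(** The exponent of 1/p after n levels: twice the previous one for the two children, and 29 = 24 + 4
    + 1 for the choice of three rectangles (8 each), the bound [grow_le] and the term 2 g(0) of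
    [pot_merge]. The initial 2 is the exponent in [seed_le]. *)
Fixpoint cexp (n : nat) : nat := if n is n'.+1 then (2 * cexp n' + 29)%N else 2.

Lemma Pr_span_le n K : valid K -> subrect K Q -> (semiper K <= n * T)%N ->
  Pr p s (span_ev K) <= X ^+ cexp n * expR (- pot g (wid K) (hei K)).
Proof.
have p1 : p <= 1 by apply: le_trans p_le _; lra.
have X1 : 1 <= X by rewrite /X invf_ge1.
have X0 : 0 <= X by exact: le_trans X1.
have p01 : 0 <= p <= 1 by rewrite ltW.
have us : uniq s by exact: rsites_uniq.
elim: n K => [|n IH] K vK sub Kn.
  by have := wid_gt0 vK; move: Kn; rewrite mul0n /semiper; case: (wid K).
have [sK|sK] := boolP (seed K).
  apply: le_trans (seed_le vK sub sK) _; rewrite ler_wpM2r ?expR_ge0 //.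
  by rewrite ler_weXn2l //= addnC.
pose L := [seq (x, y) | x <- subrects Q, y <- [seq (x, y) | x <- subrects Q, y <- subrects Q]].
pose ev (i : rect * (rect * rect)) w := let: (t, (r1, r2)) := i in
  [/\ valid t, valid r1, valid r2, subrect t K & subrect r1 t] /\
  [/\ subrect r2 t, (semiper K < semiper t + T)%N, near_rect r1 r2 /\ hull r1 r2 = t,
   (semiper r1 + T <= semiper K)%N & (semiper r2 + T <= semiper K)%N] /\
  (grow_ev t K w /\ disjoint_occ (span_ev r1) (span_ev r2) (w `&` box t)).
have cover w : w `<=` [set` s] -> span_ev K w -> exists2 i, i \in L & ev i w.
  move=> ws Kw.
  have fw : finite_set w by apply: sub_finite_set ws _; exact: finite_seq.
  have [S [r1 [r2 [[vS v1 v2 SK] h1 [h2 h3] [nr hr] d]]]] :=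
    spanning_descent vK T_gt0 (seed_large vK sK) fw Kw.
  have r1S : subrect r1 S by rewrite -hr subrect_hulll.
  have r2S : subrect r2 S by rewrite -hr subrect_hullr.
  exists (S, (r1, r2)); last by do ?split => //; exact: span_ev_grow.
  have inQ r : valid r -> subrect r S -> r \in subrects Q.
    by move=> vr rS; apply: mem_subrects => //; apply: subrect_trans rS (subrect_trans SK sub).
  apply/allpairsP; exists (S, (r1, r2)); split => //=; first exact/inQ/subrect_refl.
  by apply/allpairsP; exists (r1, r2); split => //=; exact: inQ.
pose M := X ^+ (2 * cexp n + 5) * expR (- pot g (wid K) (hei K)).
have M0 : 0 <= M by rewrite mulr_ge0 ?exprn_ge0 ?expR_ge0.
have evM i : Pr p s (ev i) <= M.
  (* The geometric conditions in [ev] do not involve w: unless the event is empty, they hold. *)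
  have [[w0 hw]|nh] := pselect (exists w, ev i w); last first.
    rewrite (_ : Pr p s _ = 0) // -[RHS](Ex_cst p s); apply: eq_Ex => w _.
    by apply: iverF => h; apply: nh; exists w.
  move: i hw => [S [r1 r2]] [[vS v1 v2 SK r1S] [[r2S ST [nr hr] t1 t2] _]].
  have SQ := subrect_trans SK sub.
  (* Growth depends on sites outside [S], disjoint spanning on sites inside: independence, then the
     BK inequality. *)
  apply: (@le_trans _ _ (Pr p s (grow_ev S K) * (Pr p s (span_ev r1) * Pr p s (span_ev r2)))).
    apply: (@le_trans _ _ (Pr p s (fun w => disjoint_occ (span_ev r1) (span_ev r2) (w `&` box S) /\ grow_ev S K w))).
      by apply: le_Pr => // w _ [_ [_ [h1 h2]]].
    rewrite (@Pr_indep _ _ p s (box S)); first last.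
    - by apply: (depends_sub _ (@grow_ev_depends S K)) => z [].
    - by move=> w /=; rewrite -setIA setIid.
    rewrite mulrC ler_wpM2l ?Pr_ge0 //.
    apply: (@le_trans _ _ (Pr p s (disjoint_occ (span_ev r1) (span_ev r2)))).
      by apply: le_Pr => // w _; apply: disjoint_occ_sub => z [].
    by apply: BK => //; exact: span_ev_increasing.
  have n1 : (semiper r1 <= n * T)%N by move: Kn t1; clear; rewrite mulSn; lia.
  have n2 : (semiper r2 <= n * T)%N by move: Kn t2; clear; rewrite mulSn; lia.
  have b1 := IH r1 v1 (subrect_trans r1S SQ) n1.
  have b2 := IH r2 v2 (subrect_trans r2S SQ) n2.
  have b3 := grow_le vS vK SK sub sK ST.
  apply: le_trans (ler_pM _ _ b3 (ler_pM _ _ b1 b2)) _; rewrite ?mulr_ge0 ?Pr_ge0 //.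
  set c := cexp n.
  have potK : pot g (wid K) (hei K) <= pot g (wid r1) (hei r1) + pot g (wid r2) (hei r2) +
     2 * g 0%N + ((wid K - wid S)%:R * g (hei S) + (hei K - hei S)%:R * g (wid S)).
    have [d1 d2 d3 d4] := hull_dims v1 v2 nr; rewrite hr in d1 d2 d3 d4.
    have hw : (maxn (wid r1) (wid r2) <= wid S <= wid r1 + wid r2 + 1)%N by rewrite d1.
    have hh : (maxn (hei r1) (hei r2) <= hei S <= hei r1 + hei r2 + 1)%N by rewrite d2.
    have h := pot_merge g_ge0 g_decr g_convex (wid_gt0 v1) (hei_gt0 v1) hw hh.
    apply: le_trans (pot_grow g_decr g_convex (subrect_wid vS SK) (subrect_hei vS SK)) _.
    by rewrite -addrA lerD2r.
  have -> : X ^+ 4 * expR (- ((wid K - wid S)%:R * g (hei S) + (hei K - hei S)%:R * g (wid S))) *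
     (X ^+ c * expR (- pot g (wid r1) (hei r1)) * (X ^+ c * expR (- pot g (wid r2) (hei r2)))) =
     X ^+ (2 * c + 4) * expR (- ((wid K - wid S)%:R * g (hei S) + (hei K - hei S)%:R * g (wid S)) +
       - pot g (wid r1) (hei r1) + - pot g (wid r2) (hei r2)).
    by rewrite !expRD exprD mul2n -addnn exprD; ring.
  rewrite /M -/c -(addn1 4) addnA addn1.
  rewrite exprSr -mulrA ler_wpM2l ?exprn_ge0 //.
  apply: le_trans (_ : expR (2 * g 0%N) * expR (- pot g (wid K) (hei K)) <= _); last first.
    by rewrite ler_wpM2r ?expR_ge0.
  by rewrite -expRD ler_expR; lra.
apply: (@le_trans _ _ (\sum_(i <- L) Pr p s (ev i))).
  apply: le_trans (Pr_union p01 s L ev); apply: le_Pr => // w ws; exact: cover.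
apply: (@le_trans _ _ ((size L)%:R * M)).
  rewrite mulr_natl -sum1_size -sumrMnr /=.
  by under [leRHS]eq_bigr do rewrite mulr1n; apply: ler_sum => i _; exact: evM.
rewrite /M mulrA ler_wpM2r ?expR_ge0 // /L; move: size_Q.
move: (subrects Q) => l hl; rewrite !size_allpairs !natrM.
have -> : cexp n.+1 = (8 + (8 + 8) + (2 * cexp n + 5))%N by rewrite /=; clear; lia.
rewrite (exprD X (8 + (8 + 8))) ler_wpM2r ?exprn_ge0 // (exprD X 8 (8 + 8)) (exprD X 8 8).
by apply: ler_pM => //; apply: ler_pM.
Qed.

End SpanBound.

(** * Thin rectangles *)

Definition colK (K : rect) (j : nat) : pred Z2 :=
  fun z => (z.1 == K.1.1 + j%:Z) && (K.1.2 <= z.2 < K.2.2).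

Lemma span_no_gap K w : valid K -> span_ev K w -> no_gap (colK K) xpred0 (wid K) w.
Proof.
case: K => [[a b] [c d]]; rewrite /valid /wid /= => v sp j jn _ _ v1 v2.
have := spans_not_two_columns sp (x := a + j%:Z); move=> /(_ _ (a + j%:Z, b)) [].
- move=> [x y] [wz [/= h1 h2]]; split=> e; rewrite e in wz.
    by apply: (v1 (a + j%:Z, y)) => //; rewrite /colK /= eqxx.
  apply: (v2 (a + j%:Z + 1, y)) => //; rewrite /colK /= h2 andbT; apply/eqP; lia.
- by rewrite /box /=; lia.
- by [].
Qed.

Lemma count_colK K (s : seq Z2) j : valid K -> uniq s -> box K `<=` [set` s] ->
  (j < wid K)%N -> count (colK K j) s = hei K.
Proof.
move=> vK us Ks jn.
pose l := [seq (K.1.1 + j%:Z, y) | y <- irange K.1.2 (hei K)].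
have -> : hei K = size l by rewrite size_map size_irange.
have ul : uniq l by rewrite map_inj_uniq ?irange_uniq // => y y' [].
have mem_side y : (y \in irange K.1.2 (hei K)) = (K.1.2 <= y < K.2.2).
  by rewrite mem_irange; move: vK; clear; rewrite /valid /hei; lia.
have inK y : K.1.2 <= y < K.2.2 -> box K (K.1.1 + j%:Z, y).
  by move: jn vK; clear; rewrite /box /valid /wid /=; lia.
apply: count_eq_size => // -[x y]; split.
  move=> /mapP[y' + [-> ->]]; rewrite mem_side => hy.
  by split; [rewrite /colK /= eqxx|exact/Ks/inK].
move=> [/andP[/eqP /= -> hy] _]; apply/mapP; exists y => //.
by rewrite mem_side.
Qed.

Lemma colK_inj K i j z : colK K i z -> colK K j z -> i = j.
Proof. by move=> /andP[/eqP e _] /andP[/eqP h _]; lia. Qed.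

Lemma span_ev_flip K w : span_ev K w -> span_ev (flipr K) (flip @^-1` w).
Proof. by rewrite /span_ev !box_flip => /spans_flip. Qed.

Section SeedBound.
Variables (R : realType) (p : R) (K : rect) (s : seq Z2) (u b : R).
Hypothesis p01 : 0 <= p <= 1.
Hypotheses (vK : valid K) (us : uniq s) (Ks : box K `<=` [set` s]).
Hypotheses (u0 : 0 < u) (ub : u <= b) (b1 : b <= 1).
Hypothesis bE : b ^+ 2 = u * b + u * (1 - u).

Lemma Pr_span_columns : 1 - u = (1 - p) ^+ hei K -> b * Pr p s (span_ev K) <= b ^+ wid K.
Proof.
move=> uE.
have Pcol j : (j < wid K)%N -> Pr p s (vacant (colK K j)) = 1 - u.
  by move=> jn; rewrite Pr_vacant // count_colK // uE.
apply: le_trans (no_gap_le p01 (@colK_inj K) Pcol u0 ub b1 bE xpred0 (leqnn _)).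
rewrite big1 // expr0 mulr1 ler_wpM2l ?(le_trans (ltW u0)) //.
by apply: le_Pr => // w _; exact: span_no_gap.
Qed.

Lemma Pr_span_rows : 1 - u = (1 - p) ^+ wid K -> b * Pr p s (span_ev K) <= b ^+ hei K.
Proof.
move=> uE; have vKf : valid (flipr K) by rewrite valid_flip.
have flip_inj : injective flip := inv_inj flipK.
pose row j : pred Z2 := fun z => colK (flipr K) j (flip z).
have Prow j : (j < hei K)%N -> Pr p s (vacant (row j)) = 1 - u.
  move=> jn; rewrite Pr_vacant // uE.
  have -> : count (row j) s = count (colK (flipr K) j) (map flip s).
    by rewrite count_map.
  rewrite count_colK ?map_inj_uniq // => z; rewrite box_flip => /Ks zs.
  by apply/mapP; exists (flip z); rewrite ?flipK.
have row_inj i j z : row i z -> row j z -> i = j by exact: colK_inj.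
apply: le_trans (no_gap_le p01 row_inj Prow u0 ub b1 bE xpred0 (leqnn _)).
rewrite big1 // expr0 mulr1 ler_wpM2l ?(le_trans (ltW u0)) //.
apply: le_Pr => // w _ /span_ev_flip/(span_no_gap vKf) h j jn _ _ v1 v2.
apply: (h j jn) => // z cz wz.
  by apply: (v1 (flip z)) => //; rewrite /row flipK.
by apply: (v2 (flip z)) => //; rewrite /row flipK.
Qed.

End SeedBound.

Lemma half_le (R : realFieldType) (x y t e : R) :
  x - y <= t -> t <= e / 2 -> e < x -> e / 2 <= y.
Proof. by move=> h1 h2 h3; lra. Qed.

Lemma combine_costs (R : realFieldType) (n m a b c d e : R) :
  n * c <= n * (a - e) -> m * d <= m * (b - e) ->
  - (n * a) + - (m * b) + (n + m) * e <= - (n * c + m * d).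
Proof. by move=> h1 h2; lra. Qed.

(** * Seed and growth estimates in terms of p *)

Section Rates.
Variables (R : realType) (p : R).
Hypothesis p_gt0 : 0 < p.
Hypothesis p_le : p <= 1 / 2.

Definition rate (p : R) : R := - ln (1 - p).
Local Notation q := (rate p).

Lemma rate_ge : p <= q.
Proof.
have p_gt := p_gt0; have p_half := p_le.
rewrite /rate; have := @le_ln1Dx R (- p); rewrite -/(1 - p) => h.
by rewrite lerNr; apply: h; lra.
Qed.

Lemma rate_gt0 : 0 < q.
Proof.
have p_gt := p_gt0; have p_half := p_le.
exact: lt_le_trans rate_ge. Qed.

Lemma rate_le : q * (1 - p) <= p.
Proof.
have p_gt := p_gt0; have p_half := p_le.
have p1 : 0 < 1 - p by lra.
rewrite -ler_pdivlMr // /rate -lnV ?posrE //.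
have e : (1 - p)^-1 = 1 + p / (1 - p) by field; rewrite gt_eqF.
rewrite [X in ln X]e.
apply: le_ln1Dx; apply: lt_le_trans (_ : 0 <= _); first lra.
by rewrite divr_ge0 // ltW.
Qed.

Lemma rate_le2 : q <= 2 * p.
Proof.
have p_gt := p_gt0; have p_half := p_le.
have h1 := rate_le; have q0 := rate_gt0.
have : q * (1 / 2) <= q * (1 - p) by apply: ler_wpM2l; [exact: ltW|lra].
lra.
Qed.

Lemma expR_rate k : expR (- (q * k%:R)) = (1 - p) ^+ k.
Proof.
have p_gt := p_gt0; have p_half := p_le.
rewrite -mulNr opprK expRM_natr lnK // posrE; lra.
Qed.

Definition occ_pr (k : nat) : R := 1 - expR (- (q * k%:R)).
Definition beta (k : nat) : R := expR (- gz (q * k%:R)).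

Lemma occ_prE k : 1 - occ_pr k = (1 - p) ^+ k.
Proof.
have p_gt := p_gt0; have p_half := p_le.
by rewrite /occ_pr opprB addrC subrK expR_rate. Qed.

Lemma betaP k : (0 < k)%N -> [/\ beta k ^+ 2 = occ_pr k * beta k + occ_pr k * (1 - occ_pr k),
  0 < occ_pr k, occ_pr k <= beta k & beta k <= 1].
Proof.
have p_gt := p_gt0; have p_half := p_le.
by move=> k0; apply: gz_beta; rewrite mulr_gt0 ?rate_gt0 // ltr0n. Qed.

Lemma occ_pr_ge k : (0 < k)%N -> p <= occ_pr k.
Proof.
have p_gt := p_gt0; have p_half := p_le.
case: k => // k _; rewrite /occ_pr expR_rate exprS.
have : (1 - p) ^+ k <= 1 by rewrite exprn_ile1 //; lra.
have : 0 <= (1 - p) ^+ k by rewrite exprn_ge0 //; lra.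
by move: (_ ^+ k) => x; nra.
Qed.

Lemma beta_exp k n : beta k ^+ n = expR (- (n%:R * gz (q * k%:R))).
Proof.
have p_gt := p_gt0; have p_half := p_le.
by rewrite /beta -expRM_natl mulrN. Qed.

Lemma beta_ge k : (0 < k)%N -> p <= beta k.
Proof.
have p_gt := p_gt0; have p_half := p_le.
by move=> k0; have [_ _ h _] := betaP k0; apply: le_trans h; exact: occ_pr_ge. Qed.

Lemma occ_pr_lower (eta : R) k : eta / 2 <= k%:R * p -> 1 - expR (- (eta / 2)) <= occ_pr k.
Proof.
move=> h; rewrite /occ_pr lerD2l lerN2 ler_expR lerN2; apply: le_trans h _.
by rewrite mulrC ler_wpM2r // rate_ge.
Qed.

(** With k <= M the two sides, the potential is at most (M + k) g(0) <= 2 M g(Z). As q k <= 2 eta,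
    each of the M cross-sections of length k costs at least g(2 eta) >= 2 g(Z), which suffices. *)
Lemma seed_bound K s (Z eta : R) (g : nat -> R) : valid K -> uniq s -> box K `<=` [set` s] ->
  0 < Z -> 2 * gz Z <= gz (2 * eta) -> g 0%N <= gz Z -> (forall k, 0 <= g k) ->
  (forall k, g k.+1 <= g k) ->
  ((wid K)%:R * p <= eta) || ((hei K)%:R * p <= eta) ->
  Pr p s (span_ev K) <= p^-1 ^+ 2 * expR (- pot g (wid K) (hei K)).
Proof.
have p_gt := p_gt0; have p_half := p_le.
move=> vK us Ks Z0 hZ gZ g0 gd hK.
have p01 : 0 <= p <= 1 by lra.
have key k M : (0 < k)%N -> (k <= M)%N -> k%:R * p <= eta -> (pot g (wid K) (hei K) <= (M + k)%:R * g 0%N) ->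
    beta k * Pr p s (span_ev K) <= beta k ^+ M ->
    Pr p s (span_ev K) <= p^-1 ^+ 2 * expR (- pot g (wid K) (hei K)).
  move=> k0 kM kp hpot hPr.
  have q0 := rate_gt0; have q2 := rate_le2.
  have k0' : (0 : R) < k%:R by rewrite ltr0n.
  have h1 : 2 * gz Z <= gz (q * k%:R).
    apply: le_trans hZ _; apply: gz_le; first by rewrite mulr_gt0.
    have : q * k%:R <= 2 * p * k%:R by rewrite ler_wpM2r // ltW.
    lra.
  have h2 : beta k ^+ M <= expR (- pot g (wid K) (hei K)).
    rewrite beta_exp ler_expR lerN2; apply: le_trans hpot _.
    apply: le_trans (_ : (2 * M%:R) * gz Z <= _).
      by apply: ler_pM => //; rewrite -natrM ler_nat mul2n -addnn leq_add2l.
    have -> : 2 * M%:R * gz Z = M%:R * (2 * gz Z) by ring.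
    by rewrite ler_wpM2l.
  have h3 : p * Pr p s (span_ev K) <= expR (- pot g (wid K) (hei K)).
    apply: le_trans h2; apply: le_trans hPr; rewrite ler_wpM2r ?Pr_ge0 //; exact: beta_ge.
  rewrite mulrC in h3; rewrite -ler_pdivlMr // in h3.
  apply: le_trans h3 _; rewrite mulrC ler_wpM2r ?expR_ge0 //.
  have p1 : p <= 1 by apply: le_trans p_half _; lra.
  by rewrite expr2 ler_peMr ?invr_ge0 ?invf_ge1 ?(ltW p_gt).
have w0 := wid_gt0 vK; have h0 := hei_gt0 vK.
have pu := pot_ub gd (wid K) (hei K).
case: (leqP (hei K) (wid K)) => hw.
  have [bE u0 ub b1] := betaP h0.
  apply: (key (hei K) (wid K)) => //; last by apply: Pr_span_columns bE _ => //; exact: occ_prE.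
  case/orP: hK => // h; apply: le_trans h; rewrite ler_wpM2r ?(ltW p_gt0) // ler_nat //.
have [bE u0 ub b1] := betaP w0.
apply: (key (wid K) (hei K)) => //; first exact: ltnW.
- case/orP: hK => // h; apply: le_trans h; rewrite ler_wpM2r ?(ltW p_gt0) // ler_nat ltnW //.
- by rewrite addnC.
- by apply: Pr_span_rows bE _ => //; exact: occ_prE.
Qed.

(** [S] is within T of [K], so its sides exceed eta / (2p) and cross-sections are occupied with
    probability at least a constant u0. The corner factor is then at most exp(n m p / u0^2) <=
    exp((n + m) eps C), absorbed by the slack [eps * C] of [g] below [gz]. *)
Lemma grow_bound S K s (eta tau eps C : R) T (g : nat -> R) :
  valid S -> valid K -> subrect S K -> uniq s -> box K `<=` [set` s] ->
  g (wid S) <= gz (q * (wid S)%:R) - eps * C ->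
  g (hei S) <= gz (q * (hei S)%:R) - eps * C ->
  0 < eta -> tau <= eta / 2 -> 0 < eps -> T%:R * p <= tau ->
  tau <= eps * C * (1 - expR (- (eta / 2))) ^+ 2 ->
  eta < (wid K)%:R * p -> eta < (hei K)%:R * p ->
  (semiper K < semiper S + T)%N ->
  Pr p s (grow_ev S K) <= p^-1 ^+ 4 * expR (- ((wid K - wid S)%:R * g (hei S) +
                                               (hei K - hei S)%:R * g (wid S))).
Proof.
have p_gt := p_gt0; have p_half := p_le.
move=> vS vK sub us Ks gleW gleH eta0 taueta eps0 Ttau tauC wK hK ST.
have p01 : 0 <= p <= 1 by lra.
have p0 := p_gt0; have p1 : p <= 1 by lra.
have wS0 := wid_gt0 vS; have hS0 := hei_gt0 vS.
have ws := subrect_wid vS sub; have hs := subrect_hei vS sub.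
have [b1E u10 ub1 b11] := betaP hS0; have [b2E u20 ub2 b21] := betaP wS0.
have := Pr_grow_le p01 vS vK sub us Ks u10 ub1 b11 b1E (occ_prE _) u20 ub2 b21 b2E (occ_prE _).
set n := (wid K - wid S)%N; set m := (hei K - hei S)%N.
have nmT : (n + m <= T)%N by move: ST ws hs; rewrite /n /m /semiper; clear; lia.
set u0 := 1 - expR (- (eta / 2)) in tauC.
have u0_gt0 : 0 < u0 by rewrite /u0 subr_gt0 expR_lt1 oppr_lt0 divr_gt0.
have uge k l : (k - l <= T)%N -> (l <= k)%N -> eta < k%:R * p -> u0 <= occ_pr l.
  move=> klT lk kp; apply: occ_pr_lower.
  have : (k - l)%:R * p <= tau.
    by apply: le_trans Ttau; rewrite ler_wpM2r ?(ltW p0) // ler_nat.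
  by rewrite natrB // mulrBl => h; exact: half_le h taueta kp.
have U1 : u0 <= occ_pr (hei S).
  by apply: (uge (hei K)) => //; apply: leq_trans nmT; rewrite /m leq_addl.
have U2 : u0 <= occ_pr (wid S).
  by apply: (uge (wid K)) => //; apply: leq_trans nmT; rewrite /n leq_addr.
set X := occ_pr (hei S) * occ_pr (wid S).
have X0 : u0 ^+ 2 <= X by rewrite expr2; apply: ler_pM => //; exact: ltW.
have u02 : 0 < u0 ^+ 2 by rewrite exprn_gt0.
have Xp : 0 < X by exact: lt_le_trans X0.
have corner_le : (1 - p + p / X) ^+ (n * m) <= expR ((n + m)%:R * (eps * C)).
  apply: (@le_trans _ _ (expR (p / u0 ^+ 2) ^+ (n * m))).
    rewrite lerXn2r ?nnegrE ?expR_ge0 //.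
      by rewrite addr_ge0 ?divr_ge0 ?(ltW p0) ?(ltW Xp) // subr_ge0.
    apply: le_trans (expR_ge1Dx _).
    have hX : p / X <= p / u0 ^+ 2 by rewrite ler_wpM2l ?(ltW p0) // lef_pV2.
    by rewrite -addrA lerD2l (le_trans _ hX) // gerDr oppr_le0 ltW.
  rewrite -expRM_natl ler_expR.
  apply: (@le_trans _ _ ((n + m)%:R * (T%:R * p / u0 ^+ 2))).
    rewrite -(mulrA T%:R) [leRHS]mulrA ler_wpM2r ?divr_ge0 ?(ltW p0) ?(ltW u02) // -natrM ler_nat.
    by apply: leq_mul; [exact: leq_addr|apply: leq_trans nmT; exact: leq_addl].
  rewrite ler_wpM2l // ler_pdivrMr //; exact: le_trans Ttau tauC.
move=> hPr.
have pr0 := Pr_ge0 p01 s (grow_ev S K).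
(* The prefactor in [Pr_grow_le] is a product of four factors, each at least p: the origin of the
   exponent 4. *)
have p4 : p ^+ 4 <= beta (hei S) * occ_pr (hei S) * (beta (wid S) * occ_pr (wid S)).
  rewrite (_ : p ^+ 4 = p * p * (p * p)); last by ring.
  by rewrite !ler_pM ?mulr_ge0 ?beta_ge ?occ_pr_ge // ltW.
have h4 : p ^+ 4 * Pr p s (grow_ev S K) <= expR (- (n%:R * g (hei S) + m%:R * g (wid S))).
  apply: le_trans (ler_wpM2r pr0 p4) _; apply: le_trans hPr _.
  have bn k l : beta k ^+ l <= expR (- (l%:R * gz (q * k%:R))) by rewrite beta_exp.
  have b0 k l : 0 <= beta k ^+ l by rewrite exprn_ge0 ?expR_ge0.
  apply: le_trans (ler_pM _ _ (ler_pM (b0 _ _) (b0 _ _) (bn _ _) (bn _ _)) corner_le) _.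
  - by rewrite mulr_ge0.
  - by rewrite exprn_ge0 // addr_ge0 ?divr_ge0 ?(ltW p0) ?(ltW Xp) // subr_ge0.
  rewrite -!expRD ler_expR natrD.
  apply: combine_costs; rewrite ler_wpM2l //.
by rewrite exprVn mulrC ler_pdivlMr ?exprn_gt0 // mulrC.
Qed.

End Rates.

Definition sqrect (L : nat) : rect := ((1, 1), (L%:Z + 1, L%:Z + 1)).

Lemma wid_sqrect L : wid (sqrect L) = L.
Proof. by rewrite /wid /=; lia. Qed.

Lemma hei_sqrect L : hei (sqrect L) = L.
Proof. by rewrite /hei /=; lia. Qed.

Lemma valid_sqrect L : (0 < L)%N -> valid (sqrect L).
Proof. by rewrite /valid /=; lia. Qed.

Section RiemannLower.
Variables (R : realType).

Lemma sum_gz_ge (q Z : R) L : 0 < q -> 0 < Z ->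
  Gz (q * L.+1%:R + Z) - Gz (q + Z) <= \sum_(k < L) q * gz (q * k.+1%:R + Z).
Proof.
move=> q0 Z0; elim: L => [|L IH].
  by rewrite big_ord0 mulr1 subrr.
rewrite big_ord_recr /=.
have k0 : 0 < q * L.+1%:R + Z by rewrite addr_gt0 // mulr_gt0.
have e : q * L.+2%:R + Z - (q * L.+1%:R + Z) = q by rewrite -(natr1 L.+1); ring.
have k1 : q * L.+1%:R + Z <= q * L.+2%:R + Z by rewrite lerD2r ler_pM2l // ler_nat.
have h : Gz (q * L.+2%:R + Z) - Gz (q * L.+1%:R + Z) <= q * gz (q * L.+1%:R + Z).
  apply: le_trans (_ : (q * L.+2%:R + Z - (q * L.+1%:R + Z)) * gz (q * L.+1%:R + Z) <= _).
    by case/andP: (Gz_bounds k0 k1).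
  by rewrite e.
by rewrite -(subrKA (Gz (q * L.+1%:R + Z))) addrC lerD.
Qed.

Lemma gz_convex3 (x d : R) : 0 < x -> 0 <= d -> gz (x + d) - gz x <= gz (x + 2 * d) - gz (x + d).
Proof.
move=> x0 d0; have y0 : 0 < x + d by lra.
have z0 : 0 < x + 2 * d by lra.
have h1 := gz_tangent y0 x0; have h2 := gz_tangent y0 z0.
rewrite (_ : x - (x + d) = - d) in h1; last by ring.
rewrite (_ : x + 2 * d - (x + d) = d) in h2; last by ring.
move: (slope _) h1 h2 => a; rewrite mulrN; lra.
Qed.

End RiemannLower.

Lemma rate_drop (R : realFieldType) (p q S D : R) : 0 < p -> p <= 1 / 2 ->
  q * (1 - p) <= p -> D <= q * S -> 0 <= S -> (1 - p) * (p^-1 * D) <= S.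
Proof.
move=> p0 p2 qp DS S0; rewrite mulrCA ler_pdivrMl //.
have p1 : 0 <= 1 - p by lra.
apply: le_trans (ler_wpM2l p1 DS) _.
by rewrite mulrA ler_wpM2r // mulrC.
Qed.

Lemma side_le (R : realFieldType) (p B l : R) : 0 < p -> p <= 1 / 2 ->
  l * p <= B -> (B + 1) * p <= 1 -> l + 1 <= p^-1 * p^-1.
Proof.
move=> p0 p2 lp Bp; rewrite -invfM -[leRHS]mul1r ler_pdivlMr ?mulr_gt0 //.
have h := ler_wpM2r (ltW p0) lp; have h' : p * p <= p by nra.
lra.
Qed.

Section SquareBound.
Variables (R : realType) (p B Z eps eta tau : R) (n : nat).
Let q := rate p.
Let L := Num.truncn (B / p).
Let T := Num.truncn (tau / p).
Let g k := (1 - eps) * gz (q * k%:R + Z).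
Hypothesis p0 : 0 < p.
Hypothesis p2 : p <= 1 / 2.
Hypothesis Z0 : 0 < Z.
Hypothesis pZ : 2 * p <= Z.
Hypothesis eps0 : 0 < eps.
Hypothesis eps1 : eps <= 1.
Hypothesis eta0 : 0 < eta.
Hypothesis etaZ : 2 * gz Z <= gz (2 * eta).
Hypothesis tau0 : 0 < tau.
Hypothesis taueta : tau <= eta / 2.
Hypothesis peta : p <= eta / 4.
Hypothesis ptau : 2 * p <= tau.
Hypothesis tauB : tau <= eps * gz (2 * B) * (1 - expR (- (eta / 2))) ^+ 2.
Hypothesis pB : p <= B.
Hypothesis B0 : 0 < B.
Hypothesis pB1 : (B + 1) * p <= 1.
Hypothesis pg : expR (2 * gz Z) <= p^-1.
Hypothesis nB : 4 * B <= n%:R * tau.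

Let q0 : 0 < q. Proof. exact: rate_gt0. Qed.

Let L0 : (0 < L)%N.
Proof. by rewrite /L truncn_gt0 ler_pdivlMr // mul1r. Qed.

Let Lp : L%:R * p <= B.
Proof. by rewrite -ler_pdivlMr // truncn_le // divr_ge0 // ltW. Qed.

Let Lp1 : B <= L.+1%:R * p.
Proof. by rewrite -ler_pdivrMr // ltW // truncnS_gt. Qed.

Let T0 : (0 < T)%N.
Proof. rewrite /T truncn_gt0 ler_pdivlMr // mul1r; move: p0 ptau; lra. Qed.

Let Tp : T%:R * p <= tau.
Proof. by rewrite -ler_pdivlMr // truncn_le // divr_ge0 // ltW. Qed.

Let Tp1 : tau <= 2 * (T%:R * p).
Proof.
have : tau <= T.+1%:R * p by rewrite -ler_pdivrMr // ltW // truncnS_gt.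
have hp := ptau; rewrite -natr1 mulrDl mul1r; lra.
Qed.

Let kq k : 0 <= q * k%:R. Proof. by rewrite mulr_ge0 // ltW. Qed.

Let kZ k : 0 < q * k%:R + Z. Proof. by rewrite ltr_wpDl // kq. Qed.

Let eps1' : 0 <= 1 - eps. Proof. by rewrite subr_ge0. Qed.

Let g_ge0 k : 0 <= g k.
Proof. by rewrite mulr_ge0 // ltW // gz_gt0. Qed.

Let kqS k : q * k.+1%:R = q * k%:R + q.
Proof. by rewrite -natr1 mulrDr mulr1. Qed.

Let g_decr k : g k.+1 <= g k.
Proof.
by rewrite /g ler_wpM2l // gz_le // lerD2r kqS lerDl ltW.
Qed.

Let g_convex k : g k.+1 - g k <= g k.+2 - g k.+1.
Proof.
rewrite /g -!mulrBr ler_wpM2l // !kqS.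
have -> : q * k%:R + q + q + Z = q * k%:R + Z + 2 * q by ring.
have -> : q * k%:R + q + Z = q * k%:R + Z + q by ring.
exact: gz_convex3 (kZ k) (ltW q0).
Qed.

Let g0_le : g 0%N <= gz Z.
Proof.
rewrite /g mulr0 add0r ler_piMl ?(ltW (gz_gt0 _)) //.
by rewrite gerBl ltW.
Qed.

(** Up to size L, q k is at most 2 B, so the factor 1 - eps leaves room for [eps * gz (2 * B)],
    which pays for the corners. *)
Let g_le k : (0 < k <= L)%N -> g k <= gz (q * k%:R) - eps * gz (2 * B).
Proof.
move=> /andP[k0 kL].
have k0' : 0 < q * k%:R by rewrite mulr_gt0 // ltr0n.
have h1 : gz (q * k%:R + Z) <= gz (q * k%:R) by rewrite gz_le // lerDl ltW.
have h2 : gz (2 * B) <= gz (q * k%:R).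
  apply: gz_le => //; apply: le_trans (_ : 2 * (k%:R * p) <= _).
    by rewrite mulrCA mulrC ler_wpM2l // rate_le2.
  by rewrite ler_pM2l // (le_trans _ Lp) // ler_pM2r // ler_nat.
have h3 := ler_wpM2l eps1' h1; have h4 := ler_wpM2l (ltW eps0) h2.
apply: le_trans h3 _; rewrite mulrBl mul1r; exact: lerB.
Qed.

Let Q := sqrect L.

(** [Z] is the shift, [eta / p] the largest short side of a seed, [tau / p] the descent step, and n
    a number of levels reaching the semi-perimeter 2 L. The sum of g is compared with the integral
    from 2 Z, which exceeds q + Z, to B. *)
Lemma Pr_square_le : Pr p (rsites Q) (span_ev Q) <=
  p^-1 ^+ cexp n * expR (- (2 * (1 - eps) * ((1 - p) / p) * (Gz B - Gz (2 * Z)))).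
Proof.
have vQ : valid Q by exact: valid_sqrect.
pose seed (K : rect) := ((wid K)%:R * p <= eta) || ((hei K)%:R * p <= eta).
have boxQ K : valid K -> subrect K Q -> box K `<=` [set` rsites Q].
  by move=> vK KQ z Kz; apply/mem_rsites => //; apply: (subrect_box Q vK).2 KQ z Kz.
have X1 : 1 <= p^-1 by rewrite invf_ge1 //; apply: le_trans p2 _; lra.
have szQ : (size (subrects Q))%:R <= p^-1 ^+ 8.
  rewrite size_subrects // wid_sqrect hei_sqrect.
  have h : (L + 1)%:R <= p^-1 * p^-1 :> R.
    by rewrite natrD; exact: (side_le p0 p2 Lp pB1).
  have -> : p^-1 ^+ 8 = p^-1 * p^-1 * (p^-1 * p^-1) * (p^-1 * p^-1 * (p^-1 * p^-1)) by ring.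
  by rewrite !natrM; do ?apply: ler_pM => //; rewrite ?mulr_ge0.
have seedL K : valid K -> ~~ seed K -> (T + 2 < semiper K)%N.
  move=> vK /norP[]; rewrite -!ltNge => h1 h2.
  rewrite -(ltr_nat R) -(ltr_pM2r p0) natrD /semiper natrD !mulrDl.
  have := Tp; have := taueta; have := peta; have := eta0; lra.
have seedP K : valid K -> subrect K Q -> seed K ->
  Pr p (rsites Q) (span_ev K) <= p^-1 ^+ 2 * expR (- pot g (wid K) (hei K)).
  move=> vK KQ sK.
  by apply: (seed_bound p0 p2 vK (rsites_uniq _) (boxQ _ vK KQ) Z0 etaZ g0_le g_ge0 g_decr sK).
have growP (S K : rect) : valid S -> valid K -> subrect S K -> subrect K Q ->
  ~~ seed K -> (semiper K < semiper S + T)%N ->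
  Pr p (rsites Q) (grow_ev S K) <= p^-1 ^+ 4 * expR (- ((wid K - wid S)%:R * g (hei S) +
                                           (hei K - hei S)%:R * g (wid S))).
  move=> vS vK SK KQ /norP[]; rewrite -!ltNge => h1 h2 ST.
  have SQ := subrect_trans SK KQ.
  have gw : g (wid S) <= gz (q * (wid S)%:R) - eps * gz (2 * B).
    by apply: g_le; rewrite wid_gt0 //= -(wid_sqrect L); exact: subrect_wid.
  have gh : g (hei S) <= gz (q * (hei S)%:R) - eps * gz (2 * B).
    by apply: g_le; rewrite hei_gt0 //= -(hei_sqrect L); exact: subrect_hei.
  exact: (grow_bound p0 p2 vS vK SK (rsites_uniq _) (boxQ _ vK KQ) gw gh eta0 taueta eps0 Tp tauB h1 h2 ST).
have g0X : expR (2 * g 0%N) <= p^-1.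
  by apply: le_trans pg; rewrite ler_expR ler_pM2l.
have semiQ : (semiper Q <= n * T)%N.
  rewrite /semiper wid_sqrect hei_sqrect -(ler_nat R) -(ler_pM2r p0) natrD natrM mulrDl -mulrA.
  have h1 := Lp; have h2 : n%:R * tau <= n%:R * (2 * (T%:R * p)) by rewrite ler_wpM2l // Tp1.
  have h3 := nB; lra.
have := Pr_span_le p0 p2 vQ g_ge0 g_decr g_convex T0 szQ g0X seedL seedP growP vQ (subrect_refl Q) semiQ.
move=> h; apply: le_trans h _; rewrite ler_wpM2l ?exprn_ge0 ?(le_trans _ X1) //.
rewrite ler_expR lerN2 wid_sqrect hei_sqrect pot_square -mulr_sumr.
rewrite -!mulrA ler_pM2l // ler_wpM2l //.
have h1 := sum_gz_ge L q0 Z0.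
have h2 : Gz B - Gz (2 * Z) <= Gz (q * L.+1%:R + Z) - Gz (q + Z).
  have k1 : B <= q * L.+1%:R + Z.
    rewrite (le_trans Lp1) // mulrC ler_wpDr ?(ltW Z0) // ler_wpM2r //; exact: rate_ge.
  have k2 : q + Z <= 2 * Z.
    rewrite mulr_natl mulr2n lerD2r; apply: le_trans pZ; exact: rate_le2.
  apply: lerB; apply: Gz_nondecr => //; by rewrite addr_gt0.
rewrite -mulr_sumr in h1.
have h3 := le_trans h2 h1.
have S0 : 0 <= \sum_(k < L) gz (q * k.+1%:R + Z).
  by apply: sumr_ge0 => k _; rewrite ltW // gz_gt0.
move: h3 S0; move: (\sum_(k < L) _) (Gz B - Gz (2 * Z)) => S D.
exact: rate_drop p0 p2 (rate_le p0 p2).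
Qed.

End SquareBound.

(** * The site percolation law *)

Section Transfer.
Variables (R : realType) (p : R) (P : probability config R).
Hypothesis hP : is_product_measure p P.

(** The sites of [s] are revealed one at a time, [occ] and [vac] recording those already seen; in
    the end the event is a cylinder or empty. *)
Lemma product_measure_Ex (Phi : set Z2 -> Prop) (occ vac s : seq Z2) :
  uniq (occ ++ vac ++ s) ->
  let A := [set X : config | [/\ forall x, x \in occ -> X x, forall x, x \in vac -> ~ X x &
                     Phi ([set` occ] `|` (X `&` [set` s]))]] in
  measurable A /\
  P A = (p ^+ size occ * (1 - p) ^+ size vac * Pr p s (fun w => Phi ([set` occ] `|` w)))%:E.
Proof.
elim: s occ vac => [|x s IH] occ vac us /=.
  rewrite /Pr /=; set A := [set X | _].
  have e (X : config) : X `&` [set` [::]] = set0.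
    by apply/seteqP; split => y // [].
  have [h|h] := pselect (Phi ([set` occ] `|` set0)).
    have -> : A = cylinder occ vac.
      by apply/seteqP; split=> X; [case|case; split => //; rewrite e].
    split; first exact: cylinder_measurable.
    by rewrite (iverT R h) mulr1 hP // -[vac]cats0.
  have -> : A = set0.
    by apply/seteqP; split=> X //; case=> _ _; rewrite e.
  by rewrite (iverF R h) mulr0 measure0.
set A := [set X | _].
have uxo : uniq ((x :: occ) ++ vac ++ s).
  by move: us; rewrite catA -[x :: s]cat1s uniq_catCA -catA.
have uxv : uniq (occ ++ (x :: vac) ++ s).
  by move: uxo; rewrite -cat1s -catA uniq_catCA.
have [m1 P1] := IH (x :: occ) vac uxo.
have [m2 P2] := IH occ (x :: vac) uxv.
set A1 := [set X | _] in m1 P1; set A2 := [set X | _] in m2 P2.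
have xvac : x \notin vac.
  by move: uxv; rewrite /= cat_uniq => /and3P[_ _ /andP[]]; rewrite mem_cat => /norP[].
have xocc : x \notin occ.
  by move: uxo => /= /andP[]; rewrite mem_cat => /norP[].
have e1 (X : config) : X x ->
    [set` occ] `|` (X `&` [set` x :: s]) = [set` x :: occ] `|` (X `&` [set` s]).
  move=> Xx; apply/seteqP; split=> y /=; rewrite !inE.
    case=> [->|[Xy /orP[/eqP ->|->]]]; [left; rewrite orbT|left; rewrite eqxx|right] => //.
  by case=> [/orP[/eqP ->|->]|[Xy ->]]; [right; rewrite eqxx|left|right; rewrite orbT].
have e2 (X : config) : ~ X x -> X `&` [set` x :: s] = X `&` [set` s].
  move=> Xx; apply/seteqP; split=> y /=; rewrite !inE.
    by case=> Xy /orP[/eqP e|//]; case: Xx; rewrite -e.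
  by case=> Xy ->; rewrite orbT.
have AE : A = A1 `|` A2.
  apply/seteqP; split=> X.
    case=> h1 h2 h3; have [Xx|Xx] := pselect (X x); [left|right]; split => //.
    - by move=> y; rewrite inE => /orP[/eqP ->|/h1].
    - by rewrite -e1.
    - by move=> y; rewrite inE => /orP[/eqP ->|/h2].
    - by rewrite -e2.
  case=> -[h1 h2 h3].
    have Xx : X x by apply: h1; rewrite mem_head.
    by split=> //; [move=> y yo; apply: h1; rewrite inE yo orbT|rewrite e1].
  have Xx : ~ X x by apply: h2; rewrite mem_head.
  by split=> //; [move=> y yo; apply: h2; rewrite inE yo orbT|rewrite e2].
rewrite AE; split; first exact: measurableU.
have A12 : A1 `&` A2 = set0.
  rewrite -subset0 => X [[h1 _ _] [_ h2 _]].
  by apply: (h2 x); [rewrite mem_head|apply: h1; rewrite mem_head].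
transitivity (P A1 + P A2)%E; first by rewrite measureU.
rewrite P1 P2 -EFinD; congr EFin; rewrite /Pr /= !exprS.
have -> : Ex p s (fun w => '1[Phi ([set` x :: occ] `|` w)]) =
    Ex p s (fun w => '1[Phi ([set` occ] `|` (x |` w))]).
  apply: eq_Ex => w _; congr ('1[Phi _]); apply/seteqP; split=> y /=; rewrite inE.
    by case=> [/orP[/eqP ->|yo]|yw]; [right; left|left|right; right].
  by case=> [yo|[->|yw]]; [left; rewrite yo orbT|left; rewrite eqxx|right].
ring.
Qed.

End Transfer.

Lemma square_box L : square L = box (sqrect L).
Proof.
by apply/seteqP; split=> -[x y]; rewrite /square /box /= !ltzD1.
Qed.

Lemma span_probE (R : realType) (L : nat) (p : R) : (0 < L)%N -> 0 <= p <= 1 ->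
  span_prob L p = (Pr p (rsites (sqrect L)) (span_ev (sqrect L)))%:E.
Proof.
move=> L0 p01; set s := rsites _.
have us : uniq ([::] ++ [::] ++ s) by exact: rsites_uniq.
have [_] := product_measure_Ex (site_lawP p01) (span_ev (sqrect L)) us.
rewrite !expr0 !mul1r => h.
have -> : Pr p s (span_ev (sqrect L)) =
    Pr p s (fun w => span_ev (sqrect L) ([set` [::]] `|` w)).
  by apply: eq_Ex => w _; congr ('1[span_ev _ _]); apply/seteqP; split=> y; [right|case].
rewrite -h /span_prob; congr (site_law p _); apply/seteqP; split=> X.
  rewrite /= square_box => /internally_spannedE-/(_ (@bclosed_box _)) sp.
  split => //; apply: spansS sp => // z [Xz Bz]; split => //; right; split => //.
  by apply/mem_rsites => //; exact: valid_sqrect.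
case=> _ _ sp; rewrite /= square_box; apply/internally_spannedE; first exact: bclosed_box.
apply: spansS sp => // z [[//|[Xz _]] Bz]; by split.
Qed.

(** Here [D] is Gz B - Gz (2 Z), [x] is ln (1/p) and [c] is [cexp n]. The polynomial factor, the
    factors 1 - eps and 1 - p, and the two ends of the integral each cost a few e. *)
Lemma cost_balance (R : realFieldType) (p eps D e lam c d l x : R) :
  0 < p -> 0 < eps -> 0 <= D -> eps * D <= e -> p * D <= e -> lam - 2 * e <= D ->
  c * (p * x) <= c * (d + p * l) -> c * d <= e -> p * (c * l + 1) <= e ->
  c * x + - (2 * (1 - eps) * ((1 - p) / p) * D) <= - ((2 * lam - 16 * e) / p).
Proof.
move=> p0 eps0 D0 h2 h3 Dg h1 cd pc.
rewrite -(ler_pM2l p0).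
have -> : p * (c * x + - (2 * (1 - eps) * ((1 - p) / p) * D)) =
    c * (p * x) - 2 * ((1 - eps) * (1 - p) * D) by field; rewrite gt_eqF.
have -> : p * - ((2 * lam - 16 * e) / p) = - (2 * lam - 16 * e) by field; rewrite gt_eqF.
have h4 : 0 <= eps * (p * D) by rewrite !mulr_ge0 // ltW.
have e0 : 0 <= e by apply: le_trans h3; rewrite mulr_ge0 // ltW.
lra.
Qed.

(** * The lower bound on the cost *)

Section Liminf.
Variable R : realType.

Lemma neg_lne_ge (P p c : R) : 0 < p -> 0 <= P -> P <= expR (- (c / p)) ->
  (c%:E <= - p%:E * lne P%:E)%E.
Proof.
move=> p0; rewrite le_eqVlt => /predU1P[<- _|P0 Pc].
  (* For P = 0 the logarithm is -oo, and the factor -p makes it +oo. *)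
  rewrite le0_lneNy // -EFinN mulrNy ltr0_sg ?oppr_lt0 // EFinN mulN1e.
  exact: leey.
rewrite lne_EFin // -EFinN -EFinM lee_fin mulNr lerNr mulrC -ler_pdivlMr // mulNr.
by rewrite -[leRHS]expRK ler_ln ?posrE ?expR_gt0.
Qed.

Lemma neg_lne_le (P p c : R) : 0 < p -> expR (- (c / p)) <= P ->
  (- p%:E * lne P%:E <= c%:E)%E.
Proof.
move=> p0 Pc; have P0 : 0 < P by apply: lt_le_trans Pc; exact: expR_gt0.
rewrite lne_EFin // -EFinN -EFinM lee_fin mulNr lerNl mulrC -ler_pdivrMr // mulNr.
by rewrite -[leLHS]expRK ler_ln ?posrE ?expR_gt0.
Qed.

(** Apply ln y <= y to y = d / p: for fixed d the bound tends to d, so p ln (1/p) -> 0. *)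
Lemma p_ln_le (p d : R) : 0 < p -> 0 < d -> p * ln p^-1 <= d + p * `|ln d^-1|.
Proof.
move=> p0 d0; have dp : 0 < d / p by rewrite divr_gt0.
have -> : p^-1 = d / p * d^-1 by rewrite mulrAC divff ?mul1r // gt_eqF.
rewrite lnM ?posrE ?invr_gt0 // mulrDr lerD //.
  by rewrite -ler_pdivlMl // [leRHS]mulrC; apply: ltW; apply: ln_sublinear.
by rewrite ler_wpM2l ?(ltW p0) // ler_norm.
Qed.

(** The order of choices is Z and B from e, then eps and eta, then tau, then n, and p last. Thus
    [cexp n] is constant and its contribution, p [cexp n] ln (1/p), vanishes. *)
Lemma span_prob_liminf (e : R) : 0 < e ->
  exists2 B0 : R, 0 < B0 & forall B, B0 <= B -> \forall p \near 0^'+,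
    ((2 * lambda R - e)%:E <= - p%:E * lne (span_prob (Num.truncn (B / p)) p))%E.
Proof.
move=> e0; pose e1 : R := e / 16; have e10 : 0 < e1 by rewrite divr_gt0.
have lam0 : 0 <= lambda R by rewrite /lambda divr_ge0 // sqr_ge0.
have [d1 d10 Hd1] := Gz_small e10; have [d2 d20 Hd2] := Gz_large e10.
pose Z : R := Num.min 1 (d1 / 2).
have Z0 : 0 < Z by rewrite /Z lt_min ltr01 divr_gt0.
have Z1 : Z <= 1 by rewrite /Z ge_min lexx.
have Zd : Z <= d1 / 2 by rewrite /Z ge_min lexx orbT.
have GZ : Gz (2 * Z) <= e1 by apply: Hd1; rewrite ?mulr_gt0 // -ler_pdivlMl // mulrC.
exists (Num.max 2 d2) => [|B]; first by rewrite lt_max ltr0n.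
rewrite ge_max => /andP[B2 Bd2].
have B0 : 0 < B by apply: lt_le_trans B2.
have GB := Hd2 _ Bd2; have GB1 := Gz_le B0.
pose eps : R := Num.min 1 (e1 / (lambda R + 1)).
have l1 : 0 < lambda R + 1 by rewrite ltr_wpDl.
have eps0 : 0 < eps by rewrite /eps lt_min ltr01 divr_gt0.
have eps1 : eps <= 1 by rewrite /eps ge_min lexx.
have epsl : eps * (lambda R + 1) <= e1 by rewrite -ler_pdivlMr // /eps ge_min lexx orbT.
have [e' e'0 He'] := gz_large (2 * gz Z).
pose eta : R := e' / 2; have eta0 : 0 < eta by rewrite divr_gt0.
have etaZ : 2 * gz Z <= gz (2 * eta) by apply: He'; rewrite /eta mulrC divfK // mulr_gt0.
have gB0 : 0 < gz (2 * B) by apply: gz_gt0; rewrite mulr_gt0.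
have u0 : 0 < 1 - expR (- (eta / 2)) by rewrite subr_gt0 expR_lt1 oppr_lt0 divr_gt0.
pose tau : R := Num.min (eta / 2) (eps * gz (2 * B) * (1 - expR (- (eta / 2))) ^+ 2).
have tau0 : 0 < tau by rewrite /tau lt_min divr_gt0 ?mulr_gt0 ?exprn_gt0.
have taueta : tau <= eta / 2 by rewrite /tau ge_min lexx.
have tauB : tau <= eps * gz (2 * B) * (1 - expR (- (eta / 2))) ^+ 2.
  by rewrite /tau ge_min lexx orbT.
pose n := (Num.truncn (4 * B / tau)).+1.
have nB : 4 * B <= n%:R * tau by rewrite -ler_pdivrMr // ltW // truncnS_gt.
pose c : R := (cexp n)%:R.
have c0 : 0 <= c by [].
have c1 : 0 < c + 1 by rewrite ltr_wpDl.
pose d : R := e1 / (c + 1); have d0 : 0 < d by rewrite divr_gt0.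
pose l : R := `|ln d^-1|; have l0 : 0 <= l by rewrite /l.
have cl0 : 0 < c * l + 1 by rewrite ltr_wpDl // mulr_ge0.
clearbody Z eps eta tau n.
have nb (x : R) : 0 < x -> \forall p \near 0^'+, p <= x by exact: nbhs_right_le.
near=> p.
have p0 : 0 < p by near: p; exact: nbhs_right_gt.
have p2 : p <= 1 / 2 by near: p; apply: nb; rewrite divr_gt0.
have pZ : 2 * p <= Z.
  by rewrite -ler_pdivlMl // mulrC; near: p; apply: nb; rewrite divr_gt0.
have peta : p <= eta / 4 by near: p; apply: nb; rewrite divr_gt0.
have ptau : 2 * p <= tau.
  by rewrite -ler_pdivlMl // mulrC; near: p; apply: nb; rewrite divr_gt0.
have pB : p <= B by near: p; exact: nb.
have pB1 : (B + 1) * p <= 1.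
  by rewrite mulrC -ler_pdivlMr ?addr_gt0 // div1r; near: p; apply: nb; rewrite invr_gt0 addr_gt0.
have pg : expR (2 * gz Z) <= p^-1.
  rewrite -[leLHS]invrK lef_pV2 ?posrE ?invr_gt0 ?expR_gt0 //.
  by near: p; apply: nb; rewrite invr_gt0 expR_gt0.
have pl : p * (lambda R + 1) <= e1.
  by rewrite -ler_pdivlMr //; near: p; apply: nb; rewrite divr_gt0.
have pc : p * (c * l + 1) <= e1.
  by rewrite -ler_pdivlMr //; near: p; apply: nb; rewrite divr_gt0.
have L0 : (0 < Num.truncn (B / p))%N by rewrite truncn_gt0 ler_pdivlMr // mul1r.
have p01 : 0 <= p <= 1 by rewrite ltW //= (le_trans p2) // ler_pdivrMr // mul1r ler1n.
rewrite span_probE //.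
apply: neg_lne_ge => //; first exact: Pr_ge0.
apply: le_trans (Pr_square_le p0 p2 Z0 pZ eps0 eps1 eta0 etaZ tau0 taueta peta ptau tauB pB B0 pB1 pg nB) _.
have -> : p^-1 ^+ cexp n = expR (c * ln p^-1) by rewrite expRM_natl lnK // posrE invr_gt0.
rewrite -expRD ler_expR.
set D := Gz B - Gz (2 * Z).
have D0 : 0 <= D.
  by rewrite /D subr_ge0; apply: Gz_nondecr; rewrite ?mulr_gt0 // (le_trans _ B2) // ler_piMr.
have Dl : D <= lambda R.
  by rewrite /D (le_trans _ GB1) // gerBl Gz_ge0 // mulr_gt0.
have Dg : lambda R - 2 * e1 <= D by rewrite mulr_natl mulr2n opprD addrA lerB.
have hln := p_ln_le p0 d0; rewrite -/l in hln.
have cd : c * d <= e1.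
  by rewrite /d mulrA ler_pdivrMr // mulrC ler_wpM2l ?(ltW e10) // lerDl.
have e16 : e = 16 * e1 by rewrite /e1 mulrC divfK.
have h2 : eps * D <= e1.
  by apply: le_trans epsl; rewrite ler_wpM2l ?(ltW eps0) // (le_trans Dl) // lerDl.
have h3 : p * D <= e1.
  by apply: le_trans pl; rewrite ler_wpM2l ?(ltW p0) // (le_trans Dl) // lerDl.
rewrite e16; exact: cost_balance p0 eps0 D0 h2 h3 Dg (ler_wpM2l c0 hln) cd pc.
Unshelve. all: by end_near.
Qed.

End Liminf.

(** * Lower bound on the spanning probability *)

(** Columns fill from left to right. In a vacant column, the next one has an occupied site, and the
    site between it and the filled region has two filled neighbours. *)
Lemma traversable_fill C (w : set Z2) (a : int) (K : rect) : bclosed C -> valid K ->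
  a < K.1.1 -> box ((a, K.1.2), (K.1.1, K.2.2)) `<=` C -> w `&` box K `<=` C ->
  traversable (colK K) (wid K) w -> box ((a, K.1.2), K.2) `<=` C.
Proof.
case: K => [[A B] [C' D]]; rewrite /valid /box /wid /= => cC v aA rC wC [ng last].
set n := `|C' - A|%N in ng last.
have fillj (j : nat) : (j <= n)%N -> forall x y, a <= x < A + j%:Z -> B <= y < D -> C (x, y).
  elim: j => [|j IH] jn x y hx hy; first by apply: rC => /=; lia.
  case: (ltrP x (A + j%:Z)) => xj; first by apply: IH => //; lia.
  have ex : x = A + j%:Z by lia.
  have prev y' : B <= y' < D -> C (x - 1, y') by move=> hy'; apply: IH => //; lia.
  suff [y0 hy0 Cy0] : exists2 y0, B <= y0 < D & C (x, y0).
    have adj : x = x - 1 + 1 \/ x = x - 1 - 1 by left; lia.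
    exact: (fill_column cC adj prev hy0 Cy0).
  have occ i : ~ vacant (colK (A, B, (C', D)) i) w -> (i < n)%N ->
      exists2 y0, B <= y0 < D & C (A + i%:Z, y0).
    move=> nv iw; apply: contrapT => h; apply: nv => z; case: z => x' y'.
    rewrite /colK /= => /andP[/eqP ex' hy'] wy'; rewrite ex' in wy'.
    by apply: h; exists y' => //; apply: wC; split => //=; lia.
  have [vj|vj] := pselect (vacant (colK (A, B, (C', D)) j) w); last first.
    by rewrite ex; exact: occ.
  have [jl|jl] : (j.+1 < n)%N \/ j.+1 = n by lia.
    have [y0 hy0 Cy0] := occ j.+1 (ng j jl isT isT vj) jl.
    exists y0 => //; apply: (cC _ (x - 1, y0) (A + j.+1%:Z, y0)) => //.
    - by case; lia.
    - by apply/nbhdE => /=; lia.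
    - by apply/nbhdE => /=; lia.
    - exact: prev.
  by case: (last j jl).
by move=> [x y] [/= hx hy]; apply: (fillj n) => //; lia.
Qed.

Definition strip (m n : nat) : rect := ((m%:Z + 1, 1), (m%:Z + n%:Z + 1, m%:Z + 1)).

Definition rowK (K : rect) (j : nat) : pred Z2 := fun z => colK K j (flip z).

Lemma wid_strip m n : wid (strip m n) = n. Proof. by rewrite /wid /=; lia. Qed.
Lemma hei_strip m n : hei (strip m n) = m. Proof. by rewrite /hei /=; lia. Qed.
Lemma valid_strip m n : (0 < m)%N -> (0 < n)%N -> valid (strip m n).
Proof. by rewrite /valid /=; lia. Qed.

(** The strips extend the square to two boxes sharing the site (1, 1), so [hull_meet] also fills the
    corner square. *)
Lemma square_growth m n (w : set Z2) : (0 < m)%N -> (0 < n)%N ->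
  span_ev (sqrect m) w -> traversable (colK (strip m n)) n w ->
  traversable (rowK (strip m n)) n w -> span_ev (sqrect (m + n)) w.
Proof.
move=> m0 n0 sp tc tr C cC wC.
have sqC : box (sqrect m) `<=` C.
  apply: sp => // z [wz bz]; apply: wC; split => //.
  by move: bz; rewrite /box /=; lia.
have hC : box ((1, 1), (strip m n).2) `<=` C.
  apply: (traversable_fill (w := w) cC (valid_strip m0 n0)).
  - by move=> /=; lia.
  - by apply: subset_trans sqC => z; rewrite /box /=; lia.
  - by move=> z [wz bz]; apply: wC; split => //; move: bz; rewrite /box /=; lia.
  - by rewrite wid_strip.
have vC : box ((1, 1), flip (strip m n).2) `<=` C.
  move=> z bz; have := @traversable_fill (flip @^-1` C) (flip @^-1` w) 1 (strip m n)
    (bclosed_flip cC) (valid_strip m0 n0).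
  move=> /(_ _ _ _ _ (flip z)); rewrite /= flipK; apply.
  - by move=> /=; lia.
  - by move=> u bu; apply: sqC; move: bu; rewrite /box /=; lia.
  - by move=> u [wu bu]; apply: wC; split => //; move: bu; rewrite /box /=; lia.
  - rewrite wid_strip; case: tr => ng last.
    have tov j : vacant (colK (strip m n) j) (flip @^-1` w) -> vacant (rowK (strip m n) j) w.
      by move=> v z' cz wz; apply: (v (flip z')) => //; rewrite /= flipK.
    have fromv j : vacant (rowK (strip m n) j) w -> vacant (colK (strip m n) j) (flip @^-1` w).
      by move=> v z' cz wz; apply: (v (flip z')) => //; rewrite /rowK flipK.
    by split=> [j jn o1 o2 /tov v1 /tov v2|j jn /tov]; [exact: (ng j)|exact: last].
  - by move: bz; rewrite /box /=; lia.
have := hull_meet cC hC vC (z := (1, 1)).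
rewrite /box /= => /(_ _ _) h z bz; apply: h; try lia.
by move: bz; rewrite /hull /box /=; lia.
Qed.

(** With [north], two regions disjoint from each other and from the square, containing the
    respective strips for every n; they carry the independence. *)
Definition east (m : nat) : set Z2 := [set z | (m%:Z + 1 <= z.1) /\ (z.2 < m%:Z + 1)].
Definition north (m : nat) : set Z2 := [set z | (m%:Z + 1 <= z.2) /\ (z.1 < m%:Z + 1)].

Lemma cols_east m n : cols (colK (strip m n)) n `<=` east m.
Proof. by move=> [x y]; rewrite /cols /= => -[j _]; rewrite /colK /east /=; lia. Qed.

Lemma rows_north m n : cols (rowK (strip m n)) n `<=` north m.
Proof. by move=> [x y]; rewrite /cols /= => -[j _]; rewrite /rowK /colK /north /=; lia. Qed.

Lemma north_east m : north m `<=` ~` east m.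
Proof. by move=> z; rewrite /north /east /=; lia. Qed.

Lemma east_north_square m : east m `|` north m `<=` ~` box (sqrect m).
Proof. by move=> z; rewrite /north /east /box /=; lia. Qed.

Section GrowthProbability.
Variables (R : realType) (p : R).
Hypothesis p_gt0 : 0 < p.
Hypothesis p_le : p <= 1 / 2.

Definition sqprob (m : nat) : R := Pr p (rsites (sqrect m)) (span_ev (sqrect m)).

Let p01 : 0 <= p <= 1.
Proof. by rewrite ltW //= (le_trans p_le) // ler_pdivrMr // mul1r ler1n. Qed.

Lemma sqprob_ge1 : p <= sqprob 1.
Proof.
have v1 : valid (sqrect 1) by [].
have sub1 : box (sqrect 1) `<=` [set` rsites (sqrect 1)] by move=> z bz; exact/mem_rsites.
have e : Pr p (rsites (sqrect 1)) (vacant (colK (sqrect 1) 0)) = 1 - p.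
  by rewrite Pr_vacant // (count_colK v1 (rsites_uniq _) sub1) // hei_sqrect expr1.
apply: le_trans (_ : Pr p (rsites (sqrect 1)) (fun w => ~ vacant (colK (sqrect 1) 0) w) <= _).
  by rewrite Pr_not e subKr.
apply: le_Pr => // w _ nv C cC wC [x y] bz.
apply: contrapT => nC; apply: nv => z; case: z => x' y'; rewrite /colK /= => /andP[/eqP ex hy] wz; apply: nC.
apply: wC.
have -> : (x, y) = (x', y') by move: bz; rewrite /box /= ex => bz; congr pair; lia.
split => //; rewrite /box /=; lia.
Qed.

Lemma sqprob_big m n : (0 < m)%N ->
  sqprob m = Pr p (rsites (sqrect (m + n))) (span_ev (sqrect m)).
Proof.
move=> m0; pose d (z : Z2) := (1 <= z.1 < m%:Z + 1) && (1 <= z.2 < m%:Z + 1).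
have dE z : d z <-> box (sqrect m) z by split => [/andP[]|[h1 h2]] //; apply/andP.
rewrite /sqprob [RHS]/Pr (@Ex_filter _ _ _ _ d); last first.
  have -> : [set z | d z] = box (sqrect m) by apply/seteqP; split=> z /dE.
  exact/depends_comp/span_ev_depends.
apply: Ex_perm; apply: uniq_perm; rewrite ?filter_uniq ?rsites_uniq //.
move=> z; rewrite mem_filter; apply/idP/andP.
  move=> /(mem_rsites _ (valid_sqrect m0)) bz; split; first exact/dE.
  by apply/mem_rsites; [apply: valid_sqrect; lia|move: bz; rewrite /box /=; lia].
by case=> /dE bz _; apply/mem_rsites => //; exact: valid_sqrect.
Qed.

(** [t] is the smaller of the two strip probabilities, both of which obey the bound of
    [traversable_ge]. *)
Lemma sqprob_step m n : (0 < m)%N -> (0 < n)%N ->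
  exists2 t : R, sqprob m * (t * t) <= sqprob (m + n) &
    0 <= t /\ occ_pr p m * beta p m ^+ n <= beta p m * t.
Proof.
move=> m0 n0; set s := rsites (sqrect (m + n)).
have us : uniq s by exact: rsites_uniq.
have vs := valid_strip m0 n0.
have vbig : valid (sqrect (m + n)) by apply: valid_sqrect; rewrite addn_gt0 m0.
have flip_inj : injective flip := inv_inj flipK.
have inS (K : rect) : subrect K (sqrect (m + n)) -> box K `<=` [set` s].
  move=> KS z bz; apply/mem_rsites => //; move: KS bz; rewrite /subrect /box /=; lia.
have sub1 : subrect (strip m n) (sqrect (m + n)) by rewrite /subrect /=; lia.
have sub2 : subrect (flipr (strip m n)) (sqrect (m + n)) by rewrite /subrect /=; lia.
have [bE u0 ub b1] := betaP p_gt0 p_le m0.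
have Pcol j : (j < n)%N -> Pr p s (vacant (colK (strip m n) j)) = 1 - occ_pr p m.
  move=> jn; rewrite Pr_vacant // count_colK ?hei_strip ?wid_strip ?occ_prE //.
  exact: inS.
have Prow j : (j < n)%N -> Pr p s (vacant (rowK (strip m n) j)) = 1 - occ_pr p m.
  move=> jn; rewrite Pr_vacant // (_ : count _ s = count (colK (strip m n) j) (map flip s)).
    rewrite count_colK ?hei_strip ?wid_strip ?occ_prE ?map_inj_uniq // => z bz.
    apply/mapP; exists (flip z); rewrite ?flipK //; apply: (inS _ sub2).
    by rewrite box_flip /= flipK.
  by rewrite count_map.
have rowK_inj i j z : rowK (strip m n) i z -> rowK (strip m n) j z -> i = j.
  exact: colK_inj.
have tcol := traversable_ge p01 (@colK_inj (strip m n)) Pcol u0 ub b1 bE (leqnn n).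
have trow := traversable_ge p01 rowK_inj Prow u0 ub b1 bE (leqnn n).
set t1 := Pr p s _ in tcol; set t2 := Pr p s _ in trow.
have b0 : 0 < beta p m by exact: lt_le_trans ub.
have t10 : 0 <= t1 by exact: Pr_ge0.
have t20 : 0 <= t2 by exact: Pr_ge0.
have main : sqprob m * (t1 * t2) <= sqprob (m + n).
  rewrite (sqprob_big n m0) -/s.
  have dcol : depends (east m) (traversable (colK (strip m n)) n).
    by apply: (depends_sub _ (@traversable_depends _ _ _)); exact: cols_east.
  have drow : depends (north m) (traversable (rowK (strip m n)) n).
    by apply: (depends_sub _ (@traversable_depends _ _ _)); exact: rows_north.
  rewrite -(@Pr_indep _ _ p s (east m)) //; last first.
    by apply: (depends_sub _ drow); exact: north_east.
  rewrite -(@Pr_indep _ _ p s (box (sqrect m))); first last.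
  - apply: (depends_sub (@east_north_square m)).
    by apply: depends_and; [apply: (depends_sub _ dcol)|apply: (depends_sub _ drow)] => z;
      [left|right].
  - exact: span_ev_depends.
  by apply: le_Pr => // w _ [sp [tc tr]]; exact: square_growth.
case: (leP t1 t2) => t12.
  exists t1 => //; apply: le_trans main; rewrite ler_wpM2l ?Pr_ge0 // ler_wpM2l //.
exists t2 => //; apply: le_trans main; rewrite ler_wpM2l ?Pr_ge0 // ler_wpM2r // ltW //.
Qed.

Lemma sqprob_succ m : (0 < m)%N -> sqprob m * occ_pr p m ^+ 2 <= sqprob m.+1.
Proof.
move=> m0; have [t h [t0]] := sqprob_step m0 (ltn0Sn 0).
have [_ u0 ub _] := betaP p_gt0 p_le m0.
rewrite expr1 mulrC ler_pM2l; last exact: lt_le_trans ub.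
move=> ut; rewrite -(addn1 m); apply: le_trans h; rewrite ler_wpM2l ?Pr_ge0 // expr2.
by apply: ler_pM => //; exact: ltW.
Qed.

Lemma sqprob_block m n N : (0 < m)%N -> (n <= N)%N ->
  sqprob m * (occ_pr p m * beta p m ^+ N) ^+ 2 <= sqprob (m + n).
Proof.
move=> m0 nN; have [_ u0 ub b1] := betaP p_gt0 p_le m0.
have b0 : 0 < beta p m by exact: lt_le_trans ub.
have ubN : 0 <= occ_pr p m * beta p m ^+ N by rewrite mulr_ge0 ?exprn_ge0 // ltW.
have s0 : 0 <= sqprob m by exact: Pr_ge0.
case: n nN => [|n] nN.
  rewrite addn0 ler_piMr // exprn_ile1 // mulr_ile1 ?exprn_ge0 ?exprn_ile1 ?(ltW b0) ?(ltW u0) //.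
  exact: le_trans ub b1.
have [t h [t0 ht]] := sqprob_step m0 (ltn0Sn n).
apply: le_trans h; rewrite ler_wpM2l // expr2.
suff : occ_pr p m * beta p m ^+ N <= t by move=> ut; apply: ler_pM.
apply: (@le_trans _ _ (occ_pr p m * beta p m ^+ n.+1)).
  by rewrite ler_wpM2l ?(ltW u0) // ler_wiXn2l // ltW.
by apply: le_trans ht _; rewrite ler_piMl.
Qed.

End GrowthProbability.

(** * Growth from one site by blocks *)

Section BlockGrowth.
Variables (R : realType) (p h0 : R) (N : nat).
Hypothesis p_gt0 : 0 < p.
Hypothesis p_le : p <= 1 / 2.
Hypothesis h0_gt0 : 0 < h0.
Hypothesis N_gt0 : (0 < N)%N.
Hypothesis h0N : h0 <= rate p * N%:R.
Hypothesis N1 : rate p * N%:R <= 1.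
Let u := occ_pr p.
Let b := beta p.

(** One occupied site, N unit enlargements, then i blocks of length N whose cost is frozen at the
    side where the block starts. The squares count the two strips, east and north. *)
Definition sqprob_lower (i : nat) : R :=
  p * (\prod_(k < N) u k.+1) ^+ 2 * (\prod_(l < i) (u (l.+1 * N) * b (l.+1 * N) ^+ N)) ^+ 2.

Let q0 : 0 < rate p. Proof. exact: rate_gt0. Qed.

Let ub k : (0 < k)%N -> [/\ 0 < u k, u k <= b k, u k <= 1 & b k <= 1].
Proof.
move=> k0; have [_ h1 h2 h3] := betaP p_gt0 p_le k0; split => //; exact: le_trans h2 h3.
Qed.

Let start m : p * (\prod_(k < m) u k.+1) ^+ 2 <= sqprob p m.+1.
Proof.
elim: m => [|m IH]; first by rewrite big_ord0 expr1n mulr1; exact: sqprob_ge1.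
rewrite big_ord_recr /= exprMn mulrA.
by apply: le_trans (sqprob_succ p_gt0 p_le (ltn0Sn m)); rewrite ler_wpM2r // sqr_ge0.
Qed.

Let block l : (0 <= u (l.+1 * N) * b (l.+1 * N) ^+ N <= 1).
Proof.
have [u0 u1 u2 b1] := @ub (l.+1 * N) (ltac:(by rewrite muln_gt0)).
have b0 : 0 <= b (l.+1 * N) by rewrite (le_trans (ltW u0)).
by rewrite mulr_ge0 ?exprn_ge0 ?(ltW u0) //= mulr_ile1 ?exprn_ge0 ?exprn_ile1 // ltW.
Qed.

Let lower_ge0 i : 0 <= sqprob_lower i.
Proof.
apply: mulr_ge0; last exact: sqr_ge0.
by apply: mulr_ge0; [exact: ltW|exact: sqr_ge0].
Qed.

(** All factors are at most 1, so the full product also bounds squares reached earlier or in the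
    middle of a block. *)
Lemma sqprob_lower_le i m : (0 < m <= i.+1 * N)%N -> sqprob_lower i <= sqprob p m.
Proof.
elim: i m => [|i IH] m /andP[m0 mi].
  rewrite /sqprob_lower big_ord0 expr1n mulr1; case: m m0 mi => // m _ mN.
  rewrite mul1n in mN.
  apply: le_trans (start m); rewrite ler_wpM2l ?(ltW p_gt0) // lerXn2r ?nnegrE //.
  - by apply: prodr_ge0 => k _; have [/ltW] := ub (ltn0Sn k).
  - by apply: prodr_ge0 => k _; have [/ltW] := ub (ltn0Sn k).
  - rewrite -(subnKC (ltnW mN)) big_split_ord /= ler_piMr //.
      by apply: prodr_ge0 => k _; have [/ltW] := ub (ltn0Sn k).
    apply: prodr_ile1 => k _; have [/ltW h1 _ h2 _] := ub (ltn0Sn (m + k)).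
    by rewrite h1 h2.
have lowerS : sqprob_lower i.+1 = sqprob_lower i * (u (i.+1 * N) * b (i.+1 * N) ^+ N) ^+ 2.
  by rewrite /sqprob_lower big_ord_recr /= exprMn mulrA.
have /andP[bl0 bl1] := block i.
rewrite lowerS; case: (leqP m (i.+1 * N)) => mi'.
  apply: le_trans (IH m _); last by rewrite m0.
  by rewrite ler_piMr ?lower_ge0 // exprn_ile1.
have iN : (0 < i.+1 * N)%N by rewrite muln_gt0.
have nN : (m - i.+1 * N <= N)%N by rewrite leq_subLR addnC -mulSn.
have := sqprob_block p_gt0 p_le iN nN; rewrite subnKC; last exact: ltnW.
apply: le_trans; rewrite ler_wpM2r ?sqr_ge0 //; apply: IH.
by rewrite iN /=.
Qed.

(** For q k <= 1, u(k) >= q k / 2; with N! >= (N / e)^N the product is at least (q N / (2 e))^N >=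
    (h0 / (2 e))^N. *)
Let prod_start : expR (- (N%:R * (1 + ln (2 / h0)))) <= \prod_(k < N) u k.+1.
Proof.
have uk k : (k < N)%N -> rate p / 2 * k.+1%:R <= u k.+1.
  move=> kN; rewrite /u /occ_pr.
  have x0 : 0 < rate p * k.+1%:R by rewrite mulr_gt0.
  have x1 : rate p * k.+1%:R <= 1.
    by apply: le_trans N1; rewrite ler_pM2l // ler_nat.
  rewrite expRN; have := expR_ge1Dx (rate p * k.+1%:R).
  have -> : rate p / 2 * k.+1%:R = rate p * k.+1%:R / 2 by rewrite mulrAC.
  move: (rate p * k.+1%:R) x0 x1 => x x0 x1 hx.
  have : (expR x)^-1 <= (1 + x)^-1 by rewrite lef_pV2 ?posrE ?expR_gt0 //; lra.
  suff : x / 2 <= 1 - (1 + x)^-1 by lra.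
  have x2 : 0 < 1 + x by lra.
  have -> : 1 - (1 + x)^-1 = x / (1 + x) by field; rewrite gt_eqF.
  by rewrite ler_wpM2l ?(ltW x0) // lef_pV2 ?posrE //; lra.
have fact_ge : N%:R ^+ N * expR (- N%:R) <= N`!%:R :> R.
  have := @expR_ge1Dxn R N%:R N.-1 (ler0n _ _); rewrite prednK // => h.
  rewrite expRN ler_pdivrMr ?expR_gt0 // mulrC -ler_pdivrMr ?ltr0n ?fact_gt0 //.
  by apply: le_trans h; rewrite lerDr.
have prodE : \prod_(k < N) (rate p / 2 * k.+1%:R) = (rate p / 2) ^+ N * N`!%:R.
  rewrite big_split /= prodr_const card_ord; congr (_ * _).
  elim: (N) => [|n IHn]; first by rewrite big_ord0.
  by rewrite big_ord_recr /= IHn factS mulnC natrM.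
apply: (@le_trans _ _ (\prod_(k < N) (rate p / 2 * k.+1%:R))); last first.
  apply: ler_prod => k _; rewrite uk // andbT mulr_ge0 //.
  by rewrite divr_ge0 // ltW.
rewrite prodE; apply: (@le_trans _ _ ((rate p / 2) ^+ N * (N%:R ^+ N * expR (- N%:R)))); last first.
  by rewrite ler_wpM2l // exprn_ge0 // divr_ge0 // ltW.
rewrite mulrA -exprMn mulrDr mulr1 opprD addrC expRD ler_wpM2r ?expR_ge0 //.
rewrite -mulrN -lnV ?posrE ?divr_gt0 // invf_div expRM_natl lnK ?posrE ?divr_gt0 //.
rewrite lerXn2r ?nnegrE ?mulr_ge0 ?divr_ge0 ?(ltW q0) ?(ltW h0_gt0) //.
by rewrite mulrAC ler_wpM2r.
Qed.

Let r := expR (- h0).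

Let r01 : 0 < r < 1.
Proof. by rewrite expR_gt0 expR_lt1 oppr_lt0. Qed.

(** With x = 1 - u, 1 / (1 - x) = 1 + x / (1 - x) <= exp(x / (1 - x)), and x <= r^(l+1) decays
    geometrically. *)
Let occ_block l : expR (- (r ^+ l.+1 / (1 - r))) <= u (l.+1 * N).
Proof.
have /andP[r0 r1] := r01.
set x := expR (- (rate p * (l.+1 * N)%:R)).
have xr : x <= r ^+ l.+1.
  rewrite /x /r -expRM_natl ler_expR mulrN lerN2 natrM mulrCA.
  by rewrite ler_wpM2l.
have xr1 : x <= r by rewrite (le_trans xr) // exprS ler_piMr ?(ltW r0) // exprn_ile1 // ltW.
have x0 : 0 < x by exact: expR_gt0.
have r2 : 0 < 1 - r by rewrite subr_gt0.
have x2 : 0 < 1 - x by rewrite subr_gt0 (le_lt_trans xr1).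
rewrite /u /occ_pr -/x expRN -[leRHS]invrK lef_pV2 ?posrE ?expR_gt0 ?invr_gt0 //.
have -> : (1 - x)^-1 = 1 + x / (1 - x) by field; rewrite gt_eqF.
apply: le_trans (expR_ge1Dx _) _; rewrite ler_expR.
by apply: ler_pM; rewrite ?invr_ge0 ?(ltW x0) ?(ltW x2) // lef_pV2 ?posrE // lerD2l lerN2.
Qed.

(** The factors u cost a geometric series, bounded whatever p and i are; the factors b form a
    Riemann sum of mesh q N, below lambda by [sum_gz_le], and dividing by the mesh gives lambda / p
    because q >= p. *)
Let prod_block i : expR (- ((1 - r)^-1 ^+ 2 + lambda R / p)) <=
  \prod_(l < i) (u (l.+1 * N) * b (l.+1 * N) ^+ N).
Proof.
have /andP[r0 r1] := r01; have r2 : 0 < 1 - r by rewrite subr_gt0.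
rewrite big_split /= opprD expRD; apply: ler_pM; rewrite ?expR_ge0 //.
  apply: (@le_trans _ _ (\prod_(l < i) expR (- (r ^+ l.+1 / (1 - r))))); last first.
    by apply: ler_prod => l _; rewrite expR_ge0 occ_block.
  rewrite -expR_sum ler_expR sumrN lerN2 -mulr_suml expr2 ler_wpM2r ?invr_ge0 ?(ltW r2) //.
  rewrite -[leRHS]mul1r ler_pdivlMr //.
  have -> : (\sum_(l < i) r ^+ l.+1) * (1 - r) = r - r ^+ i.+1.
    elim: i => [|i IH]; first by rewrite big_ord0 mul0r expr1 subrr.
    by rewrite big_ord_recr /= mulrDl IH [in RHS]exprS; ring.
  by rewrite lerBlDr (le_trans (ltW r1)) // lerDl exprn_ge0 // ltW.
have -> : \prod_(l < i) b (l.+1 * N) ^+ N = expR (- (N%:R * \sum_(l < i) gz (rate p * N%:R * l.+1%:R))).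
  rewrite mulr_sumr -sumrN expR_sum; apply: eq_bigr => l _.
  by rewrite /b (beta_exp p_gt0 p_le) natrM mulrA mulrAC.
rewrite ler_expR lerN2 ler_pdivlMr //.
have h1 : 0 < rate p * N%:R by rewrite (lt_le_trans h0_gt0).
apply: le_trans (sum_gz_le i h1); rewrite -mulr_sumr mulrAC ler_wpM2r //.
  by apply: sumr_ge0 => l _; rewrite ltW // gz_gt0 // mulr_gt0.
by rewrite mulrC ler_wpM2r // rate_ge.
Qed.

Lemma sqprob_lower_ge i : N%:R * p <= 2 * h0 ->
  expR (- ((p * ln p^-1 + 4 * h0 * (1 + ln (2 / h0)) + 2 * p * (1 - expR (- h0))^-1 ^+ 2
            + 2 * lambda R) / p)) <= sqprob_lower i.
Proof.
move=> Np; have p0 := p_gt0.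
set A := N%:R * (1 + ln (2 / h0)); set C := (1 - expR (- h0))^-1 ^+ 2.
have hA : p * A <= 2 * h0 * (1 + ln (2 / h0)).
  rewrite /A mulrA (mulrC p) ler_wpM2r // addr_ge0 // ln_ge0 // ler_pdivlMr // mul1r.
  by rewrite (le_trans h0N) // (le_trans N1) // ler1n.
have -> : sqprob_lower i = p * (\prod_(k < N) u k.+1 * \prod_(l < i) (u (l.+1 * N) * b (l.+1 * N) ^+ N)) ^+ 2.
  by rewrite exprMn mulrA.
apply: (@le_trans _ _ (p * (expR (- A) * expR (- (C + lambda R / p))) ^+ 2)); last first.
  rewrite ler_wpM2l ?(ltW p0) // lerXn2r ?nnegrE ?mulr_ge0 ?expR_ge0 //.
  - by apply: prodr_ge0 => k _; have [/ltW] := ub (ltn0Sn k).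
  - by apply: prodr_ge0 => l _; have /andP[] := block l.
  - by apply: ler_pM; rewrite ?expR_ge0 ?prod_start ?prod_block.
have pE : expR (- ln p^-1) = p by rewrite lnV ?posrE // opprK lnK ?posrE.
rewrite -[X in _ <= X * _]pE -expRD -expRM_natl -expRD ler_expR.
rewrite -(ler_pM2l p0).
have -> : p * - ((p * ln p^-1 + 4 * h0 * (1 + ln (2 / h0)) + 2 * p * C + 2 * lambda R) / p) =
   - (p * ln p^-1 + 4 * h0 * (1 + ln (2 / h0)) + 2 * p * C + 2 * lambda R).
  by rewrite mulrN mulrC divfK // gt_eqF.
have -> : p * (- ln p^-1 + 2 * (- A + - (C + lambda R / p))) =
   - (p * ln p^-1 + 2 * (p * A) + 2 * p * C + 2 * lambda R).
  move: (ln p^-1) A C (lambda R) {hA} => x a c y; field; by rewrite gt_eqF.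
rewrite lerN2 !lerD2r lerD2l.
move: hA; move: (p * A) (1 + ln (2 / h0)) => x y; lra.
Qed.

End BlockGrowth.

(** * The upper bound on the cost *)

Section Limsup.
Variable R : realType.

Lemma start_cost_small (e : R) : 0 < e ->
  exists2 h : R, 0 < h /\ h <= 1 / 2 & 4 * h * (1 + ln (2 / h)) <= e.
Proof.
move=> e0; pose d : R := e / 16; have d0 : 0 < d by rewrite divr_gt0.
pose l : R := `|ln d^-1|; have l0 : 0 <= l by rewrite /l.
pose y : R := Num.min (1 / 4) (d / (1 + l)).
have l1 : 0 < 1 + l by rewrite ltr_pwDl.
have y0 : 0 < y by rewrite /y lt_min divr_gt0 //= divr_gt0.
have y1 : y <= 1 / 4 by rewrite /y ge_min lexx.
have yd : y * (1 + l) <= d by rewrite -ler_pdivlMr // /y ge_min lexx orbT.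
have h := p_ln_le y0 d0; rewrite -/l in h.
(* With h = 2 y the logarithm becomes ln (1/y), to which [p_ln_le] applies. *)
exists (2 * y); first by split; [rewrite mulr_gt0|clearbody y; lra].
have -> : 2 / (2 * y) = y^-1 by rewrite invfM mulrA divff ?mul1r.
have ed : e = 16 * d by rewrite /d mulrC divfK.
rewrite ed; clearbody y l d; move: (ln y^-1) h => x h; nra.
Qed.

Lemma span_prob_limsup (e : R) : 0 < e -> \forall p \near 0^'+, forall m, (0 < m)%N ->
  (- p%:E * lne (span_prob m p) <= (2 * lambda R + e)%:E)%E.
Proof.
move=> e0; have e3 : 0 < e / 3 by rewrite divr_gt0.
have [h [h0 h12] hE] := start_cost_small e3.
pose C : R := (1 - expR (- h))^-1 ^+ 2.
have C0 : 0 <= C by exact: sqr_ge0.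
pose d : R := e / 6; have d0 : 0 < d by rewrite divr_gt0.
pose l : R := `|ln d^-1|; have l0 : 0 <= l by rewrite /l.
have l1 : 0 < l + 1 by rewrite ltr_wpDl.
have C1 : 0 < 2 * C + 1 by rewrite ltr_wpDl // mulr_ge0.
have nb (x : R) : 0 < x -> \forall p \near 0^'+, p <= x by exact: nbhs_right_le.
near=> p.
have p0 : 0 < p by near: p; exact: nbhs_right_gt.
have p2 : p <= 1 / 2 by near: p; apply: nb; rewrite divr_gt0.
have ph : 2 * p <= h.
  by rewrite -ler_pdivlMl // mulrC; near: p; apply: nb; rewrite divr_gt0.
have pl : p * (l + 1) <= d by rewrite -ler_pdivlMr //; near: p; apply: nb; rewrite divr_gt0.
have pC : p * (2 * C + 1) <= e / 3 by rewrite -ler_pdivlMr //; near: p; apply: nb; rewrite divr_gt0.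
have p01 : 0 <= p <= 1 by rewrite ltW //= (le_trans p2) // ler_pdivrMr // mul1r ler1n.
move=> m m0; rewrite span_probE //.
have q0 := rate_gt0 p0 p2; have q1 := rate_ge p0 p2; have q2 := rate_le2 p0 p2.
(* Rounding up makes the mesh q N at least h; it stays below 2 h because q <= 2 p <= h. *)
pose N := (Num.truncn (h / rate p)).+1.
have hN : h <= rate p * N%:R by rewrite mulrC -ler_pdivrMr // ltW // truncnS_gt.
have hN2 : rate p * N%:R <= 2 * h.
  rewrite /N -natr1 mulrDr mulr1 mulr_natl mulr2n; apply: lerD; last exact: le_trans q2 ph.
  by rewrite mulrC -ler_pdivlMr // truncn_le // divr_ge0 // ltW.
have N1 : rate p * N%:R <= 1 by apply: le_trans hN2 _; rewrite -ler_pdivlMl // mulrC.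
have Np : N%:R * p <= 2 * h by apply: le_trans hN2; rewrite mulrC ler_wpM2r.
(* Taking m blocks certainly reaches side m, and the bound of [sqprob_lower_ge] is independent of
   the number of blocks: hence the uniformity in m. *)
have mN : (0 < m <= m.+1 * N)%N by rewrite m0 (leq_trans (leqnSn m)) // leq_pmulr.
apply: neg_lne_le => //; rewrite -/(sqprob p m).
apply: le_trans (sqprob_lower_le p0 p2 (ltn0Sn _) mN).
apply: le_trans (sqprob_lower_ge p0 p2 h0 (ltn0Sn _) hN N1 m Np).
rewrite ler_expR lerN2 ler_pM2r ?invr_gt0 // addrC lerD2l -/C.
have hl := p_ln_le p0 d0; rewrite -/l in hl.
have -> : e = e / 3 + e / 3 + e / 3 by lra.
apply: lerD; [apply: lerD => //|].
  apply: le_trans hl _; apply: (@le_trans _ _ (d + d)); last by rewrite /d; lra.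
  by rewrite lerD2l (le_trans _ pl) // ler_wpM2l ?(ltW p0) // lerDl.
by apply: le_trans pC; rewrite mulrDr mulr1 (mulrC 2) -mulrA lerDl ltW.
Unshelve. all: by end_near.
Qed.

End Limsup.

Lemma limf_esup_le (R : realType) (T : choiceType) (X : filteredType T) (f : X -> \bar R)
  (F : set (set X)) (x : \bar R) :
  F [set u | (f u <= x)%E] -> (limf_esup f F <= x)%E.
Proof.
move=> h; rewrite limf_esupE; apply: ge_ereal_inf.
exists (ereal_sup (f @` [set u | (f u <= x)%E])); first by exists [set u | (f u <= x)%E].
by apply: ge_ereal_sup => _ [u ux <-].
Qed.

Lemma limf_einf_ge (R : realType) (T : choiceType) (X : filteredType T) (f : X -> \bar R)
  (F : set (set X)) (x : \bar R) :
  F [set u | (x <= f u)%E] -> (x <= limf_einf f F)%E.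
Proof.
move=> h; rewrite limf_einfE; apply: le_ereal_sup_tmp.
exists (ereal_inf (f @` [set u | (x <= f u)%E])); first by exists [set u | (x <= f u)%E].
by apply: le_ereal_inf_tmp => _ [u ux <-].
Qed.

Theorem theorem2 (R : realType) :
  (limf_esup (fun p : R =>
      ereal_sup [set (- p%:E * lne (span_prob m p))%E | m in [set m | (1 <= m)%N]])
     0^'+ <= (2 * lambda R)%:E)%E
  /\
  ((2 * lambda R)%:E <=
    limf_einf (fun B : R =>
      limf_einf (fun p : R =>
        (- p%:E * lne (span_prob (Num.truncn (B / p)) p))%E) 0^'+) +oo%R)%E.
Proof.
split; [apply/lee_addgt0Pr => e e0|apply/lee_subgt0Pr => e e0].
  apply: limf_esup_le; near=> p.
  apply: ge_ereal_sup => _ [m m0 <-]; rewrite -EFinD; move: m m0.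
  by near: p; exact: span_prob_limsup.
have [B0 B00 h] := span_prob_liminf e0.
apply: limf_einf_ge; near=> B; apply: limf_einf_ge; rewrite -EFinB; apply: h.
by near: B; apply: nbhs_pinfty_ge; exact: num_real.
Unshelve. all: by end_near.
Qed.
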